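(* Let $N \ge 1$ and $p \in (1,\infty)$. Then there exists a constant $C = C(N,p) > 0$ such that for every $s \in (0,1)$ and every $f \in \mathscr{S}(\mathbb{R}^N)$: (1) if $1 < p \leq 2$, then $$C^{-1} \left(\frac{1}{s^{1/2}} + \frac{1}{(1-s)^{1/2}}\right) [f]_{\dot{F}^{s}_{p,p}(\mathbb{R}^N)} \leq [f]_{\dot W^{s,p}(\mathbb{R}^N)} \leq C \left(\frac{1}{s^{1/p}} + \frac{1}{(1-s)^{1/p}}\right) [f]_{\dot{F}^{s}_{p,p}(\mathbb{R}^N)};$$ (2) if $2 \leq p < \infty$, then $$C^{-1} \left(\frac{1}{s^{1/p}} + \frac{1}{(1-s)^{1/p}}\right) [f]_{\dot{F}^{s}_{p,p}(\mathbb{R}^N)} \leq [f]_{\dot W^{s,p}(\mathbb{R}^N)} \leq C \left(\frac{1}{s^{1/2}} + \frac{1}{(1-s)^{1/2}}\right) [f]_{\dot{F}^{s}_{p,p}(\mathbb{R}^N)}.$$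
   Context: $\mathscr{S}(\mathbb{R}^N)$ is the space of Schwartz functions on $\mathbb{R}^N$, and $\mathcal{F}f(\xi)=\int_{\mathbb{R}^N} f(x)e^{-ix\cdot\xi}\,dx$ is the Fourier transform. Littlewood-Paley projections: fix once and for all a real-valued $\eta \in \mathscr{S}(\mathbb{R}^N)$ with $\eta(-z)=\eta(z)$ and $\mathcal{F}\eta(\xi)=\mathcal{F}\eta_0(\xi)-\mathcal{F}\eta_0(2\xi)$, where $\eta_0$ is a Schwartz function with $\mathcal{F}\eta_0(\xi)=1$ for $|\xi|\le 1$ and $\mathcal{F}\eta_0(\xi)=0$ for $|\xi|\ge 2$. For $j \in \mathbb{Z}$ put $\Delta_j f := f * [2^{jN}\eta(2^j\,\cdot)]$. (Constants may depend on this fixed choice of $\eta$.) Homogeneous Triebel-Lizorkin seminorm: for $s\in\mathbb{R}$, $p,q\in(1,\infty)$, $$[f]_{\dot{F}^{s}_{p,q}(\mathbb{R}^N)} := \left(\int_{\mathbb{R}^N} \Big(\sum_{j \in \mathbb{Z}} 2^{jsq} |\Delta_j f(x)|^q\Big)^{p/q} dx\right)^{1/p}.$$ Gagliardo seminorm: for $s\in(0,1)$, $p\in(1,\infty)$, $$[f]_{\dot W^{s,p}(\mathbb{R}^N)} := \left(\int_{\mathbb{R}^N}\int_{\mathbb{R}^N} \frac{|f(x)-f(y)|^p}{|x-y|^{N+sp}}\, dx\, dy\right)^{1/p}.$$ *)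

(* Defs.v *)
From HB Require Import structures.
From mathcomp Require Import all_boot all_order all_algebra.
From mathcomp Require Import all_classical all_reals all_analysis.
From mathcomp Require Import complex.
Set Implicit Arguments.
Unset Strict Implicit.
Unset Printing Implicit Defensive.
Import Order.TTheory GRing.Theory Num.Theory.
Import numFieldNormedType.Exports.
Local Open Scope classical_set_scope.
Local Open Scope ring_scope.

(* R^n is 'rV[R]_n, whose topology and derivatives come from the library. It
   receives the product sigma-algebra (the one generated by the coordinates,
   which on R^n is the Borel sigma-algebra), as the library does for tuples. *)
Definition rV_display : measure_display -> measure_display.
Proof. exact. Qed.

Section measurable_rV.
Context {d} {T : sigmaRingType d}.
Variable n : nat.

Let coord : 'I_n -> 'rV[T]_n -> T := fun i x => x 0 i.

Let rV_set0 : g_sigma_preimage coord set0.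
Proof. exact: sigma_algebra0. Qed.

Let rV_setC A : g_sigma_preimage coord A -> g_sigma_preimage coord (~` A).
Proof. exact: sigma_algebraC. Qed.

Let rV_bigcup (F : _^nat) : (forall i, g_sigma_preimage coord (F i)) ->
  g_sigma_preimage coord (\bigcup_i (F i)).
Proof. exact: sigma_algebra_bigcup. Qed.

HB.instance Definition _ := @isMeasurable.Build (rV_display d)
  'rV[T]_n (g_sigma_preimage coord) rV_set0 rV_setC rV_bigcup.

Lemma measurable_coord (i : 'I_n) :
  measurable_fun [set: 'rV[T]_n] (fun x : 'rV[T]_n => x 0 i).
Proof.
move=> _ Y mY; rewrite setTI; apply: sub_sigma_algebra => /=.
rewrite -bigcup_seq/=; exists i => /=; first by rewrite mem_index_enum.
by exists Y => //; rewrite setTI.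
Qed.

End measurable_rV.

Lemma measurable_fun_rVP d1 d2 (T1 : measurableType d1)
    (T2 : measurableType d2) n (f : T1 -> 'rV[T2]_n) :
  (forall i, measurable_fun [set: T1] (fun x => f x 0 i)) ->
  measurable_fun [set: T1] f.
Proof.
move=> mf _ A mA; rewrite setTI; move: A mA.
pose G := [set A : set 'rV[T2]_n | measurable (f @^-1` A)].
suff : measurable `<=` G by [].
apply: smallest_sub => //.
  split; rewrite /G /=.
  - by rewrite preimage_set0; exact: measurable0.
  - by move=> A; rewrite setTD preimage_setC; exact: measurableC.
  - by move=> F mF; rewrite preimage_bigcup; exact: bigcupT_measurable.
elim/big_ind : _ => // [B C BG CG|i _ _ [B mB <-]]; first by rewrite subUset.
by rewrite /G /= setTI; have := mf i measurableT _ mB; rewrite setTI.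
Qed.

Section lebesgue_measure_rV.
Variable R : realType.

Definition rV_cons n (z : R * 'rV[R]_n) : 'rV[R]_n.+1 :=
  row_mx (z.1%:M : 'M[R]_1) z.2.

Definition rV_uncons n (x : 'rV[R]_n.+1) : R * 'rV[R]_n :=
  (x 0 0, @rsubmx R 1 1 n x).

Lemma rV_consK n : cancel (@rV_cons n) (@rV_uncons n).
Proof.
move=> [a v]; rewrite /rV_cons /rV_uncons /=; congr (_, _).
  rewrite (_ : 0 = lshift n 0 :> 'I_(1 + n)); last exact/val_inj.
  by rewrite (row_mxEl (a%:M : 'M[R]_1) v) mxE eqxx mulr1n.
exact: row_mxKr.
Qed.

Lemma measurable_rV_cons n :
  measurable_fun [set: (measurableTypeR R * 'rV[R]_n)%type] (@rV_cons n).
Proof.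
apply: measurable_fun_rVP => i.
have [j ->|j ->] := @split_ordP 1 n i.
  rewrite (_ : (fun _ => _) = fst) //; apply/funext => -[a v].
  by rewrite /rV_cons (row_mxEl (a%:M : 'M[R]_1) v) ord1 mxE eqxx mulr1n.
rewrite (_ : (fun _ => _) = (fun v : 'rV[R]_n => v 0 j) \o snd).
  by apply: measurableT_comp => //; exact: measurable_coord.
by apply/funext => -[a v]; rewrite /rV_cons (row_mxEr (a%:M : 'M[R]_1) v).
Qed.

Lemma measurable_rV_uncons n : measurable_fun setT (@rV_uncons n).
Proof.
apply/measurable_fun_pairP; split; first exact: measurable_coord.
apply: measurable_fun_rVP => i.
rewrite (_ : (fun _ => _) = fun x : 'rV[R]_n.+1 => x 0 (rshift 1 i)).
  exact: measurable_coord.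
by apply/funext => x; rewrite /= mxE.
Qed.

(* n-fold product of the one-dimensional Lebesgue measure *)
Fixpoint lebesgue_rV n : set 'rV[R]_n -> \bar R :=
  if n is n'.+1 then
    pushforward (@lebesgue_measure R \x @lebesgue_rV n')%E (@rV_cons n')
  else dirac (0 : 'rV[R]_0).

Section lebesgue_rV_step.
Variables (n : nat) (m : {sigma_finite_measure set 'rV[R]_n -> \bar R}).

Let P :
    {measure set (measurableTypeR R * 'rV[R]_n)%type -> \bar R} :=
  (@lebesgue_measure R \x m)%E.

Let P_sigma_finite : sigma_finite setT P.
Proof.
have /sigma_finiteP[F [TF ndF Foo]] := sigma_finiteT (@lebesgue_measure R).
have /sigma_finiteP[G [TG ndG Goo]] := sigma_finiteT m.
exists (fun k => F k `*` G k).
  rewrite -setXTT TF TG; apply/seteqP; split => -[x y].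
    move=> [/= [k _ Fkx] [l _ Gly]]; exists (maxn k l) => //; split.
    - by move: x Fkx; exact/subsetPset/ndF/leq_maxl.
    - by move: y Gly; exact/subsetPset/ndG/leq_maxr.
  by move=> [k _ []/= ? ?]; split; exists k.
move=> k; have [mF Fk] := Foo k; have [mG Gk] := Goo k.
split; first exact: measurableX.
by rewrite /P /= product_measure1E// lte_mul_pinfty// ge0_fin_numE.
Qed.

Let Q := pushforward P (@rV_cons n).
Let Qm : {measure set 'rV[R]_n.+1 -> \bar R} :=
  measure_function_pushforward__canonical__measure_function_Measure P
    (@measurable_rV_cons n).

Let Q0 : Q set0 = 0%E. Proof. exact: (measure0 Qm). Qed.

Let Q_ge0 A : (0 <= Q A)%E. Proof. exact: (measure_ge0 Qm). Qed.

Let Q_sigma_additive : semi_sigma_additive Q.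
Proof. exact: (@measure_semi_sigma_additive _ _ _ Qm). Qed.

HB.instance Definition _ := isMeasure.Build _ _ _ Q
  Q0 Q_ge0 Q_sigma_additive.

Let Q_sigma_finite : sigma_finite setT Q.
Proof.
have [F TF PF] := P_sigma_finite.
exists (fun k => @rV_uncons n @^-1` F k).
  by rewrite -preimage_bigcup -TF preimage_setT.
move=> k; have [mF PFk] := PF k; split.
  by rewrite -[X in measurable X]setTI; exact: measurable_rV_uncons.
rewrite /Q /= /pushforward (_ : _ @^-1` _ = F k) //.
by apply/seteqP; split => z /=; rewrite rV_consK.
Qed.

HB.instance Definition _ := Measure_isSigmaFinite.Build _ _ _ Q Q_sigma_finite.

Lemma lebesgue_rV_step :
  exists m' : {sigma_finite_measure set 'rV[R]_n.+1 -> \bar R},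
    pushforward (@lebesgue_measure R \x m)%E (@rV_cons n) = m'.
Proof. by exists Q. Qed.

End lebesgue_rV_step.

Lemma lebesgue_rV_sigma_finite_measure n :
  exists m : {sigma_finite_measure set 'rV[R]_n -> \bar R},
    @lebesgue_rV n = m.
Proof.
elim: n => [|n [m mE]] /=; first by exists (dirac (0 : 'rV[R]_0)).
by rewrite mE; exact: lebesgue_rV_step.
Qed.

Let lebesgue_rV0 n : @lebesgue_rV n set0 = 0%E.
Proof. by have [m ->] := lebesgue_rV_sigma_finite_measure n. Qed.

Let lebesgue_rV_ge0 n (A : set 'rV[R]_n) : (0 <= lebesgue_rV A)%E.
Proof. by have [m ->] := lebesgue_rV_sigma_finite_measure n. Qed.

Let lebesgue_rV_sigma_additive n : semi_sigma_additive (@lebesgue_rV n).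
Proof.
have [m ->] := lebesgue_rV_sigma_finite_measure n.
exact: measure_semi_sigma_additive.
Qed.

HB.instance Definition _ n := isMeasure.Build _ _ _ (@lebesgue_rV n)
  (@lebesgue_rV0 n) (lebesgue_rV_ge0 (n:=n)) (@lebesgue_rV_sigma_additive n).

Let lebesgue_rV_sigma_finite n : sigma_finite setT (@lebesgue_rV n).
Proof.
by have [m ->] := lebesgue_rV_sigma_finite_measure n; exact: sigma_finiteT.
Qed.

HB.instance Definition _ n := Measure_isSigmaFinite.Build _ _ _
  (@lebesgue_rV n) (@lebesgue_rV_sigma_finite n).

End lebesgue_measure_rV.

Section schwartz.
Variables (R : realType) (N : nat).
Implicit Types (x y xi : 'rV[R]_N).

Definition dotv x y : R := \sum_(i < N) x 0 i * y 0 i.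

(* the library norm `|x| on 'rV[R]_N is the sup norm *)
Definition eucl x : R := Num.sqrt (dotv x x).

(* The directions are listed with repetitions: [:: i1; ..; ik] stands for
   d_{i1} .. d_{ik}. *)
Definition partials (l : seq 'I_N) (g : 'rV[R]_N -> R) : 'rV[R]_N -> R :=
  foldr (fun i h => 'D_(delta_mx 0 i) h) g l.

Definition smooth (g : 'rV[R]_N -> R) : Prop :=
  forall l : seq 'I_N, continuous (partials l g) /\
    forall (i : 'I_N) x, derivable (partials l g) x (delta_mx 0 i).

Definition real_schwartz (g : 'rV[R]_N -> R) : Prop :=
  smooth g /\
  forall (k : nat) (l : seq 'I_N), exists M : R,
    forall x, eucl x ^+ k * `|partials l g x| <= M.

Definition schwartz (f : 'rV[R]_N -> R[i]) : Prop :=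
  real_schwartz (fun x => complex.Re (f x)) /\
  real_schwartz (fun x => complex.Im (f x)).

Local Notation mu := (@lebesgue_rV R N).

Definition cintegral (f : 'rV[R]_N -> R[i]) : R[i] :=
  Complex (\int[mu]_x complex.Re (f x)) (\int[mu]_x complex.Im (f x)).

Definition cis (t : R) : R[i] := Complex (cos t) (sin t).

Definition fourier (f : 'rV[R]_N -> R[i]) xi : R[i] :=
  cintegral (fun x => f x * cis (- dotv x xi)).

Definition convolution (f g : 'rV[R]_N -> R[i]) x : R[i] :=
  cintegral (fun y => f (x - y) * g y).

Definition littlewood_paley_kernel (eta : 'rV[R]_N -> R) : Prop :=
  [/\ real_schwartz eta,
      forall z, eta (- z) = eta z &
      exists eta0 : 'rV[R]_N -> R[i],
        [/\ schwartz eta0,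
            forall xi, eucl xi <= 1 -> fourier eta0 xi = 1,
            forall xi, 2 <= eucl xi -> fourier eta0 xi = 0 &
            forall xi, fourier (fun x => (eta x)%:C%C) xi =
                       fourier eta0 xi - fourier eta0 (2 *: xi)]].

Definition lp_projection (eta : 'rV[R]_N -> R) (j : int)
    (f : 'rV[R]_N -> R[i]) : 'rV[R]_N -> R[i] :=
  convolution f
    (fun z => ((2 : R) ^ (j * N%:Z) * eta ((2 : R) ^ j *: z))%:C%C).

(* [f]_{F^s_{p,q}}, with values in [0, +oo] *)
Definition triebel_lizorkin (eta : 'rV[R]_N -> R) (s p q : R)
    (f : 'rV[R]_N -> R[i]) : \bar R :=
  ((\int[mu]_x (\esum_(j in [set: int])
      ((2 : R) `^ (j%:~R * s * q)
        * Normc.normc (lp_projection eta j f x) `^ q)%:E) `^ (p / q)) `^ p^-1)%E.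

(* [f]_{W^{s,p}}, with values in [0, +oo]; for p > 0 the integrand
   takes the value 0 on the diagonal x = y, which is a null set. *)
Definition gagliardo (s p : R) (f : 'rV[R]_N -> R[i]) : \bar R :=
  ((\int[mu]_y \int[mu]_x
      (Normc.normc (f x - f y) `^ p / eucl (x - y) `^ (N%:R + s * p))%:E)
    `^ p^-1)%E.

End schwartz.

(* Main.v *)
From HB Require Import structures.
Require Import Defs.
From mathcomp Require Import all_boot all_order all_algebra.
From mathcomp Require Import all_classical all_reals all_analysis.
From mathcomp Require Import measurable_realfun complex.
From mathcomp Require Import ring lra zify.
Import Order.TTheory GRing.Theory Num.Theory.
Import numFieldNormedType.Exports.
Local Open Scope classical_set_scope.
Local Open Scope ring_scope.
Set Implicit Arguments.
Unset Strict Implicit.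
Unset Printing Implicit Defensive.
(** By Tonelli both seminorms reduce to real [f]: the Triebel-Lizorkin seminorm to the
    numbers [2 ^ (j s) |D_j f|_p], the Gagliardo seminorm to the [L^p] norms of the
    increments [f (. + h) - f]. The dependence on [s] comes from the two-sided square
    function estimates
      [sum_j |D_j g|_p ^ max(p, 2) <= C |g|_p ^ max(p, 2)]  and
      [|g|_p ^ min(p, 2) <= C sum_j |D_j g|_p ^ min(p, 2)],
    applied to the increments [g] of [f], for which [|D_j g|_p] behaves like
    [min (1, 2 ^ j |h|) |D_j f|_p]. The first follows from the uniform convexity of [L^p]
    along a chain of averages of [g] at dyadic scales, the second from the first by duality.
    Jensen's inequality with the weights
    [min (1, 2 ^ j |h|) ^ q (2 ^ j |h|) ^ (- s q)], of total mass comparable to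
    [1 / s + 1 / (1 - s)], then exchanges the exponents [q] and [p]. *)

(** * Linear changes of variable *)

(** No Calderon-Zygmund theory, interpolation or maximal function is used. The exponent 2 of the
    theorem is the power type [max(p, 2)] of uniform convexity: convolution with an even probability
    density averages midpoints, so each averaging step loses a definite part of [|g|_p ^ max(p, 2)],
    and the losses telescope. They measure increments of averages, not Littlewood-Paley pieces;
    almost orthogonality, with decay [2 ^ - |j - k|], passes from one to the other. The kernel [eta]
    is prescribed only through its Fourier transform, while all estimates are made in physical
    space. A few identities linking [eta] to a scaling function [phi] carry the information across.
    Constants must not depend on [s]. Hence sums over scales without [scale_weight] are bounded with
    exponents that stay at least 1 as [s] tends to 0, and window lengths that depend on [s] never
    enter a constant. *)

Section affine.
Variable R : realType.
Local Notation leb := (@lebesgue_measure R).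
Local Open Scope ereal_scope.

(** Lebesgue measure is determined by its values on half-open intervals, and [|a|] times its image
    under [phi] has the right ones. For [a < 0] the preimage of []x, y]] is closed on the left
    instead, which does not change its length. *)
Lemma integral_affine_R (a b : R) (f : measurableTypeR R -> \bar R) : (a != 0)%R ->
  measurable_fun setT f -> (forall x, 0 <= f x) ->
  \int[leb]_x f x = `|a|%:E * \int[leb]_x f (a * x + b)%R.
Proof.
move=> a0 mf f0.
pose phi : measurableTypeR R -> measurableTypeR R := fun x => (a * x + b)%R.
have mphi : measurable_fun setT phi.
  apply: measurable_funD => //; exact: measurable_funM.
pose m' := mscale (NngNum (normr_ge0 a))
  (measure_function_pushforward__canonical__measure_function_Measure leb mphi).
have E A : measurable A -> leb A = m' A.
  apply: lebesgue_measure_unique => X [[x y] _ <-] /=.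
  rewrite /m' /mscale /= /pushforward /=.
  have [->|] := eqVneq ([set` `]x, y]] : set R) set0.
    by rewrite preimage_set0 !measure0 mule0.
  move=> xy0; have xy : (x < y)%R.
    by apply: contra_neqT xy0; rewrite -leNgt => yx; rewrite set_itv_ge// -leNgt bnd_simp.
  have [a1|a1|a1] := ltgtP a 0%R; last by rewrite a1 eqxx in a0.
  - have -> : phi @^-1` [set` `]x, y]] = [set` `[(y - b) / a, (x - b) / a[]%R.
      apply/seteqP; split => z /=; rewrite !in_itv /= /phi => /andP[h1 h2]; apply/andP; split.
      + by rewrite ler_ndivrMr// mulrC lerBrDr.
      + by rewrite ltr_ndivlMr// mulrC ltrBlDr.
      + by rewrite -ltrBlDr mulrC -ltr_ndivlMr.
      + by rewrite -lerBrDr mulrC -ler_ndivrMr.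
    rewrite !lebesgue_measure_itv /= !lte_fin xy.
    have -> : ((y - b) / a < (x - b) / a)%R.
      by rewrite ltr_nM2r ?invr_lt0// ltrD2r.
    rewrite -!EFinB -EFinM; congr EFin; rewrite ltr0_norm//; field.
    by rewrite a0.
  - have -> : phi @^-1` [set` `]x, y]] = [set` `](x - b) / a, (y - b) / a]]%R.
      apply/seteqP; split => z /=; rewrite !in_itv /= /phi => /andP[h1 h2]; apply/andP; split.
      + by rewrite ltr_pdivrMr// mulrC ltrBlDr.
      + by rewrite ler_pdivlMr// mulrC lerBrDr.
      + by rewrite -ltrBlDr mulrC -ltr_pdivrMr.
      + by rewrite -lerBrDr mulrC -ler_pdivlMr.
    rewrite !lebesgue_measure_itv /= !lte_fin xy.
    have -> : ((x - b) / a < (y - b) / a)%R.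
      by rewrite ltr_pM2r ?invr_gt0// ltrD2r.
    rewrite -!EFinB -EFinM; congr EFin; rewrite gtr0_norm//; field.
    by rewrite a0.
rewrite (eq_measure_integral m'); last by move=> A mA _; exact: E.
rewrite ge0_integral_mscale//= ge0_integral_pushforward//.
Qed.

Lemma integral_rV_cons n (f : 'rV[R]_n.+1 -> \bar R) :
  measurable_fun setT f -> (forall x, 0 <= f x) ->
  \int[@lebesgue_rV R n.+1]_x f x =
  \int[leb]_t \int[@lebesgue_rV R n]_v f (rV_cons (t, v)).
Proof.
move=> mf f0.
rewrite (eq_measure_integral
  (measure_function_pushforward__canonical__measure_function_Measure
    (leb \x @lebesgue_rV R n) (@measurable_rV_cons R n))); last by [].
rewrite ge0_integral_pushforward//; last exact: measurable_rV_cons.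
rewrite fubini_tonelli1//; last by move=> x; exact: f0.
apply: measurableT_comp => //; exact: measurable_rV_cons.
Qed.

Lemma rV_consEl n (z : R * 'rV[R]_n) (j : 'I_1) : rV_cons z 0%R (lshift n j) = z.1.
Proof.
by rewrite /rV_cons (row_mxEl (z.1%:M%R : 'M[R]_1) z.2) ord1 mxE eqxx mulr1n.
Qed.

Lemma rV_consEr n (z : R * 'rV[R]_n) (j : 'I_n) :
  rV_cons z 0%R (rshift 1 j) = z.2 0%R j.
Proof. by rewrite /rV_cons (row_mxEr (z.1%:M%R : 'M[R]_1) z.2). Qed.

Lemma measurable_rV_affine n (a : R) (b : 'rV[R]_n) :
  measurable_fun setT (fun x : 'rV[R]_n => (a *: x + b)%R).
Proof.
apply: measurable_fun_rVP => i.
under eq_fun do rewrite !mxE.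
apply: measurable_funD => //; apply: measurable_funM => //; exact: measurable_coord.
Qed.

Lemma integral_affine n (a : R) (b : 'rV[R]_n) (f : 'rV[R]_n -> \bar R) :
  (a != 0)%R -> measurable_fun setT f -> (forall x, 0 <= f x) ->
  \int[@lebesgue_rV R n]_x f x =
  (`|a| ^+ n)%:E * \int[@lebesgue_rV R n]_x f (a *: x + b)%R.
Proof.
move=> a0; elim: n b f => [|n ih] b f mf f0.
  rewrite expr0 mul1e; apply: eq_integral => x _; congr f.
  by apply/rowP => -[].
rewrite integral_rV_cons// integral_rV_cons; last 2 first.
- apply: measurableT_comp => //; exact: measurable_rV_affine.
- by [].
pose b0 := (rV_uncons b).1; pose b' := (rV_uncons b).2.
have rE (t : R) v : (a *: rV_cons (t, v) + b)%R = rV_cons ((a * t + b0)%R, (a *: v + b')%R).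
  apply/rowP => i.
  rewrite [LHS]mxE [X in (X + _)%R]mxE.
  have [j ->|j ->] := @split_ordP 1 n i.
    by rewrite !rV_consEl /= ord1 /b0 /rV_uncons /=; congr (_ + b _ _)%R; exact/val_inj.
  by rewrite !rV_consEr /= !mxE.
under [in RHS]eq_integral do under eq_integral do rewrite rE.
have mF : measurable_fun setT (fun z : measurableTypeR R * 'rV[R]_n => f (rV_cons z)).
  apply: measurableT_comp => //; exact: measurable_rV_cons.
have := measurable_fun_fubini_tonelli_F (m2 := @lebesgue_rV R n)
  (fun z : measurableTypeR R * 'rV[R]_n => f (rV_cons z)) mF (fun _ => f0 _).
rewrite /fubini_F => mG.
rewrite (integral_affine_R b0 a0 mG); last by move=> x; exact: integral_ge0.
rewrite exprS EFinM -muleA; congr (_ * _).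
rewrite -ge0_integralZl//; last first.
- by move=> x _; exact: integral_ge0.
- pose H := (fun z : measurableTypeR R * 'rV[R]_n => f (rV_cons ((a * z.1 + b0)%R, (a *: z.2 + b')%R))).
  have mH : measurable_fun setT H.
    apply: (measurableT_comp mf); apply: (measurableT_comp (@measurable_rV_cons R n)).
    apply/measurable_fun_pairP; split => /=.
      by apply: measurable_funD => //; apply: measurable_funM.
    exact: (measurableT_comp (measurable_rV_affine a b')).
  have := measurable_fun_fubini_tonelli_F (m2 := @lebesgue_rV R n) H mH (fun _ => f0 _).
  by rewrite /fubini_F.
apply: eq_integral => t _ /=.
rewrite (ih b')//.
by apply: (measurableT_comp mf); apply: (measurableT_comp (@measurable_rV_cons R n)).
Qed.

End affine.
(** * Measurability and shells *)

Section euclidean_measurability.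
Variables (R : realType) (N : nat).
Local Notation V := 'rV[R]_N.
Local Notation mu := (@lebesgue_rV R N).

Lemma coord_le_norm (x : V) i : `|x 0 i| <= `|x|.
Proof.
rewrite [leRHS]mx_normrE.
exact: (le_bigmax _ (fun ij : 'I_1 * 'I_N => `|x ij.1 ij.2|) (0, i)).
Qed.

Lemma norm_leP (x : V) (r : R) : 0 <= r -> reflect (forall i, `|x 0 i| <= r) (`|x| <= r).
Proof.
move=> r0; apply: (iffP idP) => [xr i|xr].
  exact: le_trans (coord_le_norm _ _) xr.
rewrite [leLHS]mx_normrE; apply: bigmax_le => // -[i j] _ /=.
by rewrite (ord1 i).
Qed.

(** The sigma-algebra on rows is generated by coordinates, so open sets have to be shown measurable:
    each is the countable union of the boxes with rational centre and radius [1 / k.+1] that it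
    contains. *)
Lemma continuous_measurable_rV (g : V -> R) : continuous g -> measurable_fun setT g.
Proof.
move=> cg.
suff op U : open U -> measurable (g @^-1` U).
  have -> : [set: V] = setT by [].
  apply: (@measurability _ _ _ _ _ _ (@RGenOpens.G R)).
    exact: RGenOpens.measurableE.
  move=> _ [B [a [b ->]] <-]; rewrite setTI; apply: op.
  exact: interval_open.
move=> oU.
have oW : open (g @^-1` U) by apply: open_comp => // x _; exact: cg.
move: (g @^-1` U) oW => W oW.
pose box (c : 'rV[rat]_N) (k : nat) : set V :=
  [set y | forall i, `|ratr (c 0 i) - y 0 i| < k.+1%:R^-1].
(* Boxes are enumerated through [unpickle]; an index that codes no pair, or a box not inside [W],
   contributes the empty set. *)
pose F n : set V := if (unpickle n : option ('rV[rat]_N * nat)) is Some ck then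
  (if `[< box ck.1 ck.2 `<=` W >] then box ck.1 ck.2 else set0) else set0.
have mbox c k : measurable (box c k).
  have -> : box c k = \bigcap_(i in [set: 'I_N])
      ((fun y : V => y 0 i) @^-1` [set t | `|ratr (c 0 i) - t| < k.+1%:R^-1]).
    by apply/seteqP; split => y /= H i //=; exact: H.
  apply: fin_bigcap_measurable => // i _.
  rewrite -[X in measurable X]setTI; apply: measurable_coord => //.
  have -> : [set t : R | `|ratr (c 0 i) - t| < k.+1%:R^-1] = ball (ratr (c 0 i) : R) k.+1%:R^-1 by [].
  exact: measurable_ball.
have -> : W = \bigcup_n F n.
  apply/seteqP; split => x.
    move=> Wx; have /nbhs_ballP[e /= e0 He] := open_nbhs_nbhs (conj oW Wx).
    pose k := Num.bound ((e / 2)^-1).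
    have k2 : k.+1%:R^-1 < e / 2 :> R.
      have e20 : 0 < (e/2)^-1 by rewrite invr_gt0 divr_gt0.
      rewrite -[ltRHS]invrK ltf_pV2 ?posrE//.
      by apply: (lt_le_trans (archi_boundP (ltW e20))); rewrite ler_nat.
    have /choice[c Hc] : forall i, exists q : rat, `|ratr q - x 0 i| < k.+1%:R^-1.
      move=> i.
      have h : x 0 i - k.+1%:R^-1 < x 0 i + k.+1%:R^-1 by rewrite ltrD2l gtrN// invr_gt0.
      have [q] := rat_in_itvoo h.
      rewrite in_itv /= => /andP[h1 h2]; exists q.
      by rewrite ltr_distl h1 h2.
    pose cc := \row_i c i.
    have ccE i : cc 0 i = c i by rewrite mxE.
    have bx : box cc k x by move=> i; rewrite ccE.
    exists (pickle (cc, k)) => //; rewrite /F pickleK /=; case: asboolP => // -[].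
    move=> y Hy; apply: He; split => // i j; rewrite (ord1 i).
    rewrite /ball /= (_ : x 0 j - y 0 j = (ratr (cc 0 j) - y 0 j) - (ratr (cc 0 j) - x 0 j)); last by ring.
    apply: (le_lt_trans (ler_normB _ _)).
    by rewrite [e]splitr; apply: ltrD; apply: lt_trans k2.
  by move=> [n _]; rewrite /F; case: unpickle => //= ck; case: asboolP => // h; exact: h.
apply: bigcup_measurable => n _; rewrite /F; case: unpickle => //= ck.
by case: asboolP.
Qed.

Lemma measurable_norm_rV : measurable_fun setT (fun x : V => `|x|).
Proof. by apply: continuous_measurable_rV => x; exact: norm_continuous. Qed.

Lemma eucl_ge0 (x : V) : 0 <= eucl x.
Proof. exact: sqrtr_ge0. Qed.

Lemma norm_le_eucl (x : V) : `|x| <= eucl x.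
Proof.
apply/norm_leP; first exact: eucl_ge0.
move=> i; rewrite -sqrtr_sqr /eucl ler_sqrt ?sqr_ge0//; last first.
  by apply: sumr_ge0 => j _; rewrite -expr2 sqr_ge0.
rewrite /dotv (bigD1 i)//= expr2 lerDl.
by apply: sumr_ge0 => j _; rewrite -expr2 sqr_ge0.
Qed.

Lemma eucl_le_norm (x : V) : eucl x <= N.+1%:R * `|x|.
Proof.
rewrite /eucl -[leRHS]ger0_norm ?mulr_ge0// -sqrtr_sqr ler_sqrt ?sqr_ge0//.
apply: (@le_trans _ _ (\sum_(i < N) `|x| ^+ 2)).
  apply: ler_sum => i _; rewrite -expr2 -real_normK ?num_real//.
  by rewrite ler_pXn2r ?nnegrE// coord_le_norm.
rewrite sumr_const card_ord -[leLHS]mulr_natl exprMn; apply: ler_wpM2r; first exact: sqr_ge0.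
rewrite -natrX ler_nat expnS expn1; exact: leq_trans (leqnSn _) (leq_pmulr _ _).
Qed.

Lemma measurable_eucl : measurable_fun setT (fun x : V => eucl x).
Proof.
have -> : (fun x : V => eucl x) = (fun x => (dotv x x) `^ (2^-1)).
  by apply/funext => x; rewrite powR12_sqrt//; apply: sumr_ge0 => j _; rewrite -expr2 sqr_ge0.
apply: (measurableT_comp (measurable_powR _)).
apply: measurable_sum => i; apply: measurable_funM; exact: measurable_coord.
Qed.

End euclidean_measurability.

Section cube.
Variable (R : realType).
Local Open Scope ereal_scope.

Lemma integral_cube1 N : \int[@lebesgue_rV R N]_x (if (`|x| <= 1)%R then 1 else 0) = (2 ^+ N)%:E.
Proof.
pose X n (x : 'rV[R]_n) : \bar R := if (`|x| <= 1)%R then 1 else 0.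
have mX n : measurable_fun setT (X n).
  apply: measurable_fun_ifT => //.
  apply: (@measurable_fun_ler _ _ _ _ (fun x : 'rV[R]_n => `|x|%R) (fun _ => 1%R)) => //.
  exact: measurable_norm_rV.
rewrite -[LHS]/(\int[_]_x (X N x)).
elim: N => [|n ih].
  under eq_integral.
    move=> x _; rewrite /X (_ : (`|x| <= 1)%R = true); last by apply/norm_leP => // -[].
    over.
  by rewrite integral_cst// /= diracT mule1 expr0.
rewrite integral_rV_cons//; last by move=> x; rewrite /X; case: ifP.
pose Y (t : R) : \bar R := if (`|t| <= 1)%R then 1 else 0.
have XE t v : X n.+1 (rV_cons (t, v)) = Y t * X n v.
  rewrite /X /Y; case: (leP `|t|%R 1%R) => t1.
    rewrite mul1e; congr (if _ then _ else _); apply/norm_leP/norm_leP => //.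
      by move=> h i; have := h (rshift 1 i); rewrite rV_consEr.
    move=> h i; have [j ->|j ->] := @split_ordP 1 n i.
      by rewrite rV_consEl.
    by rewrite rV_consEr.
  rewrite mul0e; case: norm_leP => // /(_ (lshift n (ord0 : 'I_1))).
  by rewrite rV_consEl /= leNgt t1.
under eq_integral do under eq_integral do rewrite XE.
have XI t : \int[@lebesgue_rV R n]_v (Y t * X n v) = Y t * (2 ^+ n)%:E.
  rewrite ge0_integralZl//; first by rewrite ih.
  - exact: mX.
  - by move=> x _; rewrite /X; case: ifP.
  - by rewrite /Y; case: ifP.
under eq_integral do rewrite XI.
rewrite /=; transitivity (\int[@lebesgue_measure R]_t ((2 ^+ n)%:E * (\1_(`[(-1)%R, 1%R]%classic) t)%:E)).
  apply: eq_integral => t _; rewrite muleC; congr (_ * _); rewrite /Y indicE.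
  by rewrite mem_setE /= in_itv /= -ler_norml; case: ifP.
rewrite ge0_integralZl//; last first.
  by apply/measurable_EFinP; exact: measurable_indic.
have L : @lebesgue_measure R `[(-1)%R, 1%R]%classic = 2%:E.
  rewrite lebesgue_measure_itv /= lte_fin (_ : (-1 < 1)%R = true); last by apply/idP; lra.
  by rewrite -EFinD; congr EFin; ring.
by rewrite integral_indic// setIT [X in _ * X]L -EFinM mulrC -exprS.
Qed.

Variable N : nat.
Local Notation V := 'rV[R]_N.
Local Notation mu := (@lebesgue_rV R N).

Lemma measurable_cube (r : R) : measurable [set x : V | (`|x| <= r)%R].
Proof.
have := @measurable_norm_rV R N measurableT `]-oo, r]%classic (measurable_itv _).
by rewrite setTI set_itvE.
Qed.

Lemma measure_cube (r : R) : (0 < r)%R -> mu [set x | (`|x| <= r)%R] = ((2 * r) ^+ N)%:E.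
Proof.
move=> r0; rewrite -[X in mu X]setIT -integral_indic//; last exact: measurable_cube.
rewrite (integral_affine (0:V) (lt0r_neq0 r0)).
- have E x : (\1_[set x : V | (`|x| <= r)%R] (r *: x + 0)%R)%:E = if (`|x| <= 1)%R then 1 else 0 :> \bar R.
    rewrite addr0 indicE; have -> : (r *: x)%R \in [set x : V | (`|x| <= r)%R] = (`|x| <= 1)%R.
      apply/asboolP/idP => /=; rewrite normrZ gtr0_norm// => h; last by rewrite ler_piMr// ltW.
      by rewrite -(ler_pM2l r0) mulr1.
    by case: ifP.
  under eq_integral do rewrite E.
  by rewrite integral_cube1 -EFinM gtr0_norm// -exprMn mulrC.
- apply/measurable_EFinP; apply: measurable_indic; exact: measurable_cube.
- by move=> x; rewrite lee_fin.
Qed.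

(** Where [F] is nonzero it lies below some [w k] times the indicator of a cube, hence below the sum
    of these functions, which integrates termwise. The cubes may overlap: for dyadic radii this
    costs only a constant. *)
Lemma shell_bound (F : V -> R) (w r : nat -> R) :
  measurable_fun setT F -> (forall x, 0 <= F x)%R ->
  (forall k, 0 <= w k)%R -> (forall k, 0 < r k)%R ->
  (forall x, F x != 0%R -> exists k, (F x <= w k)%R /\ (`|x| <= r k)%R) ->
  \int[mu]_x (F x)%:E <= \sum_(k <oo) (w k * (2 * r k) ^+ N)%:E.
Proof.
move=> mF F0 w0 r0 Fw.
pose S x k : \bar R := (w k * (\1_[set y : V | (`|y| <= r k)%R] x))%:E.
have S0 x k : 0 <= S x k by rewrite lee_fin mulr_ge0.
have mS k : measurable_fun setT (S ^~ k).
  apply/measurable_EFinP; apply: measurable_funM => //.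
  by apply: measurable_indic; exact: measurable_cube.
apply: (@le_trans _ _ (\int[mu]_x \sum_(k <oo) S x k)).
  apply: ge0_le_integral => //.
  - by move=> x _; rewrite lee_fin.
  - exact/measurable_EFinP.
  - have := @ge0_emeasurable_sum _ _ _ setT (fun k x => S x k) xpredT (fun k x _ _ => S0 x k) (fun k _ => mS k).
    by [].
  move=> x _; have [->|Fx] := eqVneq (F x) 0%R.
    by apply: nneseries_ge0 => k _ _; exact: S0.
  have [k [h1 h2]] := Fw _ Fx.
  apply: (@le_trans _ _ (S x k)).
    by rewrite lee_fin indicE mem_set// mulr1.
  rewrite (@nneseriesD1 _ _ k xpredT)//=.
  by rewrite leeDl//; apply: nneseries_ge0 => i _ _; exact: S0.
rewrite (@integral_nneseries _ _ _ mu _ _ (fun k x => S x k))//.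
apply: lee_nneseries => [k _ _|k _]; first by apply: integral_ge0 => x _; exact: S0.
rewrite /S; under eq_integral do rewrite EFinM.
rewrite ge0_integralZl ?lee_fin//; last by apply/measurable_EFinP; apply: measurable_indic; exact: measurable_cube.
rewrite integral_indic//; last exact: measurable_cube.
by rewrite setIT [X in _ * X](measure_cube (r0 k)) -EFinM.
Qed.

End cube.
(** * Integrals of real functions *)

HB.lock Definition Int (R : realType) (N : nat) (f : 'rV[R]_N -> R) : R :=
  \int[@lebesgue_rV R N]_x f x.

Section integral_toolkit.
Variables (R : realType) (N : nat).
Local Notation V := 'rV[R]_N.
Local Notation mu := (@lebesgue_rV R N).
Implicit Types (f g h k : V -> R) (F G : V -> V -> R).

Definition itg f : Prop := mu.-integrable setT (EFin \o f).

Lemma itg_meas f : itg f -> measurable_fun setT f.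
Proof. by move=> /measurable_int /measurable_EFinP. Qed.

Lemma IntE f : itg f -> (Int f)%:E = (\int[mu]_x (f x)%:E)%E.
Proof. by move=> hf; rewrite Int.unlock /Rintegral fineK//; exact: integrable_fin_num. Qed.

Lemma eq_Int f g : f =1 g -> Int f = Int g.
Proof. by move=> fg; rewrite Int.unlock; apply: eq_Rintegral => x _; exact: fg. Qed.

Lemma eq_itg f g : f =1 g -> itg f -> itg g.
Proof. by move=> /funext ->. Qed.

Lemma le_itg f g : measurable_fun setT f -> (forall x, `|f x| <= g x) -> itg g -> itg f.
Proof.
move=> mf fg; apply: le_integrable => //; first exact/measurable_EFinP.
move=> x _ /=; rewrite lee_fin; apply: le_trans (fg x) _; exact: ler_norm.
Qed.

Lemma itg0 : itg (fun=> 0).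
Proof. exact: integrable0. Qed.

Lemma itgD f g : itg f -> itg g -> itg (fun x => f x + g x).
Proof. by move=> hf hg; exact: (integrableD measurableT hf hg). Qed.

Lemma itgB f g : itg f -> itg g -> itg (fun x => f x - g x).
Proof. by move=> hf hg; exact: (integrableB measurableT hf hg). Qed.

Lemma itgZ (c : R) f : itg f -> itg (fun x => c * f x).
Proof. by move=> hf; exact: (integrableZl measurableT c hf). Qed.

Lemma itg_norm f : itg f -> itg (fun x => `|f x|).
Proof. exact: integrable_norm. Qed.

Lemma itg_sum (I : Type) (s : seq I) (f : I -> V -> R) :
  (forall i, itg (f i)) -> itg (fun x => \sum_(i <- s) f i x).
Proof.
move=> hf; elim: s => [|i s ih].
  by apply: eq_itg itg0 => x; rewrite big_nil.
by apply: eq_itg (itgD (hf i) ih) => x; rewrite big_cons.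
Qed.

Lemma Int0 : Int (fun _ : V => 0) = 0.
Proof. by rewrite Int.unlock /Rintegral integral0. Qed.

Lemma IntD f g : itg f -> itg g -> Int (fun x => f x + g x) = Int f + Int g.
Proof. by move=> hf hg; rewrite Int.unlock RintegralD. Qed.

Lemma IntB f g : itg f -> itg g -> Int (fun x => f x - g x) = Int f - Int g.
Proof. by move=> hf hg; rewrite Int.unlock RintegralB. Qed.

Lemma IntZ (c : R) f : itg f -> Int (fun x => c * f x) = c * Int f.
Proof. by move=> hf; rewrite Int.unlock RintegralZl. Qed.

Lemma Int_sum (I : Type) (s : seq I) (f : I -> V -> R) :
  (forall i, itg (f i)) -> Int (fun x => \sum_(i <- s) f i x) = \sum_(i <- s) Int (f i).
Proof.
move=> hf; elim: s => [|i s ih].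
  by rewrite big_nil -[RHS]Int0; apply: eq_Int => x; rewrite big_nil.
rewrite big_cons -ih -IntD//; last exact: itg_sum.
by apply: eq_Int => x; rewrite big_cons.
Qed.

Lemma le_Int f g : itg f -> itg g -> (forall x, f x <= g x) -> Int f <= Int g.
Proof. by move=> hf hg fg; rewrite Int.unlock; apply: le_Rintegral. Qed.

Lemma Int_ge0 f : (forall x, 0 <= f x) -> 0 <= Int f.
Proof. by move=> f0; rewrite Int.unlock; apply: Rintegral_ge0 => x _. Qed.

Lemma Int_norm f : itg f -> `|Int f| <= Int (fun x => `|f x|).
Proof. by move=> hf; rewrite Int.unlock; apply: le_normr_Rintegral. Qed.

Lemma itg_lty f : measurable_fun setT f -> (forall x, 0 <= f x) ->
  (\int[mu]_x (f x)%:E < +oo)%E -> itg f.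
Proof.
move=> mf f0 h; apply/integrableP; split; first exact/measurable_EFinP.
by under eq_integral do rewrite /= ger0_norm//.
Qed.

Lemma measurable_affine (a : R) (b : V) : measurable_fun setT (fun x : V => a *: x + b).
Proof. exact: measurable_rV_affine. Qed.

Lemma itg_affine f (a : R) (b : V) : a != 0 -> itg f -> itg (fun x => f (a *: x + b)).
Proof.
move=> a0 /integrableP[mf hf]; apply/integrableP; split.
  exact: (measurableT_comp mf (measurable_affine a b)).
move: hf; rewrite (integral_affine b a0)//; last exact: measurableT_comp.
case: (\int[mu]_x _)%E => [r _||_]; [exact: ltry| |by []].
by rewrite gt0_muley ?lte_fin ?exprn_gt0 ?normr_gt0.
Qed.

Lemma Int_affine f (a : R) (b : V) : a != 0 -> itg f ->
  Int f = `|a| ^+ N * Int (fun x => f (a *: x + b)).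
Proof.
move=> a0 hf; apply: EFin_inj; rewrite EFinM !IntE//; last exact: itg_affine.
have mf : measurable_fun setT (EFin \o f) by apply/measurable_EFinP; exact: itg_meas.
rewrite [LHS]integralE [X in (_ * X)%E]integralE muleBr; last 2 first.
- by [].
- apply: fin_num_adde_defr; apply: integrable_pos_fin_num => //.
  exact: (itg_affine b a0 hf).
congr (_ - _)%E.
  apply: (etrans (integral_affine b a0 (measurable_funepos mf) (fun=> funepos_ge0 _ _))).
  by congr (_ * _)%E; apply: eq_integral => x _; rewrite !funeposE.
apply: (etrans (integral_affine b a0 (measurable_funeneg mf) (fun=> funeneg_ge0 _ _))).
  by congr (_ * _)%E; apply: eq_integral => x _; rewrite !funenegE.
Qed.

Definition mfun2 F := measurable_fun [set: V * V] (fun z => F z.1 z.2).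

Lemma mfun2_l F x : mfun2 F -> measurable_fun setT (F x).
Proof. by move=> mF; exact: (measurableT_comp mF (pair1_measurable x)). Qed.

Lemma mfun2_r F y : mfun2 F -> measurable_fun setT (F ^~ y).
Proof. by move=> mF; exact: (measurableT_comp mF (pair2_measurable y)). Qed.

Lemma mfun2_comp f (a b : R) (c : V) : measurable_fun setT f ->
  mfun2 (fun x y => f (a *: x + b *: y + c)).
Proof.
move=> mf.
suff mh : measurable_fun setT (fun z : V * V => a *: z.1 + b *: z.2 + c) by exact: (measurableT_comp mf mh).
apply: measurable_fun_rVP => i; under eq_fun do rewrite !mxE.
by apply: measurable_funD => //; apply: measurable_funD; apply: measurable_funM => //;
  apply: (measurableT_comp (measurable_coord i)).
Qed.

Lemma mfun2_swap F : mfun2 F -> mfun2 (fun x y => F y x).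
Proof.
move=> mF.
suff h : measurable_fun setT (fun z : V * V => (z.2, z.1)) by exact: (measurableT_comp mF h).
by apply/measurable_fun_pairP; split; [exact: measurable_snd|exact: measurable_fst].
Qed.

Lemma mfun2_x f : measurable_fun setT f -> mfun2 (fun x _ => f x).
Proof. by move=> mf; exact: (measurableT_comp mf measurable_fst). Qed.

Lemma mfun2_y f : measurable_fun setT f -> mfun2 (fun _ y => f y).
Proof. by move=> mf; exact: (measurableT_comp mf measurable_snd). Qed.

Lemma mfun_Int F : mfun2 F -> (forall x, itg (F x)) -> measurable_fun setT (fun x => Int (F x)).
Proof.
move=> mF iF; apply/measurable_EFinP.
have mF' : measurable_fun setT (fun z : V * V => (F z.1 z.2)%:E) by exact/measurable_EFinP.
have mP : measurable_fun setT (fun x => \int[mu]_y (fun z : V * V => (F z.1 z.2)%:E)^\+%E (x, y))%E.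
  by apply: measurable_fun_fubini_tonelli_F => //; exact: measurable_funepos.
have mN : measurable_fun setT (fun x => \int[mu]_y (fun z : V * V => (F z.1 z.2)%:E)^\-%E (x, y))%E.
  by apply: measurable_fun_fubini_tonelli_F => //; exact: measurable_funeneg.
rewrite (_ : EFin \o _ = (fun x => \int[mu]_y (fun z : V * V => (F z.1 z.2)%:E)^\+%E (x, y) -
  \int[mu]_y (fun z : V * V => (F z.1 z.2)%:E)^\-%E (x, y))%E).
  exact: emeasurable_funB.
apply/funext => x /=; rewrite IntE// integralE; congr (_ - _)%E; apply: eq_integral => y _.
  by rewrite !funeposE.
by rewrite !funenegE.
Qed.

Lemma tonelli_itg F : mfun2 F -> (forall x y, 0 <= F x y) ->
  (forall x, itg (F x)) -> (forall y, itg (F ^~ y)) -> itg (fun y => Int (F ^~ y)) ->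
  itg (fun x => Int (F x)) /\ Int (fun x => Int (F x)) = Int (fun y => Int (F ^~ y)).
Proof.
move=> mF F0 ix iy hI.
have mF' : measurable_fun setT (fun z : V * V => (F z.1 z.2)%:E) by exact/measurable_EFinP.
have F0' (z : V * V) : (0 <= (F z.1 z.2)%:E)%E by rewrite lee_fin.
have T := fubini_tonelli (m1 := mu) (m2 := mu) _ mF' F0'.
have Ex : (\int[mu]_x \int[mu]_y (F x y)%:E = \int[mu]_x (Int (F x))%:E)%E.
  by apply: eq_integral => x _; rewrite -IntE.
have Ey : (\int[mu]_y \int[mu]_x (F x y)%:E = \int[mu]_y (Int (F ^~ y))%:E)%E.
  by apply: eq_integral => y _; rewrite -IntE.
move: T; rewrite /= Ex Ey => T.
have h : itg (fun x => Int (F x)).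
  apply: itg_lty; [exact: mfun_Int|by move=> x; exact: Int_ge0|].
  by rewrite T -IntE// ltry.
by split=> //; apply: EFin_inj; rewrite !IntE.
Qed.

(** Slices are integrable for every [x] and every [y], not almost every one, so that both iterated
    integrals are functions defined everywhere and no null set has to be carried along. *)
Lemma fubini_itg F : mfun2 F ->
  (forall x, itg (F x)) -> (forall y, itg (F ^~ y)) -> itg (fun y => Int (fun x => `|F x y|)) ->
  [/\ itg (fun x => Int (F x)), itg (fun y => Int (F ^~ y)) &
      Int (fun x => Int (F x)) = Int (fun y => Int (F ^~ y))].
Proof.
move=> mF ix iy hI.
have mF' : measurable_fun setT (fun z : V * V => (F z.1 z.2)%:E) by exact/measurable_EFinP.
have mA : mfun2 (fun x y => `|F x y|) by exact: measurableT_comp.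
have [hI1 _] := tonelli_itg mA (fun _ _ => normr_ge0 _) (fun x => itg_norm (ix x)) (fun y => itg_norm (iy y)) hI.
have h1 : itg (fun x => Int (F x)).
  by apply: le_itg hI1; [exact: mfun_Int|move=> x; exact: Int_norm].
have h2 : itg (fun y => Int (F ^~ y)).
  apply: le_itg hI; last by move=> y; exact: Int_norm.
  exact: (mfun_Int (mfun2_swap mF)).
split; [exact: h1|exact: h2|]; apply: EFin_inj; rewrite (IntE h1) (IntE h2).
have P : (mu \x mu)%E.-integrable setT (fun z : V * V => (F z.1 z.2)%:E).
  apply/(integrable12ltyP _ _ mF').
  have -> : (\int[mu]_x \int[mu]_y `|(F (x, y).1 (x, y).2)%:E| = \int[mu]_x (Int (fun y => `|F x y|))%:E)%E.
    by apply: eq_integral => x _; rewrite IntE//; exact: itg_norm.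
  by rewrite -IntE// ltry.
have := Fubini P => /= E.
under eq_integral do rewrite IntE//.
by rewrite E; apply: eq_integral => y _; rewrite IntE.
Qed.

End integral_toolkit.
(** * Real inequalities *)

Section real_inequalities.
Variable R : realType.
Implicit Types (a b c d p r s t u x y : R).

Lemma powRSr p x : 0 <= x -> p != 0 -> x `^ p = x * x `^ (p - 1).
Proof.
move=> x0 p0; have [->|xn0] := eqVneq x 0; first by rewrite mul0r powR0.
by rewrite -{2}(powRr1 x0) -powRD ?xn0 ?implybT// addrC subrK.
Qed.

Lemma powR_ler p x y : 0 <= p -> 0 <= x -> x <= y -> x `^ p <= y `^ p.
Proof. by move=> p0 x0 xy; apply: ge0_ler_powR; rewrite ?nnegrE// (le_trans x0). Qed.

Lemma powR_le_linear p M x : 1 <= p -> 0 <= x -> x <= M -> x `^ p <= M `^ (p - 1) * x.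
Proof.
move=> p1 x0 xM; rewrite powRSr//; last by lra.
by rewrite mulrC ler_wpM2r// powR_ler// subr_ge0.
Qed.

Lemma powRK p x : 0 <= x -> p != 0 -> (x `^ p) `^ p^-1 = x.
Proof. by move=> x0 p0; rewrite -powRrM mulfV// powRr1. Qed.

Lemma powRVK p x : 0 <= x -> p != 0 -> (x `^ p^-1) `^ p = x.
Proof. by move=> x0 p0; rewrite -powRrM mulVf// powRr1. Qed.

(** Young's inequality for [t] and [a ^ (p - 1)], with exponents [p] and [p / (p - 1)], rearranged:
    the power lies above its tangent at [a]. *)
Lemma powR_tangent p a t : 1 <= p -> 0 <= a -> 0 <= t ->
  a `^ p + p * a `^ (p - 1) * (t - a) <= t `^ p.
Proof.
move=> p1 a0 t0.
have [->|p1'] := eqVneq p 1.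
  by rewrite subrr powRr0 !powRr1//; lra.
have {}p1 : 1 < p by rewrite lt_neqAle eq_sym p1'.
have p0 : p != 0 by lra.
have q0 : p - 1 != 0 by lra.
have := @conjugate_powR R t (a `^ (p - 1)) p (p / (p - 1)) t0 (powR_ge0 _ _).
rewrite -powRrM (_ : (p - 1) * (p / (p - 1)) = p); last by field.
have h1 : 0 < p by lra.
have h2 : 0 < p / (p - 1) by rewrite divr_gt0//; lra.
have h3 : p^-1 + (p / (p - 1))^-1 = 1 by field; rewrite p0 q0.
move=> /(_ h1 h2 h3); rewrite (powRSr a0 p0); set A := a `^ (p - 1).
rewrite -(ler_pM2l h1).
have -> : p * (t `^ p / p + a * A / (p / (p - 1))) = t `^ p + (p - 1) * (a * A).
  by field; rewrite p0 q0.
lra.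
Qed.

Lemma powR_bernoulli_concave b x : 0 < b <= 1 -> 0 <= x -> x `^ b <= 1 + b * (x - 1).
Proof.
move=> /andP[b0 b1] x0.
have b1' : 1 <= b^-1 by rewrite -invr1 lef_pV2 ?posrE.
have := powR_tangent b1' ler01 (powR_ge0 x b).
rewrite !powR1 -powRrM mulfV ?gt_eqF// powRr1// mulr1 => h.
rewrite -(ler_pM2l (lt_le_trans ltr01 b1')) mulrDr mulrA mulVf ?gt_eqF// mul1r mulr1; lra.
Qed.

(** The tangent inequality at the weighted mean [a = T / S], summed: the linear terms cancel. The
    weights are not normalised, whence the power [r - 1] of their total mass; this power is what
    later becomes the dependence on [s]. *)
Lemma jensen_sum (I : Type) (s : seq I) (c X : I -> R) r : 1 <= r ->
  (forall i, 0 <= c i) -> (forall i, 0 <= X i) ->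
  (\sum_(i <- s) c i * X i) `^ r <= (\sum_(i <- s) c i) `^ (r - 1) * \sum_(i <- s) c i * X i `^ r.
Proof.
move=> r1 c0 X0.
have r0 : r != 0 by lra.
set S := \sum_(i <- s) c i; set T := \sum_(i <- s) c i * X i.
have S0 : 0 <= S by exact: sumr_ge0.
have T0 : 0 <= T by apply: sumr_ge0 => i _; exact: mulr_ge0.
have [S00|Sn0] := eqVneq S 0.
  have c00 : forall i, c i * X i <= S * X i -> True by [].
  suff -> : T = 0 by rewrite powR0// mulr_ge0// ?powR_ge0// sumr_ge0// => i _; rewrite mulr_ge0// powR_ge0.
  have : forall s' : seq I, \sum_(i <- s') c i = 0 -> \sum_(i <- s') c i * X i = 0.
    elim=> [|i s' ih]; first by rewrite !big_nil.
    rewrite !big_cons => /eqP; rewrite paddr_eq0//; last exact: sumr_ge0.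
    by move=> /andP[/eqP -> /eqP /ih ->]; rewrite mul0r addr0.
  by move=> /(_ s S00).
have Sp : 0 < S by rewrite lt_neqAle eq_sym Sn0.
pose a := T / S; have a0 : 0 <= a by rewrite divr_ge0.
have H : S * a `^ r <= \sum_(i <- s) c i * X i `^ r.
  apply: (@le_trans _ _ (\sum_(i <- s) c i * (a `^ r + r * a `^ (r - 1) * (X i - a)))).
    have -> : \sum_(i <- s) c i * (a `^ r + r * a `^ (r - 1) * (X i - a)) =
      S * a `^ r + r * a `^ (r - 1) * (T - S * a).
      rewrite /S /T mulr_suml [(\sum_(i <- s) c i) * a]mulr_suml.
      rewrite -sumrB mulr_sumr -big_split /=; apply: eq_bigr => i _; ring.
    by rewrite /a mulrCA mulfV// mulr1 subrr mulr0 addr0.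
  by apply: ler_sum => i _; rewrite ler_wpM2l// powR_tangent.
apply: (le_trans _ (ler_wpM2l (powR_ge0 _ _) H)).
have -> : T = S * a by rewrite /a mulrCA mulfV// mulr1.
by rewrite powRM// (powRSr S0 r0) mulrA [S `^ _ * S]mulrC.
Qed.

(** The convex case with exponent [1 / r], for the numbers [X i ^ r]. *)
Lemma jensen_sum_concave (I : Type) (s : seq I) (c X : I -> R) r : 0 < r <= 1 ->
  (forall i, 0 <= c i) -> (forall i, 0 <= X i) ->
  \sum_(i <- s) c i * X i `^ r <= (\sum_(i <- s) c i) `^ (1 - r) * (\sum_(i <- s) c i * X i) `^ r.
Proof.
move=> /andP[r0 r1] c0 X0.
have r0' : r != 0 by lra.
have r1' : 1 <= r^-1 by rewrite -invr1 lef_pV2 ?posrE.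
have L0 : 0 <= \sum_(i <- s) c i * X i `^ r by apply: sumr_ge0 => i _; rewrite mulr_ge0// powR_ge0.
have := jensen_sum s r1' c0 (fun i => powR_ge0 (X i) r).
under [X in _ <= _ * X]eq_bigr do rewrite powRK//.
move=> /(powR_ler (ltW r0) (powR_ge0 _ _)).
rewrite powRVK// powRM ?powR_ge0//; last by apply: sumr_ge0 => i _; rewrite mulr_ge0.
by rewrite -powRrM mulrBl mulVf// mul1r.
Qed.

Lemma powR_superadd r a b : 1 <= r -> 0 <= a -> 0 <= b -> a `^ r + b `^ r <= (a + b) `^ r.
Proof.
move=> r1 a0 b0; have r0 : r != 0 by lra.
rewrite (powRSr (addr_ge0 a0 b0) r0) (powRSr a0 r0) (powRSr b0 r0) mulrDl.
by apply: lerD; rewrite ler_wpM2l// powR_ler ?subr_ge0// (lerDl, lerDr).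
Qed.

Lemma powR_mean r a b : 1 <= r -> 0 <= a -> 0 <= b ->
  (a + b) `^ r <= 2 `^ (r - 1) * (a `^ r + b `^ r).
Proof.
move=> r1 a0 b0.
have := @jensen_sum bool [:: true; false] (fun=> 1) (fun i => if i then a else b) r r1.
rewrite !big_cons !big_nil !addr0 !mul1r; apply; first by [].
by case.
Qed.

Lemma powR_subadd r a b : 0 < r <= 1 -> 0 <= a -> 0 <= b -> (a + b) `^ r <= a `^ r + b `^ r.
Proof.
move=> /andP[r0 r1] a0 b0; have r0' : r != 0 by lra.
have r1' : 1 <= r^-1 by rewrite -invr1 lef_pV2 ?posrE.
have := powR_superadd r1' (powR_ge0 a r) (powR_ge0 b r); rewrite !powRK//.
move=> /(powR_ler (ltW r0) (addr_ge0 a0 b0)) /le_trans; apply.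
by rewrite powRVK// addr_ge0// powR_ge0.
Qed.

(** Convexity of [z ^ (p / 2)] at the squares of [x + y] and [x - y], the parallelogram identity,
    and superadditivity of the same power. *)
Lemma clarkson_ge2 p x y : 2 <= p ->
  2 * (`|x| `^ p + `|y| `^ p) <= `|x + y| `^ p + `|x - y| `^ p.
Proof.
move=> p2; pose r := p / 2; have r1 : 1 <= r by rewrite /r ler_pdivlMr// mul1r.
have E z : `|z| `^ p = (z ^+ 2) `^ r.
  by rewrite -real_normK ?num_real// -powR_mulrn// -powRrM /r mulrCA mulfV ?mulr1// pnatr_eq0.
rewrite !E.
have := powR_mean r1 (sqr_ge0 (x + y)) (sqr_ge0 (x - y)).
have -> : (x + y) ^+ 2 + (x - y) ^+ 2 = 2 * (x ^+ 2 + y ^+ 2) by ring.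
rewrite powRM ?addr_ge0 ?sqr_ge0// (powRSr (x := 2))//; last by lra.
rewrite mulrAC [2 * _ * _]mulrC ler_pM2l ?powR_gt0// => h.
apply: le_trans h; rewrite ler_pM2l//; apply: powR_superadd => //; exact: sqr_ge0.
Qed.

(** Two tangent lines replace the second derivative, one from 1 to [1 + t / 2], one from there to
    [1 + t]. The quadratic gain is the increase of the slope between the two points of contact. *)
Lemma powR_taylor2 p t : 1 < p <= 2 -> 0 <= t <= 1 ->
  1 + p * t + p * (p - 1) / 8 * t ^+ 2 <= (1 + t) `^ p.
Proof.
move=> /andP[p1 p2] /andP[t0 t1].
pose u := t / 2; have u0 : 0 <= u by rewrite /u; lra.
have x0 : 0 <= 1 + u by lra.
have h1 := powR_tangent (ltW p1) x0 (addr_ge0 ler01 t0).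
have h2 := powR_tangent (ltW p1) ler01 x0.
rewrite !powR1 mulr1 in h2.
(* The slope at [1 + u] is written [(1 + u) / (1 + u) ^ (2 - p)], and Bernoulli's inequality is
   applied to the denominator. *)
have h3 : 1 + (p - 1) * u / 2 <= (1 + u) `^ (p - 1).
  have [->|pn2] := eqVneq p 2.
    by rewrite (_ : 2 - 1 = 1) ?powRr1 //; rewrite /u; lra.
  have b01 : 0 < 2 - p <= 1 by apply/andP; split; [rewrite subr_gt0 lt_neqAle pn2|lra].
  have := powR_bernoulli_concave b01 x0.
  have -> : (1 + u) `^ (p - 1) = (1 + u) / (1 + u) `^ (2 - p).
    by rewrite -[X in X / _]powRr1// -powRB; [congr (_ `^ _); ring|apply/implyP => _; lra].
  have P0 : 0 < (1 + u) `^ (2 - p) by rewrite powR_gt0//; lra.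
  rewrite ler_pdivlMr// => h4.
  have h5 : 0 <= 1 + (p - 1) * u / 2 by apply: addr_ge0 => //; rewrite divr_ge0// mulr_ge0//; lra.
  apply: (le_trans (ler_wpM2l h5 h4)).
  have u1 : u <= 1 by rewrite /u; lra.
  have u2 : (2 - p) * u <= 1 by rewrite -[leRHS]mulr1; apply: ler_pM => //; lra.
  have : 0 <= (p - 1) * u * (1 - (2 - p) * u) by rewrite mulr_ge0 ?mulr_ge0//; lra.
  move=> h; rewrite -subr_ge0.
  have -> : 1 + u - (1 + (p - 1) * u / 2) * (1 + (2 - p) * (1 + u - 1)) =
    (p - 1) * u * (1 - (2 - p) * u) / 2 by field.
  by rewrite divr_ge0//; lra.
have tE : t = 2 * u by rewrite /u; lra.
rewrite tE in h1 *.
have h6 : p * (1 + (p - 1) * u / 2) * u <= p * (1 + u) `^ (p - 1) * u.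
  by apply: ler_wpM2r => //; apply: ler_wpM2l => //; lra.
move: h1 h2 h6; rewrite (_ : 1 + 2 * u - (1 + u) = u); last by ring.
rewrite (_ : 1 + u - 1 = u); last by ring.
move=> h1 h2 h6; apply: le_trans h1.
apply: le_trans (lerD h2 h6).
by rewrite le_eqVlt; apply/orP; left; apply/eqP; rewrite !expr2; field.
Qed.

(** By homogeneity [x = 1]. The power of [1 + t] brings the quadratic gain; for [1 - t] the tangent
    at 1 suffices, and the linear terms cancel. *)
Lemma clarkson_le2_small p x y : 1 < p <= 2 -> 0 <= y -> y <= x ->
  2 * x `^ p + p * (p - 1) / 8 * (y ^+ 2 * x `^ (p - 2)) <= (x + y) `^ p + (x - y) `^ p.
Proof.
move=> p12 y0 yx; have /andP[p1 p2] := p12.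
have x0 : 0 <= x by exact: le_trans yx.
have p0 : p != 0 by lra.
have [x00|xn0] := eqVneq x 0.
  have y00 : y = 0 by lra.
  by rewrite x00 y00 addr0 subr0 powR0// expr0n /= mul0r !mulr0.
have xp : 0 < x by rewrite lt_neqAle eq_sym xn0.
pose t := y / x; have t01 : 0 <= t <= 1 by rewrite divr_ge0//= ler_pdivrMr// mul1r.
have /andP[t0 t1] := t01.
have yE : y = x * t by rewrite /t mulrCA mulfV// mulr1.
have -> : x + y = x * (1 + t) by rewrite yE; ring.
have -> : x - y = x * (1 - t) by rewrite yE; ring.
rewrite !powRM//; try lra.
have -> : y ^+ 2 * x `^ (p - 2) = x `^ p * t ^+ 2.
  rewrite yE exprMn mulrAC; congr (_ * _).
  by rewrite -(powR_mulrn 2 x0) -powRD ?xn0 ?implybT//; congr (_ `^ _); ring.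
have -> : 2 * x `^ p + p * (p - 1) / 8 * (x `^ p * t ^+ 2) = x `^ p * (2 + p * (p - 1) / 8 * t ^+ 2) by ring.
rewrite -mulrDr ler_pM2l ?powR_gt0//.
have h1 := powR_taylor2 p12 t01.
have t1' : 0 <= 1 - t by lra.
have h2 := powR_tangent (ltW p1) ler01 t1'.
rewrite !powR1 mulr1 in h2; lra.
Qed.

(** A scalar form of 2-uniform convexity. The weight [(|x| + |y|) ^ (p - 2)] can be integrated
    without knowing which of the two is larger. When [|y| > |x|] the roles are exchanged; the
    surplus [2 (|y| ^ p - |x| ^ p)] and the exchanged quadratic term together pay for the one that
    is claimed. *)
Lemma clarkson_le2 p x y : 1 < p <= 2 ->
  2 * `|x| `^ p + p * (p - 1) / 16 * (`|y| ^+ 2 * (`|x| + `|y|) `^ (p - 2)) <=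
  `|x + y| `^ p + `|x - y| `^ p.
Proof.
move=> p12; have /andP[p1 p2] := p12.
have -> : `|x + y| `^ p + `|x - y| `^ p = (`|x| + `|y|) `^ p + (`| `|x| - `|y| |) `^ p.
  have [x0|x0] := ger0P x; have [y0|y0] := ger0P y.
  - by rewrite (ger0_norm (addr_ge0 x0 y0)).
  - by rewrite addrC opprK (ger0_norm (x:=x - y))//; lra.
  - by rewrite addrC -opprD normrN (ltr0_norm (x:=x - y)) ?opprB 1?[- x + y]addrC//; lra.
  - rewrite (ltr0_norm (x:=x + y)) ?opprD; last lra.
    by rewrite (_ : - x - - y = - (x - y)) ?normrN//; ring.
move: (normr_ge0 x) (normr_ge0 y); move: `|x| `|y| => {x y} x y x0 y0.
have c0 : 0 <= p * (p - 1) / 16 by apply: divr_ge0 => //; apply: mulr_ge0; lra.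
have [x00|xn0] := eqVneq (x + y) 0.
  have [-> ->] : x = 0 /\ y = 0 by split; lra.
  by rewrite addr0 subr0 normr0 powR0 ?expr0n /=; [rewrite mul0r !mulr0 addr0|lra].
have W0 : 0 <= (x + y) `^ (p - 2) by exact: powR_ge0.
have W z : 0 < z -> z <= x + y -> (x + y) `^ (p - 2) <= z `^ (p - 2).
  move=> z0 zxy; rewrite (_ : p - 2 = - (2 - p)); [rewrite !powRN|by ring].
  rewrite lef_pV2 ?posrE ?powR_gt0//.
    by apply: powR_ler => //; lra.
  by exact: lt_le_trans zxy.
have [yx|xy] := leP y x.
  rewrite ger0_norm ?subr_ge0//; apply: le_trans (clarkson_le2_small p12 y0 yx).
  have xp : 0 < x by rewrite lt_neqAle x0 andbT; apply: contra_neq xn0 => x00; lra.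
  have := W x xp; rewrite lerDl => /(_ y0) h.
  rewrite lerD2l; apply: (@le_trans _ _ (p * (p - 1) / 16 * (y ^+ 2 * x `^ (p - 2)))).
    by rewrite ler_wpM2l// ler_wpM2l// sqr_ge0.
  apply: ler_wpM2r; first by rewrite mulr_ge0 ?sqr_ge0 ?powR_ge0.
  have : 0 <= p * (p - 1) by apply: mulr_ge0; lra.
  lra.
have yp : 0 < y by exact: le_lt_trans xy.
rewrite ltr0_norm ?subr_lt0// opprB [x + y]addrC.
apply: le_trans (clarkson_le2_small p12 x0 (ltW xy)).
have := W y yp; rewrite lerDr => /(_ x0); rewrite [x + y]addrC => h.
have Y0 : 0 <= y `^ (p - 2) by exact: powR_ge0.
have yE : y `^ p = y ^+ 2 * y `^ (p - 2).
  rewrite -(powR_mulrn 2 y0) -powRD ?(gt_eqF yp) ?implybT//; congr (_ `^ _); ring.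
have xE : x `^ p <= x * y * y `^ (p - 2).
  have p0 : p != 0 by lra.
  rewrite (powRSr x0 p0) -mulrA ler_wpM2l//.
  have -> : y * y `^ (p - 2) = y `^ (p - 1).
    by rewrite -{1}(powRr1 y0) -powRD ?(gt_eqF yp) ?implybT//; congr (_ `^ _); ring.
  by apply: powR_ler => //; [lra|exact: ltW].
rewrite yE.
have h2 : y ^+ 2 * (y + x) `^ (p - 2) <= y ^+ 2 * y `^ (p - 2) by rewrite ler_wpM2l// sqr_ge0.
have c4 : p * (p - 1) / 16 <= 1 / 8.
  by rewrite ler_pdivrMr//; move: p1 p2; clear; nra.
apply: (le_trans (lerD (lexx _) (ler_wpM2l c0 h2))).
have -> : p * (p - 1) / 8 = 2 * (p * (p - 1) / 16) by field.
move: c0 c4; move: (p * (p - 1) / 16) => c c0 c4.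
apply: (@le_trans _ _ (2 * (x * y * y `^ (p - 2)) + c * (y ^+ 2 * y `^ (p - 2)))); first by rewrite lerD2r ler_wpM2l.
have -> : 2 * (x * y * y `^ (p - 2)) + c * (y ^+ 2 * y `^ (p - 2)) = (2 * (x * y) + c * y ^+ 2) * y `^ (p - 2) by ring.
have -> : 2 * (y ^+ 2 * y `^ (p - 2)) + 2 * c * (x ^+ 2 * y `^ (p - 2)) = (2 * y ^+ 2 + 2 * c * x ^+ 2) * y `^ (p - 2) by ring.
apply: ler_wpM2r => //.
have d0 : 0 <= y - x by lra.
have yE' : y = x + (y - x) by ring.
rewrite yE'; move: d0; move: (y - x) => d d0.
have xd : 0 <= x * d by exact: mulr_ge0.
have d2 : 0 <= d ^+ 2 by exact: sqr_ge0.
have x2 : 0 <= x ^+ 2 by exact: sqr_ge0.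
rewrite -subr_ge0.
have -> : 2 * (x + d) ^+ 2 + 2 * c * x ^+ 2 - (2 * (x * (x + d)) + c * (x + d) ^+ 2) =
  c * x ^+ 2 + (2 - 2 * c) * (x * d) + (2 - c) * d ^+ 2 by ring.
by apply: addr_ge0; [apply: addr_ge0|]; apply: mulr_ge0 => //; lra.
Qed.

(* Substitute for Hoelder's inequality in the proof of uniform convexity:
   the two cases are [d * (a + b) <= b] and its negation. *)
Lemma powR_split p d a b : 1 < p <= 2 -> 0 < d <= 1 -> 0 <= a -> 0 <= b ->
  b `^ p <= d `^ (p - 2) * (b ^+ 2 * (a + b) `^ (p - 2)) + d `^ p * (a + b) `^ p.
Proof.
move=> /andP[p1 p2] /andP[d0 d1] a0 b0.
have ab0 : 0 <= a + b by exact: addr_ge0.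
have [b00|bn0] := eqVneq b 0.
  rewrite b00 powR0; last by lra.
  by rewrite addr_ge0// mulr_ge0 ?powR_ge0// mulr_ge0 ?sqr_ge0 ?powR_ge0.
have bp : 0 < b by rewrite lt_neqAle eq_sym bn0.
have [h|h] := leP (d * (a + b)) b; last first.
  rewrite -powRM ?(ltW d0)//; apply: (@le_trans _ _ ((d * (a + b)) `^ p)).
    by apply: powR_ler => //; [lra|exact: ltW].
  by rewrite lerDr mulr_ge0 ?powR_ge0// mulr_ge0 ?sqr_ge0 ?powR_ge0.
apply: (@le_trans _ _ (d `^ (p - 2) * (b ^+ 2 * (a + b) `^ (p - 2)))); last first.
  by rewrite lerDl mulr_ge0 ?powR_ge0.
rewrite mulrCA -powRM ?(ltW d0)//.
have -> : b `^ p = b ^+ 2 * b `^ (p - 2).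
  by rewrite -(powR_mulrn 2 b0) -powRD ?bn0 ?implybT//; congr (_ `^ _); ring.
rewrite ler_wpM2l ?sqr_ge0//.
have dp : 0 < d * (a + b) by apply: mulr_gt0 => //; apply: (lt_le_trans bp); rewrite lerDr.
rewrite (_ : p - 2 = - (2 - p)); [rewrite !powRN|by ring].
  rewrite lef_pV2 ?posrE ?powR_gt0//.
by apply: powR_ler => //; [lra|exact: ltW].
Qed.

End real_inequalities.
(** * Averages and Jensen's inequality *)

HB.lock Definition nm (R : realType) (N : nat) (p : R) (f : 'rV[R]_N -> R) : R :=
  Int (fun x => `|f x| `^ p) `^ p^-1.

Section averages.
Variables (R : realType) (N : nat).
Local Notation V := 'rV[R]_N.
Implicit Types (f g h k u : V -> R) (F G : V -> V -> R).

(* [L^1] and bounded, hence in every [L^p] *)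
Definition cls f := [/\ measurable_fun setT f, (exists M : R, forall x, `|f x| <= M) & itg f].

Lemma cls_meas f : cls f -> measurable_fun setT f. Proof. by case. Qed.
Lemma cls_itg f : cls f -> itg f. Proof. by case. Qed.

Lemma cls0 : cls (fun=> 0).
Proof. by split; [|exists 0 => x; rewrite normr0|exact: itg0]. Qed.

Lemma clsD f g : cls f -> cls g -> cls (fun x => f x + g x).
Proof.
move=> [mf [A hA] hf] [mg [B hB] hg]; split; [exact: measurable_funD| |exact: itgD].
by exists (A + B) => x; apply: le_trans (ler_normD _ _) _; exact: lerD.
Qed.

Lemma clsZ (c : R) f : cls f -> cls (fun x => c * f x).
Proof.
move=> [mf [A hA] hf]; split; [exact: measurable_funM| |exact: itgZ].
by exists (`|c| * A) => x; rewrite normrM ler_wpM2l.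
Qed.

Lemma eq_cls f g : f =1 g -> cls f -> cls g.
Proof. by move=> /funext ->. Qed.

Lemma clsB f g : cls f -> cls g -> cls (fun x => f x - g x).
Proof.
move=> cf cg; apply: (eq_cls _ (clsD cf (clsZ (-1) cg))) => x /=.
by rewrite mulN1r.
Qed.

Lemma cls_sum (I : Type) (s : seq I) (f : I -> V -> R) :
  (forall i, cls (f i)) -> cls (fun x => \sum_(i <- s) f i x).
Proof.
move=> hf; elim: s => [|i s ih].
  by apply: eq_cls cls0 => x; rewrite big_nil.
by apply: eq_cls (clsD (hf i) ih) => x; rewrite big_cons.
Qed.

Lemma cls_affine f (a : R) (b : V) : a != 0 -> cls f -> cls (fun x => f (a *: x + b)).
Proof.
move=> a0 [mf [A hA] hf]; split; [|by exists A => x|exact: itg_affine].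
exact: (measurableT_comp mf (measurable_affine a b)).
Qed.

Lemma cls_shift f (b : V) : cls f -> cls (fun x => f (x + b)).
Proof.
move=> cf; apply: (eq_cls _ (cls_affine b (oner_neq0 R) cf)) => x /=.
by rewrite scale1r.
Qed.

Lemma clsM f u : cls f -> measurable_fun setT u -> (exists M : R, forall x, `|u x| <= M) ->
  cls (fun x => u x * f x).
Proof.
move=> [mf [A hA] hf] mu [B hB]; split; first exact: measurable_funM.
  by exists (B * A) => x; rewrite normrM ler_pM.
have B0 : 0 <= B by exact: le_trans (normr_ge0 _) (hB 0).
apply: (le_itg _ _ (itgZ B (itg_norm hf))); first exact: measurable_funM.
by move=> x /=; rewrite normrM ler_wpM2r.
Qed.

Lemma clsMM f g : cls f -> cls g -> cls (fun x => f x * g x).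
Proof. by move=> [mf bf _] cg; exact: clsM. Qed.

Lemma cls_norm f : cls f -> cls (fun x => `|f x|).
Proof.
move=> [mf [A hA] hf]; split; [exact: measurableT_comp| |exact: itg_norm].
by exists A => x; rewrite normr_id.
Qed.

Lemma measurable_powR_norm p f : measurable_fun setT f -> measurable_fun setT (fun x => `|f x| `^ p).
Proof.
by move=> mf; apply: (measurableT_comp (measurable_powR p)); exact: measurableT_comp.
Qed.

Lemma cls_pow p f : 1 <= p -> cls f -> cls (fun x => `|f x| `^ p).
Proof.
move=> p1 [mf [A hA] hf].
have mp := measurable_powR_norm p mf.
split=> //.
  exists (A `^ p) => x; rewrite ger0_norm ?powR_ge0// powR_ler//; lra.
apply: (le_itg mp _ (itgZ (A `^ (p - 1)) (itg_norm hf))) => x.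
by rewrite ger0_norm ?powR_ge0// powR_le_linear.
Qed.

(** A family of functions of [x] indexed by [y], bounded and uniformly in [L^1] in [x]. Nothing is
    asked in the direction of [y]: there integrability comes from the kernel against which the
    family is averaged. The translates of one function form such a family. *)
Definition fam G := [/\ mfun2 G, (exists M : R, forall x y, `|G x y| <= M) &
  exists B : R, forall y, itg (G ^~ y) /\ Int (fun x => `|G x y|) <= B].

Lemma famD F G : fam F -> fam G -> fam (fun x y => F x y + G x y).
Proof.
move=> [mF [A hA] [B hB]] [mG [C hC] [D hD]]; split; first exact: measurable_funD.
  by exists (A + C) => x y; apply: le_trans (ler_normD _ _) _; exact: lerD.
exists (B + D) => y; have [[h1 h2] [h3 h4]] := (hB y, hD y); split; first exact: itgD.
apply: le_trans (lerD h2 h4); rewrite -IntD; [|exact: itg_norm|exact: itg_norm].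
apply: le_Int; [exact/itg_norm/itgD|by apply: itgD; exact: itg_norm|].
by move=> x; exact: ler_normD.
Qed.

Lemma famM G u : fam G -> measurable_fun setT u -> (exists M : R, forall x, `|u x| <= M) ->
  fam (fun x y => u x * G x y).
Proof.
move=> [mG [A hA] [B hB]] mu [C hC].
have C0 : 0 <= C by exact: le_trans (normr_ge0 _) (hC 0).
split; first by apply: measurable_funM => //; exact: (mfun2_x mu).
  by exists (C * A) => x y; rewrite normrM ler_pM.
exists (C * B) => y; have [h1 h2] := hB y.
have i1 : itg (fun x => u x * G x y).
  apply: (le_itg _ _ (itgZ C (itg_norm h1))); last by move=> x; rewrite normrM ler_wpM2r.
  by apply: measurable_funM => //; exact: (mfun2_r y mG).
split=> //; apply: le_trans (ler_wpM2l C0 h2).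
rewrite -IntZ; last exact: itg_norm.
apply: le_Int; [exact: itg_norm|by apply: itgZ; exact: itg_norm|].
by move=> x; rewrite normrM ler_wpM2r.
Qed.

Lemma famZ (c : R) G : fam G -> fam (fun x y => c * G x y).
Proof. by move=> fG; apply: (famM (u := fun=> c) fG) => //; exists `|c| => x. Qed.

Lemma eq_fam F G : (forall x y, F x y = G x y) -> fam F -> fam G.
Proof. by move=> FG; have -> : F = G by apply/funext => x; apply/funext => y. Qed.

Lemma famB F G : fam F -> fam G -> fam (fun x y => F x y - G x y).
Proof. by move=> hF hG; apply: (eq_fam _ (famD hF (famZ (-1) hG))) => x y; rewrite mulN1r. Qed.

Lemma fam_affine f (a b : R) (c : V) : a != 0 -> cls f ->
  fam (fun x y => f (a *: x + b *: y + c)).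
Proof.
move=> a0 [mf [A hA] hf]; split; [exact: mfun2_comp|by exists A|].
exists (`|a| ^- N * Int (fun x => `|f x|)) => y.
have h : itg (fun x => f (a *: x + (b *: y + c))) by exact: itg_affine.
have E : (fun x => f (a *: x + b *: y + c)) = (fun x => f (a *: x + (b *: y + c))).
  by apply/funext => x; rewrite addrA.
rewrite E; split=> //.
under eq_Int do rewrite -addrA.
rewrite [X in _ * X](Int_affine (b *: y + c) a0); last exact: itg_norm.
by rewrite mulrA mulVf ?mul1r// expf_neq0// normr_eq0.
Qed.

Lemma fam_shift f (b : R) : cls f -> fam (fun x y => f (x + b *: y)).
Proof.
move=> cf; apply: (eq_fam _ (fam_affine b 0 (oner_neq0 R) cf)) => x y.
by rewrite scale1r addr0.
Qed.

Lemma fam_cst f : cls f -> fam (fun x _ => f x).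
Proof.
by move=> cf; apply: (eq_fam _ (fam_shift 0 cf)) => x y; rewrite scale0r addr0.
Qed.

Lemma fam_pow p G : 1 <= p -> fam G -> fam (fun x y => `|G x y| `^ p).
Proof.
move=> p1 [mG [A hA] [B hB]].
have A0 : 0 <= A by exact: le_trans (normr_ge0 _) (hA 0 0).
have mp : mfun2 (fun x y => `|G x y| `^ p).
  by apply: (measurableT_comp (measurable_powR p)); exact: measurableT_comp.
have lin x y : `| `|G x y| `^ p | <= A `^ (p - 1) * `|G x y|.
  by rewrite ger0_norm ?powR_ge0// powR_le_linear.
split=> //.
  exists (A `^ p) => x y; rewrite ger0_norm ?powR_ge0// powR_ler//; lra.
exists (A `^ (p - 1) * B) => y; have [h1 h2] := hB y.
have i1 : itg (fun x => `|G x y| `^ p).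
  by apply: (le_itg _ (lin ^~ y) (itgZ _ (itg_norm h1))); exact: (mfun2_r y mp).
split=> //; apply: le_trans (ler_wpM2l (powR_ge0 _ _) h2).
rewrite -IntZ; last exact: itg_norm.
by apply: le_Int; [exact: itg_norm|by apply: itgZ; exact: itg_norm|exact: (lin ^~ y)].
Qed.

Definition avg k G : V -> R := fun x => Int (fun y => k y * G x y).

Lemma avg_itg k G x : itg k -> fam G -> itg (fun y => k y * G x y).
Proof.
move=> ik [mG [M hM] _].
apply: (le_itg _ _ (itgZ M (itg_norm ik))).
  by apply: measurable_funM; [exact: itg_meas|exact: mfun2_l].
by move=> y; rewrite normrM mulrC ler_wpM2r.
Qed.

Lemma avg_mfun2 k G : itg k -> fam G -> mfun2 (fun x y => k y * G x y).
Proof.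
by move=> ik [mG _ _]; apply: measurable_funM => //; exact: (mfun2_y (itg_meas ik)).
Qed.

Lemma avg_fubini k G : itg k -> fam G ->
  [/\ itg (avg k G), itg (fun y => k y * Int (G ^~ y)) &
      Int (avg k G) = Int (fun y => k y * Int (G ^~ y))].
Proof.
move=> ik fG; have [mG [M hM] [B hB]] := fG.
have m2 := avg_mfun2 ik fG.
have iy y : itg (fun x => k y * G x y) by apply: itgZ; exact: (hB y).1.
have hI : itg (fun y => Int (fun x => `|k y * G x y|)).
  apply: (le_itg _ _ (itgZ B (itg_norm ik))).
    apply: (mfun_Int (F := fun y x => `|k y * G x y|)).
      by apply: measurableT_comp => //; exact: (mfun2_swap m2).
    by move=> y; exact: itg_norm.
  move=> y; rewrite ger0_norm; last by apply: Int_ge0 => x.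
  under eq_Int do rewrite normrM.
  rewrite IntZ; last by apply: itg_norm; exact: (hB y).1.
  by rewrite mulrC ler_wpM2r//; exact: (hB y).2.
have [h1 h2 h3] := fubini_itg m2 (fun x => avg_itg x ik fG) iy hI.
have E y : Int (fun x => k y * G x y) = k y * Int (G ^~ y).
  by rewrite IntZ//; exact: (hB y).1.
split=> //; first by apply: (eq_itg _ h2) => y; exact: E.
by rewrite [LHS]h3; apply: eq_Int => y; exact: E.
Qed.

Lemma avg_cls k G : itg k -> fam G -> cls (avg k G).
Proof.
move=> ik fG; have [h1 _ _] := avg_fubini ik fG; have [mG [M hM] _] := fG.
split=> //; first exact: itg_meas.
exists (M * Int (fun y => `|k y|)) => x; apply: le_trans (Int_norm (avg_itg x ik fG)) _.
rewrite -IntZ; last exact: itg_norm.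
apply: le_Int; [by apply: itg_norm; exact: avg_itg|by apply: itgZ; exact: itg_norm|].
by move=> y; rewrite normrM mulrC ler_wpM2r.
Qed.

Lemma avg_dual k G u : itg k -> fam G -> measurable_fun setT u ->
  (exists M : R, forall x, `|u x| <= M) ->
  Int (fun x => u x * avg k G x) = Int (fun y => k y * Int (fun x => u x * G x y)).
Proof.
move=> ik fG mu bu; have [_ _ <-] := avg_fubini ik (famM fG mu bu).
apply: eq_Int => x; rewrite /avg -IntZ; last exact: avg_itg.
by apply: eq_Int => y; ring.
Qed.

Lemma avg_norm k G x : itg k -> fam G -> `|avg k G x| <= avg (fun y => `|k y|) (fun x y => `|G x y|) x.
Proof.
move=> ik fG; apply: le_trans (Int_norm (avg_itg x ik fG)) _.
by rewrite /avg; under eq_Int do rewrite normrM.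
Qed.

(** The tangent argument of [jensen_sum], under the measure of density [k]. A kernel of zero mass is
    harmless because [T <= M * S]. *)
Lemma jensen_Int k u p : 1 <= p -> itg k -> (forall y, 0 <= k y) ->
  measurable_fun setT u -> (exists M : R, forall y, `|u y| <= M) -> (forall y, 0 <= u y) ->
  (Int (fun y => k y * u y)) `^ p <= (Int k) `^ (p - 1) * Int (fun y => k y * u y `^ p).
Proof.
move=> p1 ik k0 mu [M hM] u0.
have p0 : p != 0 by lra.
have kb (w : V -> R) : measurable_fun setT w -> (forall y, `|w y| <= M `^ p + M + 1) -> itg (fun y => k y * w y).
  move=> mw hw; apply: (le_itg _ _ (itgZ (M `^ p + M + 1) ik)).
    by apply: measurable_funM => //; exact: itg_meas.
  by move=> y; rewrite normrM mulrC (ger0_norm (k0 y)) ler_wpM2r.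
have M0 : 0 <= M by exact: le_trans (normr_ge0 _) (hM 0).
have iku : itg (fun y => k y * u y).
  apply: kb => // y; apply: le_trans (hM y) _.
  by have := powR_ge0 M p; lra.
have ikp : itg (fun y => k y * u y `^ p).
  apply: kb; first exact: (measurableT_comp (measurable_powR p)).
  move=> y; rewrite ger0_norm ?powR_ge0//.
  have : u y `^ p <= M `^ p by apply: powR_ler => //; [lra|rewrite -[u y]ger0_norm].
  lra.
set S := Int k; set T := Int _.
have S0 : 0 <= S by exact: Int_ge0.
have T0 : 0 <= T by apply: Int_ge0 => y; exact: mulr_ge0.
have X0 : 0 <= Int (fun y => k y * u y `^ p) by apply: Int_ge0 => y; rewrite mulr_ge0// powR_ge0.
have TS : T <= M * S.
  rewrite /S -IntZ//; apply: le_Int => //; first exact: itgZ.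
  by move=> y; rewrite mulrC ler_wpM2r//; rewrite -[u y]ger0_norm.
have [S00|Sn0] := eqVneq S 0.
  have -> : T = 0 by apply/eqP; rewrite eq_le T0 andbT -(mulr0 M) -S00.
  by rewrite powR0// mulr_ge0// powR_ge0.
have Sp : 0 < S by rewrite lt_neqAle eq_sym Sn0.
pose a := T / S; have a0 : 0 <= a by rewrite divr_ge0.
have H : S * a `^ p <= Int (fun y => k y * u y `^ p).
  pose c := p * a `^ (p - 1).
  have i2 : itg (fun y => (a `^ p - c * a) * k y + c * (k y * u y)) by apply: itgD; exact: itgZ.
  apply: (@le_trans _ _ (Int (fun y => (a `^ p - c * a) * k y + c * (k y * u y)))); last first.
    apply: le_Int => // y.
    have := ler_wpM2l (k0 y) (powR_tangent p1 a0 (u0 y)); rewrite -/c; apply: le_trans.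
    by rewrite le_eqVlt; apply/orP; left; apply/eqP; ring.
  rewrite IntD; [|exact: itgZ|exact: itgZ]; rewrite !IntZ// -/S -/T.
  have -> : T = S * a by rewrite /a mulrCA mulfV// mulr1.
  by rewrite le_eqVlt; apply/orP; left; apply/eqP; ring.
apply: (le_trans _ (ler_wpM2l (powR_ge0 _ _) H)).
have -> : T = S * a by rewrite /a mulrCA mulfV// mulr1.
by rewrite powRM// (powRSr S0 p0) mulrA [S `^ _ * S]mulrC.
Qed.

Definition Np p f : R := Int (fun x => `|f x| `^ p).

Lemma nmE p f : nm p f = Np p f `^ p^-1.
Proof. by rewrite nm.unlock. Qed.

Lemma Np_ge0 p f : 0 <= Np p f.
Proof. by apply: Int_ge0 => x; exact: powR_ge0. Qed.

Lemma nm_ge0 p f : 0 <= nm p f.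
Proof. by rewrite nmE powR_ge0. Qed.

Lemma nm_pow p f : p != 0 -> nm p f `^ p = Np p f.
Proof. by move=> p0; rewrite !nmE powRVK// Np_ge0. Qed.

Lemma le_Np p f g : 1 <= p -> cls f -> cls g -> (forall x, `|f x| <= `|g x|) -> Np p f <= Np p g.
Proof.
move=> p1 cf cg fg; apply: le_Int; [exact/cls_itg/cls_pow|exact/cls_itg/cls_pow|].
by move=> x; apply: powR_ler => //; lra.
Qed.

Lemma eq_Np p f g : f =1 g -> Np p f = Np p g.
Proof. by move=> /funext ->. Qed.

Lemma eq_nm p f g : f =1 g -> nm p f = nm p g.
Proof. by move=> /funext ->. Qed.

Lemma nmZ p (c : R) f : 1 <= p -> cls f -> nm p (fun x => c * f x) = `|c| * nm p f.
Proof.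
move=> p1 cf; have p0 : p != 0 by lra.
rewrite !nmE /Np; under eq_Int do rewrite normrM powRM//.
rewrite IntZ; last exact/cls_itg/cls_pow.
by rewrite powRM ?powR_ge0 ?Np_ge0// powRK.
Qed.

Lemma Np_affine p f (a : R) (b : V) : 1 <= p -> a != 0 -> cls f ->
  Np p f = `|a| ^+ N * Np p (fun x => f (a *: x + b)).
Proof. by move=> p1 a0 cf; rewrite /Np (Int_affine b a0)//; exact/cls_itg/cls_pow. Qed.

Lemma Np_shift p f (b : V) : 1 <= p -> cls f -> Np p (fun x => f (x + b)) = Np p f.
Proof.
move=> p1 cf; rewrite (Np_affine b p1 (oner_neq0 R) cf) normr1 expr1n mul1r.
by apply: eq_Np => x; rewrite scale1r.
Qed.

Lemma fam_Np_itg p k G : 1 <= p -> itg k -> fam G -> itg (fun y => k y * Np p (G ^~ y)).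
Proof. by move=> p1 ik fG; have [_ h _] := avg_fubini ik (fam_pow p1 fG). Qed.

Lemma fam_Np_bound p G : 1 <= p -> fam G ->
  measurable_fun setT (fun y => Np p (G ^~ y)) /\ exists M, forall y, `|Np p (G ^~ y)| <= M.
Proof.
move=> p1 fG; have [m2 _ [B hB]] := fam_pow p1 fG; split.
  by apply: (mfun_Int (mfun2_swap m2)) => y; exact: (hB y).1.
exists B => y; have [_] := hB y; rewrite ger0_norm ?Np_ge0//; apply: le_trans.
by rewrite /Np; under [leRHS]eq_Int do rewrite ger0_norm ?powR_ge0//.
Qed.

(** Jensen under [|k|], then Tonelli. This takes the place of Minkowski's integral inequality and
    stays with p-th powers, in which increments are integrated throughout. *)
Lemma Np_avg p k G : 1 <= p -> itg k -> fam G ->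
  Np p (avg k G) <= (Int (fun y => `|k y|)) `^ (p - 1) * Int (fun y => `|k y| * Np p (G ^~ y)).
Proof.
move=> p1 ik fG; have ik' := itg_norm ik.
have [h1 h2 h3] := avg_fubini ik' (fam_pow p1 fG).
rewrite -h3 -IntZ//; apply: le_Int.
- by apply/cls_itg/cls_pow => //; exact: avg_cls.
- exact: itgZ.
move=> x; have [mG [M hM] _] := fG.
apply: (@le_trans _ _ ((Int (fun y => `|k y| * `|G x y|)) `^ p)).
  by apply: powR_ler => //; [lra|exact: avg_norm].
apply: jensen_Int => //.
- by apply: measurableT_comp => //; exact: mfun2_l.
- by exists M => y; rewrite normr_id.
Qed.

End averages.
(** * Convolutions, dilations and differences *)

Section convolutions.
Variables (R : realType) (N : nat).
Local Notation V := 'rV[R]_N.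
Local Notation mu := (@lebesgue_rV R N).
Implicit Types (f g h k l u : V -> R) (a b p : R).

Lemma Lnorm_nm p f : 1 <= p -> cls f -> ('N[mu]_p%:E[EFin \o f])%E = (nm p f)%:E.
Proof.
move=> p1 cf; rewrite unlock /=.
rewrite !nmE /Np -poweR_EFin IntE; last exact/cls_itg/cls_pow.
by congr (_ `^ _)%E; apply: eq_integral => x _; rewrite -poweR_EFin.
Qed.

Lemma nm_triangle p f g : 1 <= p -> cls f -> cls g -> nm p (fun x => f x + g x) <= nm p f + nm p g.
Proof.
move=> p1 cf cg; have := minkowski_EFin mu (cls_meas cf) (cls_meas cg) p1.
rewrite (Lnorm_nm p1 cf) (Lnorm_nm p1 cg).
have -> : (f \+ g)%R = (fun x => f x + g x) by [].
by rewrite (Lnorm_nm p1 (clsD cf cg)) -EFinD lee_fin.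
Qed.

Lemma nm0 p : p != 0 -> nm p (fun _ : V => 0) = 0.
Proof.
move=> p0; rewrite !nmE /Np; under eq_Int do rewrite normr0 powR0//.
by rewrite Int0 powR0// invr_neq0.
Qed.

Lemma nm_sum p (I : Type) (s : seq I) (f : I -> V -> R) : 1 <= p -> (forall i, cls (f i)) ->
  nm p (fun x => \sum_(i <- s) f i x) <= \sum_(i <- s) nm p (f i).
Proof.
move=> p1 cf; elim: s => [|i s ih].
  rewrite big_nil (_ : nm _ _ = 0)//; rewrite -[RHS](@nm0 p); last by lra.
  by apply: eq_nm => x; rewrite big_nil.
rewrite big_cons; apply: le_trans (lerD (lexx _) ih).
rewrite (_ : nm p _ = nm p (fun x => f i x + \sum_(j <- s) f j x)).
  by apply: nm_triangle => //; exact: cls_sum.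
by apply: eq_nm => x; rewrite big_cons.
Qed.

Lemma hoelder_Int p p' f g : 1 < p -> 1 < p' -> p^-1 + p'^-1 = 1 -> cls f -> cls g ->
  `|Int (fun x => f x * g x)| <= nm p f * nm p' g.
Proof.
move=> p1 p1' pp cf cg.
have := hoelder mu (cls_meas cf) (cls_meas cg) (lt_trans ltr01 p1) (lt_trans ltr01 p1') pp.
rewrite (Lnorm_nm (ltW p1) cf) (Lnorm_nm (ltW p1') cg).
have cfg := clsMM cf cg.
have -> : (f \* g)%R = (fun x => f x * g x) by [].
rewrite (Lnorm_nm (lexx 1) cfg) -EFinM lee_fin; apply: le_trans.
rewrite !nmE invr1 powRr1 ?Np_ge0//.
apply: le_trans (Int_norm (cls_itg cfg)) _.
by rewrite /Np le_eqVlt; apply/orP; left; apply/eqP/eq_Int => x; rewrite powRr1.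
Qed.

Definition N1 f : R := Int (fun x => `|f x|).

Lemma N1_ge0 f : 0 <= N1 f.
Proof. by apply: Int_ge0 => x. Qed.

(** The normalisation preserves integrals; [dil (2 ^ j) eta] is the convolution kernel of the
    projection of index [j]. *)
Definition dil a f : V -> R := fun x => a ^+ N * f (a *: x).
Definition fdiff (z : V) f : V -> R := fun x => f (x + z) - f x.
Definition conv g k : V -> R := avg k (fun x y => g (x - y)).

Lemma cls_dil a f : 0 < a -> cls f -> cls (dil a f).
Proof.
move=> a0 cf; apply: clsZ.
by apply: (eq_cls _ (cls_affine 0 (lt0r_neq0 a0) cf)) => x; rewrite addr0.
Qed.

Lemma cls_fdiff z f : cls f -> cls (fdiff z f).
Proof. by move=> cf; apply: clsB => //; exact: cls_shift. Qed.

Lemma Int_dil a f : 0 < a -> itg f -> Int (dil a f) = Int f.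
Proof.
move=> a0 hf; rewrite [RHS](Int_affine 0 (lt0r_neq0 a0) hf) /dil IntZ.
  by rewrite gtr0_norm//; congr (_ * _); apply: eq_Int => x; rewrite addr0.
by apply: (eq_itg _ (itg_affine 0 (lt0r_neq0 a0) hf)) => x; rewrite addr0.
Qed.

Lemma dil_norm a f x : 0 < a -> `|dil a f x| = dil a (fun x => `|f x|) x.
Proof. by move=> a0; rewrite /dil normrM ger0_norm// exprn_ge0// ltW. Qed.

Lemma N1_dil a f : 0 < a -> itg f -> N1 (dil a f) = N1 f.
Proof.
move=> a0 hf; rewrite /N1; under eq_Int do rewrite dil_norm//.
by rewrite Int_dil//; exact: itg_norm.
Qed.

Lemma dil_dil a b f : dil a (dil b f) = dil (a * b) f.
Proof. by apply/funext => x; rewrite /dil exprMn scalerA [a * b]mulrC; ring. Qed.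

Lemma fam_sub f : cls f -> fam (fun x y => f (x - y)).
Proof. by move=> cf; apply: (eq_fam _ (fam_shift (-1) cf)) => x y; rewrite scaleN1r. Qed.

Lemma fam_add f : cls f -> fam (fun x y => f (x + y)).
Proof. by move=> cf; apply: (eq_fam _ (fam_shift 1 cf)) => x y; rewrite scale1r. Qed.

Lemma cls_conv g k : cls g -> itg k -> cls (conv g k).
Proof. by move=> cg ik; apply: avg_cls => //; exact: fam_sub. Qed.

Lemma itg_conv1 g k x : cls g -> itg k -> itg (fun y => k y * g (x - y)).
Proof. by move=> cg ik; exact: (avg_itg x ik (fam_sub cg)). Qed.

Lemma Int_reflect f (b : V) : itg f -> Int (fun x => f (b - x)) = Int f.
Proof.
move=> hf; have h : -1 != 0 :> R by rewrite oppr_eq0 oner_neq0.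
rewrite [RHS](Int_affine b h hf).
rewrite normrN1 expr1n mul1r; apply: eq_Int => x.
by rewrite scaleN1r addrC.
Qed.

Lemma Int_shift f (b : V) : itg f -> Int (fun x => f (x + b)) = Int f.
Proof.
move=> hf; rewrite [RHS](Int_affine b (oner_neq0 R))//.
by rewrite normr1 expr1n mul1r; apply: eq_Int => x; rewrite scale1r.
Qed.

Lemma convC g k : cls g -> cls k -> conv g k = conv k g.
Proof.
move=> cg ck; apply/funext => x; rewrite /conv /avg.
rewrite -[LHS](Int_reflect x); last by exact: itg_conv1 (cls_itg ck).
apply: eq_Int => y; have -> : x - (x - y) = y by rewrite opprB addrC subrK.
by rewrite mulrC.
Qed.

Lemma convDl f g k : cls f -> cls g -> itg k ->
  conv (fun x => f x + g x) k = (fun x => conv f k x + conv g k x).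
Proof.
move=> cf cg ik; apply/funext => x; rewrite /conv /avg -IntD; [|exact: itg_conv1..].
by apply: eq_Int => y; rewrite mulrDr.
Qed.

Lemma convBl f g k : cls f -> cls g -> itg k ->
  conv (fun x => f x - g x) k = (fun x => conv f k x - conv g k x).
Proof.
move=> cf cg ik; apply/funext => x; rewrite /conv /avg -IntB; [|exact: itg_conv1..].
by apply: eq_Int => y; rewrite mulrBr.
Qed.

Lemma convBr f k l : cls f -> itg k -> itg l ->
  conv f (fun x => k x - l x) = (fun x => conv f k x - conv f l x).
Proof.
move=> cf ik il; apply/funext => x; rewrite /conv /avg -IntB; [|exact: itg_conv1..].
by apply: eq_Int => y; rewrite mulrBl.
Qed.

Lemma conv_suml (I : Type) (s : seq I) (f : I -> V -> R) k : (forall i, cls (f i)) -> itg k ->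
  conv (fun x => \sum_(i <- s) f i x) k = (fun x => \sum_(i <- s) conv (f i) k x).
Proof.
move=> cf ik; apply/funext => x; rewrite /conv /avg -Int_sum; last first.
  by move=> i; exact: itg_conv1.
by apply: eq_Int => y; rewrite mulr_sumr.
Qed.

Lemma conv_fdiffl z g k : cls g -> itg k -> conv (fdiff z g) k = fdiff z (conv g k).
Proof.
move=> cg ik; rewrite /fdiff (convBl (cls_shift z cg) cg ik).
by apply/funext => x; congr (_ - _); apply: eq_Int => y; rewrite addrAC.
Qed.

Lemma conv_fdiffr z g k : cls g -> cls k -> conv g (fdiff z k) = fdiff z (conv g k).
Proof.
move=> cg ck; rewrite (convC cg (cls_fdiff z ck)) (conv_fdiffl z ck (cls_itg cg)).
by rewrite (convC cg ck).
Qed.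

Lemma convA f k l : cls f -> cls k -> cls l -> conv (conv f k) l = conv f (conv k l).
Proof.
move=> cf ck cl; apply/funext => x; rewrite {1}/conv /avg.
have cfx : cls (fun w => f (x - w)).
  have := cls_affine x (a:=-1) _ cf; rewrite oppr_eq0 oner_neq0 => /(_ isT).
  by apply: eq_cls => w; rewrite scaleN1r addrC.
have [mfx bfx _] := cfx.
transitivity (Int (fun w => f (x - w) * avg l (fun w z => k (w - z)) w)); last first.
  by apply: eq_Int => w; rewrite mulrC.
rewrite (avg_dual (cls_itg cl) (fam_sub ck) mfx bfx); apply: eq_Int => z; congr (_ * _).
rewrite {1}/conv /avg.
rewrite -[RHS](Int_shift z); last by apply/cls_itg/clsMM => //; exact: cls_shift.
apply: eq_Int => y; have -> : x - (y + z) = x - z - y by rewrite [y + z]addrC opprD addrA.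
by rewrite addrK mulrC.
Qed.

Lemma conv_dil a g k : 0 < a -> cls g -> itg k -> conv (dil a g) (dil a k) = dil a (conv g k).
Proof.
move=> a0 cg ik; apply/funext => x; rewrite {3}/dil /conv /avg.
rewrite -(@Int_dil a (fun y => k y * g (a *: x - y)))//; last exact: itg_conv1.
rewrite -IntZ; last first.
  have h := itg_affine 0 (lt0r_neq0 a0) (itg_conv1 (a *: x) cg ik).
  by apply: (eq_itg _ (itgZ (a ^+ N) h)) => y; rewrite addr0.
by apply: eq_Int => y; rewrite /dil scalerBr; ring.
Qed.

Lemma conv_adj f k u : (forall x, k (- x) = k x) -> cls f -> cls k -> cls u ->
  Int (fun x => u x * conv f k x) = Int (fun x => f x * conv u k x).
Proof.
move=> ek cf ck cu; have [mu' bu _] := cu; have [mf bf _] := cf.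
rewrite /conv (avg_dual (cls_itg ck) (fam_sub cf) mu' bu).
rewrite (avg_dual (cls_itg ck) (fam_sub cu) mf bf).
have [_ h _] := avg_fubini (cls_itg ck) (famM (fam_sub cf) mu' bu).
rewrite -(Int_reflect 0 h); apply: eq_Int => y; rewrite sub0r ek opprK; congr (_ * _).
rewrite -(Int_shift (- y)); last by apply/cls_itg/clsMM => //; exact: cls_shift.
by apply: eq_Int => x; rewrite subrK mulrC.
Qed.

Lemma Np_conv p g k : 1 <= p -> cls g -> itg k -> Np p (conv g k) <= N1 k `^ p * Np p g.
Proof.
move=> p1 cg ik; apply: (le_trans (Np_avg p1 ik (fam_sub cg))).
have E y : Np p (fun x => g (x - y)) = Np p g by exact: Np_shift.
under [X in _ * X <= _]eq_Int do rewrite E mulrC.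
rewrite IntZ; last exact: itg_norm.
rewrite (powRSr (N1_ge0 k)); last by lra.
by rewrite /N1 le_eqVlt; apply/orP; left; apply/eqP; ring.
Qed.

Lemma nm_conv p g k : 1 <= p -> cls g -> itg k -> nm p (conv g k) <= N1 k * nm p g.
Proof.
move=> p1 cg ik; rewrite !nmE; have p0 : p != 0 by lra.
have := powR_ler _ (Np_ge0 _ _) (Np_conv p1 cg ik) => /(_ p^-1).
rewrite powRM ?powR_ge0 ?Np_ge0// (powRK (N1_ge0 k) p0); apply.
by rewrite invr_ge0; lra.
Qed.

Lemma N1E f : N1 f = Np 1 f.
Proof. by apply: eq_Int => x; rewrite powRr1. Qed.

Lemma nm_shift p f (b : V) : 1 <= p -> cls f -> nm p (fun x => f (x + b)) = nm p f.
Proof. by move=> p1 cf; rewrite !nmE Np_shift. Qed.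

Lemma nm_norm p f : nm p (fun x => - f x) = nm p f.
Proof. by rewrite !nmE /Np; under eq_Int do rewrite normrN. Qed.

Lemma nm_sub p f g : 1 <= p -> cls f -> cls g -> nm p (fun x => f x - g x) <= nm p f + nm p g.
Proof.
move=> p1 cf cg; rewrite -(nm_norm p g).
have cg' : cls (fun x => - g x) by apply: (eq_cls _ (clsZ (-1) cg)) => x; rewrite mulN1r.
exact: (nm_triangle p1 cf cg').
Qed.

Lemma nm_fdiff p z f : 1 <= p -> cls f -> nm p (fdiff z f) <= 2 * nm p f.
Proof.
move=> p1 cf; apply: (le_trans (nm_sub p1 (cls_shift z cf) cf)).
by rewrite nm_shift// mulr2n mulrDl mul1r.
Qed.

Lemma N1_nm f : N1 f = nm 1 f.
Proof. by rewrite N1E !nmE invr1 powRr1// Np_ge0. Qed.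

Lemma N1_fdiff z f : cls f -> N1 (fdiff z f) <= 2 * N1 f.
Proof. by move=> cf; rewrite !N1_nm; exact: nm_fdiff. Qed.

(** A Lipschitz condition on translations in [L^1], not a pointwise one: it stands for an integrable
    gradient, and [dil a] multiplies its constant by [a]. *)
Definition lip (L : R) f := forall z, N1 (fdiff z f) <= L * `|z|.

Lemma fdiff_dil a z f : fdiff z (dil a f) = dil a (fdiff (a *: z) f).
Proof. by apply/funext => x; rewrite /fdiff /dil scalerDr mulrBr. Qed.

Lemma lip_dil a L f z : 0 < a -> cls f -> lip L f -> N1 (fdiff z (dil a f)) <= L * a * `|z|.
Proof.
move=> a0 cf hL; rewrite fdiff_dil N1_dil//; last exact/cls_itg/cls_fdiff.
by apply: le_trans (hL _) _; rewrite normrZ gtr0_norm// mulrA.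
Qed.

Definition mom f := itg (fun x => `|x| * `|f x|).
Definition M1 f : R := Int (fun x => `|x| * `|f x|).

Lemma M1_ge0 f : 0 <= M1 f.
Proof. by apply: Int_ge0 => x; exact: mulr_ge0. Qed.

Lemma mom_dil a f : 0 < a -> mom f -> mom (dil a f) /\ M1 (dil a f) = a^-1 * M1 f.
Proof.
move=> a0 mf.
have E x : `|x| * `|dil a f x| = a^-1 * dil a (fun x => `|x| * `|f x|) x.
  rewrite dil_norm// /dil normrZ gtr0_norm//.
  by field; rewrite gt_eqF.
have i1 : itg (dil a (fun x => `|x| * `|f x|)).
  apply: itgZ.
  by apply: (eq_itg _ (itg_affine 0 (lt0r_neq0 a0) mf)) => x; rewrite addr0.
split; first by apply: (eq_itg _ (itgZ a^-1 i1)) => x; rewrite E.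
by rewrite /M1; under eq_Int do rewrite E; rewrite IntZ// Int_dil.
Qed.

(* A kernel of mean zero gains a derivative. *)
Lemma N1_conv_vanish g k L : cls g -> cls k -> lip L g -> mom k -> Int k = 0 ->
  N1 (conv g k) <= L * M1 k.
Proof.
move=> cg ck hL mk k0; have ik := cls_itg ck.
have fF : fam (fun x y => g (x - y) - g x) by apply: famB; [exact: fam_sub|exact: fam_cst].
have E x : conv g k x = avg k (fun x y => g (x - y) - g x) x.
  rewrite /conv /avg -[LHS]subr0 -(mul0r (g x)) -k0 mulrC -IntZ// -IntB; [|exact: itg_conv1|exact: itgZ].
  by apply: eq_Int => y; ring.
rewrite N1E (eq_Np _ E); apply: (le_trans (Np_avg (lexx 1) ik fF)).
rewrite subrr powRr0 mul1r /M1 -IntZ//; apply: le_Int.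
- by apply: fam_Np_itg => //; exact: itg_norm.
- exact: itgZ.
move=> y; rewrite -N1E (_ : L * (`|y| * `|k y|) = `|k y| * (L * `|y|)); last by ring.
by apply: ler_wpM2l => //; rewrite -normrN; exact: hL.
Qed.

End convolutions.
(** * Uniform convexity and the tent kernel *)

Section uniform_convexity.
Variables (R : realType) (N : nat).
Local Notation V := 'rV[R]_N.
Implicit Types (f g h k u : V -> R).

(** Uniform convexity of [L^p] of power type [q] with constant [c], on balls of arbitrary radius
    [A]. *)
Definition uc_const (p q c : R) := forall (A : R) f g, cls f -> cls g ->
  nm p f <= A -> nm p g <= A ->
  nm p (fun x => 2^-1 * (f x + g x)) `^ q + c * nm p (fun x => f x - g x) `^ q <= A `^ q.

Lemma nm_half_le p A f g : 1 <= p -> cls f -> cls g -> nm p f <= A -> nm p g <= A ->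
  nm p (fun x => 2^-1 * (f x + g x)) <= A /\ nm p (fun x => 2^-1 * (f x - g x)) <= A.
Proof.
move=> p1 cf cg fA gA.
rewrite !nmZ//; [|exact: clsB|exact: clsD].
have := nm_triangle p1 cf cg; have := nm_sub p1 cf cg.
by rewrite gtr0_norm ?invr_gt0//; split; lra.
Qed.

Lemma Np_le_pow p A f : 1 <= p -> nm p f <= A -> Np p f <= A `^ p.
Proof.
move=> p1 fA; rewrite -nm_pow; last by lra.
by apply: powR_ler; [lra|exact: nm_ge0|].
Qed.

(** [clarkson_ge2] integrated, at half the sum and half the difference of [f] and [g]; the factor
    [2 ^ - p] comes from the second half. *)
Lemma uc_ge2 p : 2 <= p -> uc_const p p (2 `^ (- p)).
Proof.
move=> p2 A f g cf cg fA gA; have p1 : 1 <= p by lra.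
have p0 : p != 0 by lra.
have chg : cls (fun x => 2^-1 * (f x + g x)) by apply: clsZ; exact: clsD.
have chd : cls (fun x => 2^-1 * (f x - g x)) by apply: clsZ; exact: clsB.
have E : 2 `^ (- p) * nm p (fun x => f x - g x) `^ p = nm p (fun x => 2^-1 * (f x - g x)) `^ p.
  rewrite nmZ//; last exact: clsB.
  rewrite powRM ?nm_ge0// gtr0_norm ?invr_gt0//; congr (_ * _).
  by rewrite -[in RHS]powR_inv1// -powRrM mulN1r.
rewrite E !nm_pow//.
have I := fun h (ch : cls h) => cls_itg (cls_pow p1 ch).
have : Np p (fun x => 2^-1 * (f x + g x)) + Np p (fun x => 2^-1 * (f x - g x)) <= 2^-1 * (Np p f + Np p g).
  rewrite /Np -!IntD; try exact: I.
  rewrite -IntZ; last by apply: itgD; exact: I.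
  apply: le_Int; [by apply: itgD; exact: I|by apply: itgZ; apply: itgD; exact: I|].
  move=> x /=; rewrite ler_pdivlMl//.
  apply: le_trans (clarkson_ge2 _ _ p2) _.
  by rewrite (_ : 2^-1 * (f x + g x) + 2^-1 * (f x - g x) = f x) 1?(_ : 2^-1 * (f x + g x) - 2^-1 * (f x - g x) = g x)//; field.
have := Np_le_pow p1 fA; have := Np_le_pow p1 gA; lra.
Qed.

(** The pointwise inequality controls only the integral of [W], a square with a degenerate weight.
    [powR_split] with a free parameter [d] bounds the p-th power of the norm of [y] by this integral
    and a remainder; [d] is then chosen so that the remainder is absorbed. *)
Lemma uc_le2 p : 1 < p <= 2 -> exists2 c : R, 0 < c & uc_const p 2 c.
Proof.
move=> p12; have /andP[p1 p2] := p12.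
have p1' : 1 <= p by lra.
have p0 : p != 0 by lra.
pose c := p * (p - 1) / 16 / 4 * 4 `^ (p - 2) / 4.
exists c; first by rewrite /c !mulr_gt0 ?invr_gt0 ?powR_gt0//; lra.
move=> A f g cf cg fA gA.
pose x := fun t => 2^-1 * (f t + g t); pose y := fun t => 2^-1 * (f t - g t).
have cx : cls x by apply: clsZ; exact: clsD.
have cy : cls y by apply: clsZ; exact: clsB.
have [xA yA] := nm_half_le p1' cf cg fA gA; rewrite -/x -/y in xA yA *.
have En : nm p (fun t => f t - g t) = 2 * nm p y.
  rewrite /y nmZ//; last exact: clsB.
  by rewrite gtr0_norm ?invr_gt0// mulrA mulfV// mul1r.
rewrite En; have n0 := nm_ge0 p y; have X0 := nm_ge0 p x.
have A0 : 0 <= A by exact: le_trans yA.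
have sq t : 0 <= t -> t `^ 2 = t ^+ 2 by move=> t0; rewrite -powR_mulrn.
rewrite !sq ?mulr_ge0//.
have I := fun h (ch : cls h) => cls_itg (cls_pow p1' ch).
have [n00|nn0] := eqVneq (nm p y) 0.
  by rewrite n00 !mulr0 expr0n /= mulr0 addr0 ler_pXn2r// nnegrE.
have np : 0 < nm p y by rewrite lt_neqAle eq_sym nn0.
have Ap : 0 < A by exact: lt_le_trans yA.
pose W := fun t => `|y t| ^+ 2 * (`|x t| + `|y t|) `^ (p - 2).
have mW : measurable_fun setT W.
  apply: measurable_funM.
    by apply: measurable_funX; apply: measurableT_comp => //; exact: cls_meas.
  apply: (measurableT_comp (measurable_powR _)).
  by apply: measurable_funD; apply: measurableT_comp => //; exact: cls_meas.
have W0 t : 0 <= W t by rewrite mulr_ge0 ?sqr_ge0 ?powR_ge0.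
have iW : itg W.
  apply: (le_itg mW _ (I _ cy)) => t; rewrite ger0_norm// /W.
  have [->|yn0] := eqVneq `|y t| 0; first by rewrite expr0n /= mul0r powR_ge0.
  have yp : 0 < `|y t| by rewrite lt_neqAle eq_sym yn0 normr_ge0.
  have -> : `|y t| `^ p = `|y t| ^+ 2 * `|y t| `^ (p - 2).
    by rewrite -powR_mulrn// -powRD ?yn0 ?implybT//; congr (_ `^ _); ring.
  rewrite ler_wpM2l ?sqr_ge0//.
  rewrite (_ : p - 2 = - (2 - p)); last by ring.
  rewrite !powRN lef_pV2 ?posrE ?powR_gt0//; last by rewrite ltr_wpDl.
  by apply: powR_ler => //; [lra|rewrite lerDr].
have H1 : Np p x + p * (p - 1) / 32 * Int W <= A `^ p.
  have : 2 * Np p x + p * (p - 1) / 16 * Int W <= Np p f + Np p g.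
    rewrite /Np -!IntZ//; [|exact: I].
    rewrite -!IntD; try exact: I; try (by apply: itgZ => //; exact: I).
    apply: le_Int.
    - by apply: itgD; apply: itgZ => //; exact: I.
    - by apply: itgD; exact: I.
    move=> t; apply: le_trans (clarkson_le2 _ _ p12) _.
    by rewrite (_ : x t + y t = f t) 1?(_ : x t - y t = g t)// /x /y; field.
  have := Np_le_pow p1' fA; have := Np_le_pow p1' gA.
  have -> : p * (p - 1) / 32 = (p * (p - 1) / 16) / 2 by field.
  lra.
(* With this choice [d * (2 * A)] is half of [nm p y], so the remainder is at most half of [Np p y],
   as [2 ^ - p <= 1 / 2]. *)
pose d := nm p y / (4 * A).
have A4 : 0 < 4 * A by rewrite mulr_gt0.
have d0 : 0 < d by exact: divr_gt0.
have d1 : d <= 1 by rewrite /d ler_pdivrMr// mul1r; lra.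
have d01 : 0 < d <= 1 by rewrite d0.
have H2 : Np p y <= d `^ (p - 2) * Int W + d `^ p * (2 `^ p * A `^ p).
  have iB : itg (fun t => `| `|x t| + `|y t| | `^ p) by apply: I; apply: clsD; exact: cls_norm.
  apply: (@le_trans _ _ (d `^ (p - 2) * Int W + d `^ p * Int (fun t => `| `|x t| + `|y t| | `^ p))).
    rewrite -!IntZ// -IntD; [|exact: itgZ|exact: itgZ].
    apply: le_Int; [exact: I|by apply: itgD; exact: itgZ|].
    by move=> t; rewrite [`| `|x t| + `|y t| |]ger0_norm ?addr_ge0//; apply: powR_split.
  rewrite lerD2l ler_wpM2l ?powR_ge0//.
  apply: (@le_trans _ _ (2 `^ (p - 1) * (Np p x + Np p y))).
    rewrite /Np -IntD; try exact: I.
    rewrite -IntZ; last by apply: itgD; exact: I.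
    apply: le_Int => //; first by apply: itgZ; apply: itgD; exact: I.
    by move=> t; rewrite ger0_norm ?addr_ge0//; exact: powR_mean.
  rewrite (@powRSr _ p 2)// [2 * _]mulrC -mulrA ler_wpM2l ?powR_ge0//.
  have := Np_le_pow p1' xA; have := Np_le_pow p1' yA; lra.
have H3 : d `^ p * (2 `^ p * A `^ p) <= 2^-1 * Np p y.
  rewrite -powRM// -powRM ?(ltW d0)//; last by rewrite mulr_ge0.
  have -> : d * (2 * A) = 2^-1 * nm p y by rewrite /d; field; rewrite gt_eqF.
  rewrite powRM// nm_pow// ler_wpM2r ?Np_ge0//.
  by rewrite -[leRHS]powRr1//; apply: ger_powR => //; apply/andP; split; lra.
have H4 : nm p y ^+ 2 * (4 * A) `^ (p - 2) <= 2 * Int W.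
  have D0 : 0 < d `^ (p - 2) by rewrite powR_gt0.
  rewrite -(ler_pM2l D0).
  have -> : d `^ (p - 2) * (nm p y ^+ 2 * (4 * A) `^ (p - 2)) = Np p y.
    rewrite mulrCA -powRM ?(ltW d0) ?(ltW A4)// /d divfK ?gt_eqF//.
    rewrite -(powR_mulrn 2 n0) -powRD ?nn0 ?implybT// -nm_pow//; congr (_ `^ _); ring.
  rewrite mulrCA; move: H2 H3.
  move: (d `^ (p - 2) * Int W) (d `^ p * _) (Np p y) => Q X Y; clear; lra.
(* Since [p - 2 <= 0] and the norm is at most [A], the factor [A ^ (p - 2)] turns the bound on p-th
   powers into one on squares. *)
have H5 : nm p x ^+ 2 * A `^ (p - 2) <= Np p x.
  have [x00|xn0] := eqVneq (nm p x) 0; first by rewrite x00 expr0n /= mul0r Np_ge0.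
  rewrite -nm_pow// (_ : nm p x `^ p = nm p x ^+ 2 * nm p x `^ (p - 2)); last first.
    by rewrite -(powR_mulrn 2 X0) -powRD ?xn0 ?implybT//; congr (_ `^ _); ring.
  rewrite ler_wpM2l ?sqr_ge0// (_ : p - 2 = - (2 - p)); last by ring.
  have xp : 0 < nm p x by rewrite lt_neqAle eq_sym xn0.
  rewrite !powRN lef_pV2 ?posrE ?powR_gt0//.
  by apply: powR_ler => //; lra.
have AA : 0 < A `^ (p - 2) by rewrite powR_gt0.
rewrite -(ler_pM2r AA).
have -> : A ^+ 2 * A `^ (p - 2) = A `^ p.
  by rewrite -(powR_mulrn 2 A0) -powRD ?(gt_eqF Ap) ?implybT//; congr (_ `^ _); ring.
apply: le_trans H1; rewrite mulrDl; apply: lerD => //.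
have -> : c * (2 * nm p y) ^+ 2 * A `^ (p - 2) =
    p * (p - 1) / 32 * (nm p y ^+ 2 * (4 * A) `^ (p - 2)) / 2.
  by rewrite (powRM _ _ A0)// /c exprMn; field.
rewrite -mulrA ler_wpM2l//; last by rewrite ler_pdivrMr// [_ * 2]mulrC.
by apply: divr_ge0 => //; apply: mulr_ge0; lra.
Qed.

Lemma uc_exists p : 1 < p -> exists2 c : R, 0 < c & uc_const p (Num.max p 2) c.
Proof.
move=> p1; have [p2|p2] := leP p 2.
  by apply: uc_le2; rewrite p1.
by exists (2 `^ (- p)); [exact: powR_gt0|apply: uc_ge2; exact: ltW].
Qed.

End uniform_convexity.

Section tent_kernel.
Variables (R : realType) (N : nat).
Local Notation V := 'rV[R]_N.

Definition ccube (r : R) : V -> R := \1_[set x : V | `|x| <= r].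

Lemma ccubeE r x : ccube r x = if `|x| <= r then 1 else 0.
Proof.
rewrite /ccube indicE; case: ifP => h; first by rewrite mem_set.
by rewrite memNset//= h.
Qed.

Lemma measurable_ccube r : measurable_fun setT (ccube r).
Proof. by apply: measurable_indic; exact: measurable_cube. Qed.

Lemma itg_ccube r : 0 < r -> itg (ccube r) /\ Int (ccube r) = (2 * r) ^+ N.
Proof.
move=> r0.
have E : (\int[@lebesgue_rV R N]_x (ccube r x)%:E = ((2 * r) ^+ N)%:E)%E.
  rewrite /ccube integral_indic ?setIT; [|exact: measurableT|exact: measurable_cube].
  exact: measure_cube.
have i : itg (ccube r).
  apply: itg_lty; [exact: measurable_ccube|by move=> x; rewrite ccubeE; case: ifP|].
  by rewrite E ltry.
by split=> //; apply: EFin_inj; rewrite IntE.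
Qed.

Let T : V -> R := fun x => Num.max 0 (1 - `|x|).

Let T0 x : 0 <= T x. Proof. by rewrite /T le_max lexx. Qed.

Let T1 x : T x <= ccube 1 x.
Proof.
by rewrite ccubeE /T ge_max; have := normr_ge0 x; case: (leP `|x| 1) => h1 h2; apply/andP; split; lra.
Qed.

Let cT : cls T.
Proof.
have mT : measurable_fun setT T.
  by apply: measurable_funTS => //; apply: measurable_maxr => //; apply: measurable_funB => //; exact: measurable_norm_rV.
have [i1 _] := itg_ccube ltr01.
split=> //.
  exists 1 => x; rewrite ger0_norm//; apply: le_trans (T1 x) _.
  by rewrite ccubeE; case: ifP.
by apply: (le_itg mT _ i1) => x; rewrite ger0_norm.
Qed.

Let IT : 0 < Int T.
Proof.
have h0 : 0 < 2^-1 :> R by rewrite invr_gt0.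
have [i1 i2] := itg_ccube h0.
apply: (@lt_le_trans _ _ (2^-1 * Int (ccube 2^-1))); first by rewrite i2 mulr_gt0// exprn_gt0// mulr_gt0.
rewrite -IntZ//; apply: le_Int; [exact: itgZ|exact: cls_itg|].
move=> x; rewrite ccubeE /T le_max; case: (leP `|x| 2^-1) => h; last by rewrite mulr0 lexx.
by apply/orP; right; lra.
Qed.

(** Evenness produces midpoints, monotonicity along rays ([tent2]) compares the steps [y] and [2 y],
    compact support bounds the steps, and the [L^1] Lipschitz bound makes averages smooth at their
    scale. Nonnegativity and mass 1 allow Jensen. *)
Definition tent : V -> R := fun x => (Int T)^-1 * T x.

Lemma tent_ge0 x : 0 <= tent x.
Proof. by rewrite mulr_ge0// invr_ge0 ltW. Qed.

Lemma cls_tent : cls tent. Proof. exact: clsZ. Qed.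

Lemma Int_tent : Int tent = 1.
Proof. by rewrite IntZ ?mulVf ?gt_eqF//; exact: cls_itg. Qed.

Lemma tentN x : tent (- x) = tent x.
Proof. by rewrite /tent /T normrN. Qed.

Lemma tent2 x : tent (2 *: x) <= tent x.
Proof.
rewrite /tent ler_wpM2l ?invr_ge0 ?(ltW IT)// /T normrZ normr_nat.
have h : 1 - 2 * `|x| <= 1 - `|x| by have := normr_ge0 x; lra.
by rewrite ge_max le_max lexx /= le_max h orbT.
Qed.

Lemma tent_support x : tent x != 0 -> `|x| <= 1.
Proof.
rewrite /tent /T; case: (leP `|x| 1) => // h.
by rewrite max_l ?mulr0 ?eqxx//; lra.
Qed.

Lemma lip_tent : exists2 L : R, 0 <= L & lip L tent.
Proof.
have I0 : 0 <= (Int T)^-1 by rewrite invr_ge0 ltW.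
have [i1 i2] := itg_ccube ltr01.
exists ((Int T)^-1 * (2 * (2 * 1) ^+ N)); first by rewrite mulr_ge0// mulr_ge0// exprn_ge0.
move=> z.
have its : itg (fun x => ccube 1 (x + z)).
  by apply: (eq_itg _ (itg_affine z (oner_neq0 R) i1)) => x; rewrite scale1r.
have iT := cls_itg (cls_norm (cls_fdiff z cls_tent)).
apply: (@le_trans _ _ (Int (fun x => ((Int T)^-1 * `|z|) * (ccube 1 x + ccube 1 (x + z))))); last first.
  rewrite IntZ ?IntD//; [|exact: itgD].
  rewrite (Int_shift z i1) i2.
  by rewrite le_eqVlt; apply/orP; left; apply/eqP; ring.
apply: le_Int => //; first by apply: itgZ; exact: itgD.
move=> x; rewrite /fdiff /tent -mulrBr normrM (ger0_norm I0) -mulrA ler_wpM2l//.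
have tri1 : `|x + z| <= `|x| + `|z| by exact: ler_normD.
have tri2 : `|x| <= `|x + z| + `|z| by have := ler_normB (x + z) z; rewrite addrK.
have z0 := normr_ge0 z.
rewrite !ccubeE /T; case: (leP `|x| 1) => h1; case: (leP `|x + z| 1) => h2.
- rewrite !max_r; [|lra|lra]; rewrite ler_norml; apply/andP; split; lra.
- rewrite (max_l (y := 1 - `|x + z|)) ?max_r; [|lra|lra]; rewrite ler_norml; apply/andP; split; lra.
- rewrite (max_l (y := 1 - `|x|)) ?max_r; [|lra|lra]; rewrite ler_norml; apply/andP; split; lra.
- by rewrite !max_l; [rewrite subrr normr0 addr0 mulr0|lra|lra].
Qed.

End tent_kernel.
(** * Energies of averaged functions *)

Section square_function.
Variables (R : realType) (N : nat).
Local Notation V := 'rV[R]_N.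
Implicit Types (f g h k u v : V -> R).

Lemma fdiffN_Np p z u : 1 <= p -> cls u -> Np p (fdiff (- z) u) = Np p (fdiff z u).
Proof.
move=> p1 cu; rewrite -(Np_shift z p1 (cls_fdiff (- z) cu)).
rewrite /Np; apply: eq_Int => x; rewrite /fdiff addrK distrC; by [].
Qed.

Lemma fam_fdiff (a : R) u : cls u -> fam (fun x y => fdiff (a *: y) u x).
Proof. by move=> cu; apply: famB; [exact: fam_shift|exact: fam_cst]. Qed.

(** Increments over [2 y], because uniform convexity is applied to the pair [u (x + y)],
    [u (x - y)]. The value is a p-th power. *)
Definition energy p k u : R := Int (fun y => k y * Np p (fdiff (2 *: y) u)).

Lemma itg_energy p k u : 1 <= p -> itg k -> cls u -> itg (fun y => k y * Np p (fdiff (2 *: y) u)).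
Proof. by move=> p1 ik cu; have := fam_Np_itg p1 ik (fam_fdiff 2 cu). Qed.

Lemma energy_ge0 p k u : (forall y, 0 <= k y) -> 0 <= energy p k u.
Proof. by move=> k0; apply: Int_ge0 => y; rewrite mulr_ge0// Np_ge0. Qed.

(** For even [k] the convolution is a [k]-average of the midpoints of [u (x + y)] and [u (x - y)].
    Uniform convexity holds for each [y] with [A = nm p u]; Jensen with exponent [q / p >= 1] then
    replaces averages of powers by powers of averages. *)
Lemma energy_step p q c k u : 1 < p -> p <= q -> 0 < c -> uc_const N p q c ->
  cls k -> (forall y, 0 <= k y) -> Int k = 1 -> (forall y, k (- y) = k y) -> cls u ->
  nm p (conv u k) `^ q + c * (energy p k u `^ p^-1) `^ q <= nm p u `^ q.
Proof.
move=> p1 pq c0 uc ck k0 k1 ek cu.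
have p1' : 1 <= p by lra.
have p0 : p != 0 by lra.
have pp : 0 < p by lra.
have ik := cls_itg ck.
pose G := fun x y => 2^-1 * (u (x + y) + u (x - y)).
have fG : fam G by apply/famZ/famD; [exact: fam_add|exact: fam_sub].
have E : conv u k = avg k G.
  apply/funext => x; rewrite /conv /avg /G.
  have i1 := itg_conv1 x cu ik.
  have i2 : itg (fun y => k y * u (x + y)) by exact: (avg_itg x ik (fam_add cu)).
  have e2 : Int (fun y => k y * u (x + y)) = Int (fun y => k y * u (x - y)).
    by rewrite -(Int_reflect 0 i2); apply: eq_Int => y; rewrite sub0r ek.
  rewrite -[LHS](_ : 2^-1 * (Int (fun y => k y * u (x + y)) + Int (fun y => k y * u (x - y))) = _); last by rewrite e2; field.
  rewrite -IntD// -IntZ; last exact: itgD.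
  by apply: eq_Int => y; ring.
pose X y := Np p (G ^~ y); pose Y y := Np p (fdiff (2 *: y) u).
have [mX [BX hX]] := fam_Np_bound p1' fG.
have [mY [BY hY]] := fam_Np_bound p1' (fam_fdiff 2 cu).
pose r := q / p; have r1 : 1 <= r by rewrite ler_pdivlMr// mul1r.
have key y : X y `^ r + c * Y y `^ r <= nm p u `^ q.
  have c1 : cls (fun x => u (x + y)) by exact: cls_shift.
  have c2 : cls (fun x => u (x - y)) by exact: cls_shift.
  have := uc (nm p u) _ _ c1 c2; rewrite !nm_shift// => /(_ (lexx _) (lexx _)).
  have -> : nm p (fun x => 2^-1 * (u (x + y) + u (x - y))) `^ q = X y `^ r.
    by rewrite nmE -powRrM /r [_ / p]mulrC.
  have -> // : nm p (fun x => u (x + y) - u (x - y)) `^ q = Y y `^ r.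
  rewrite nmE -powRrM /r [_ / p]mulrC; congr (_ `^ _).
  rewrite /Y -(Np_shift (- y) p1' (cls_fdiff (2 *: y) cu)); apply: eq_Np => x.
  by rewrite /fdiff scaler_nat mulr2n addrA subrK.
have kX0 y : 0 <= X y by exact: Np_ge0.
have kY0 y : 0 <= Y y by exact: Np_ge0.
have bnd (W : V -> R) B : measurable_fun setT W -> (forall y, `|W y| <= B) -> (forall y, 0 <= W y) ->
    itg (fun y => k y * W y `^ r).
  move=> mW hW W0; apply: cls_itg.
  apply: (eq_cls (fun y => mulrC _ _)); apply: clsM => //.
    exact: (measurableT_comp (measurable_powR r)).
  exists (B `^ r) => y; rewrite ger0_norm ?powR_ge0//; apply: powR_ler => //; first lra.
  by apply: le_trans (hW y); exact: ler_norm.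
have iX := bnd X BX mX hX kX0; have iY := bnd Y BY mY hY kY0.
have tot : Int (fun y => k y * X y `^ r) + c * Int (fun y => k y * Y y `^ r) <= nm p u `^ q.
  rewrite -IntZ// -IntD//; last exact: itgZ.
  rewrite -[leRHS]mulr1 -k1 -IntZ//; apply: le_Int; [by apply: itgD => //; exact: itgZ|exact: itgZ|].
  move=> y; have := ler_wpM2l (k0 y) (key y); rewrite [leRHS]mulrC; apply: le_trans.
  by rewrite mulrDr [k y * (c * _)]mulrCA.
apply: le_trans tot; apply: lerD; last first.
  rewrite ler_wpM2l ?(ltW c0)//.
  have := jensen_Int r1 ik k0 mY (ex_intro _ BY hY) kY0; rewrite k1 powR1 mul1r.
  by rewrite /energy -powRrM /r [_ / p]mulrC.
have := jensen_Int r1 ik k0 mX (ex_intro _ BX hX) kX0; rewrite k1 powR1 mul1r; apply: le_trans.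
rewrite nmE -powRrM [p^-1 * q]mulrC -/r; apply: powR_ler; [lra|exact: Np_ge0|].
rewrite E; apply: (le_trans (Np_avg p1' ik fG)).
have kE : (fun y => `|k y|) = k by apply/funext => y; rewrite ger0_norm.
by rewrite kE k1 powR1 mul1r; under eq_Int do rewrite ger0_norm//.
Qed.

Lemma Int_fdiff_energy p k k' u : 1 <= p -> itg k' -> cls u ->
  (forall y, 2 ^+ N * k' (2 *: y) = k y) ->
  Int (fun y => k' y * Np p (fdiff y u)) = energy p k u.
Proof.
move=> p1 ik' cu kk.
have i1 : itg (fun y => k' y * Np p (fdiff y u)).
  have := fam_Np_itg p1 ik' (fam_fdiff 1 cu).
  by apply: eq_itg => y; rewrite scale1r.
have n2 : 2 != 0 :> R by rewrite pnatr_eq0.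
rewrite (Int_affine 0 n2 i1) -IntZ; last exact: (itg_affine 0 n2 i1).
by apply: eq_Int => y; rewrite addr0 normr_nat mulrA kk.
Qed.

(** The last hypothesis says that [k] is [dil 2 k'], so increments over [y] weighted by [k'] are
    increments over [2 y] weighted by [k]: the energy at one scale controls the averaging at the
    next coarser one. *)
Lemma conv_id_sub p k k' u : 1 < p -> cls k' -> (forall y, 0 <= k' y) -> Int k' = 1 -> cls u ->
  (forall y, 2 ^+ N * k' (2 *: y) = k y) ->
  nm p (fun x => u x - conv u k' x) <= energy p k u `^ p^-1.
Proof.
move=> p1 ck k0 k1 cu kk; have p1' : 1 <= p by lra.
have ik := cls_itg ck.
rewrite nmE; apply: powR_ler; [by rewrite invr_ge0; lra|exact: Np_ge0|].
have fG : fam (fun x y => u x - u (x - y)) by apply: famB; [exact: fam_cst|exact: fam_sub].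
have -> : (fun x => u x - conv u k' x) = avg k' (fun x y => u x - u (x - y)).
  apply/funext => x; rewrite /conv /avg -{1}[u x]mulr1 -k1 -IntZ// -IntB; [|exact: itgZ|exact: itg_conv1].
  by apply: eq_Int => y; ring.
apply: (le_trans (Np_avg p1' ik fG)).
have kE : (fun y => `|k' y|) = k' by apply/funext => y; rewrite ger0_norm.
rewrite kE k1 powR1 mul1r -(Int_fdiff_energy p1' ik cu kk) le_eqVlt; apply/orP; left; apply/eqP.
apply: eq_Int => y; rewrite ger0_norm//; congr (_ * _).
rewrite -(Np_shift (- y) p1' (cls_fdiff y cu)); apply: eq_Np => x.
by rewrite /fdiff subrK.
Qed.

(** As [k] is even, subtracting its average from [v = conv u h] averages second differences of [v].
    One difference falls on [u] and gives the energy, the other falls on [h] and gains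
    [L |z| <= L r]. Here averaging and energy use the same kernel; the passage from steps [y] to
    [2 y] rests on [k (2 y) <= k y] and costs [2 ^ N]. *)
Lemma conv_id_sub_smooth p k u h (r L : R) : 1 < p -> cls k -> (forall y, 0 <= k y) -> Int k = 1 ->
  (forall y, k (- y) = k y) -> (forall y, k (2 *: y) <= k y) ->
  (forall y, k y != 0 -> `|y| <= r) -> 0 <= r -> 0 <= L -> lip L h -> cls h -> cls u ->
  nm p (conv (fun x => u x - conv u k x) h) <= (2 ^+ N * (L * r)) * energy p k u `^ p^-1.
Proof.
move=> p1 ck k0 k1 ek k2 ks r0 L0 hL ch cu; have p1' : 1 <= p by lra.
have p0 : p != 0 by lra.
have ik := cls_itg ck.
pose v := conv u h; have cv : cls v by exact: cls_conv (cls_itg ch).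
have -> : conv (fun x => u x - conv u k x) h = (fun x => v x - conv v k x).
  rewrite convBl //; [|exact: cls_conv|exact: cls_itg].
  by rewrite /v (convA cu ck ch) (convA cu ch ck) (convC ck ch).
pose G := fun x z => 2^-1 * ((v x - v (x - z)) + (v x - v (x + z))).
have fG : fam G.
  by apply/famZ/famD; apply: famB; [exact: fam_cst|exact: fam_sub|exact: fam_cst|exact: fam_add].
have -> : (fun x => v x - conv v k x) = avg k G.
  apply/funext => x; rewrite /conv /avg /G.
  have i1 := itg_conv1 x cv ik.
  have i2 : itg (fun y => k y * v (x + y)) by exact: (avg_itg x ik (fam_add cv)).
  have e2 : Int (fun y => k y * v (x + y)) = Int (fun y => k y * v (x - y)).
    by rewrite -(Int_reflect 0 i2); apply: eq_Int => y; rewrite sub0r ek.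
  transitivity (2^-1 * ((2 * v x) * Int k - (Int (fun y => k y * v (x + y)) + Int (fun y => k y * v (x - y))))).
    by rewrite k1 e2; field.
  rewrite -IntZ// -IntD// -IntB; [|exact: itgZ|exact: itgD].
  rewrite -IntZ; last by apply: itgB; [exact: itgZ|exact: itgD].
  by apply: eq_Int => y; ring.
have GE z : G ^~ z = (fun x => 2^-1 * conv (fdiff (- z) u) (fdiff z h) x).
  apply/funext => x; rewrite /G (conv_fdiffl (- z) cu (cls_itg (cls_fdiff z ch))).
  by rewrite (conv_fdiffr z cu ch) -/v /fdiff subrK; ring.
have NG z : k z * Np p (G ^~ z) <= k z * ((L * r) `^ p * Np p (fdiff z u)).
  have [->|kz] := eqVneq (k z) 0; first by rewrite !mul0r.
  apply: ler_wpM2l => //; rewrite GE.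
  have cc : cls (conv (fdiff (- z) u) (fdiff z h)).
    by apply: cls_conv; [exact: cls_fdiff|exact/cls_itg/cls_fdiff].
  apply: (@le_trans _ _ (Np p (conv (fdiff (- z) u) (fdiff z h)))).
    apply: le_Np => //; first exact: clsZ.
    by move=> x; rewrite normrM gtr0_norm ?invr_gt0// ler_piMl//; lra.
  apply: (le_trans (Np_conv p1' (cls_fdiff (- z) cu) (cls_itg (cls_fdiff z ch)))).
  rewrite fdiffN_Np//; apply: ler_wpM2r; first exact: Np_ge0.
  apply: powR_ler; [lra|exact: N1_ge0|].
  by apply: le_trans (hL z) _; apply: ler_wpM2l => //; exact: ks.
have i1 : itg (fun y => k y * Np p (fdiff y u)).
  have := fam_Np_itg p1' ik (fam_fdiff 1 cu).
  by apply: eq_itg => y; rewrite scale1r.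
have kE : (fun y => `|k y|) = k by apply/funext => y; rewrite ger0_norm.
have B : Np p (avg k G) <= (L * r) `^ p * (2 ^+ N * energy p k u).
  apply: (le_trans (Np_avg p1' ik fG)).
  rewrite kE k1 powR1 mul1r.
  apply: (@le_trans _ _ (Int (fun y => (L * r) `^ p * (k y * Np p (fdiff y u))))).
    apply: le_Int; [by apply: fam_Np_itg => //; rewrite kE|exact: itgZ|].
    by move=> y; rewrite ger0_norm// mulrCA.
  rewrite IntZ// ler_wpM2l ?powR_ge0//.
  have n2 : 2 != 0 :> R by rewrite pnatr_eq0.
  rewrite (Int_affine 0 n2 i1) normr_nat ler_wpM2l ?exprn_ge0//.
  apply: le_Int; [exact: (itg_affine 0 n2 i1)|exact: itg_energy|].
  by move=> y; rewrite addr0 ler_wpM2r ?Np_ge0.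
have Lr0 : 0 <= L * r by exact: mulr_ge0.
have e0 := energy_ge0 p u k0.
have pV : 0 < p^-1 <= 1 by apply/andP; split; [rewrite invr_gt0|rewrite invf_le1]; lra.
have /andP[pV0 pV1] := pV.
rewrite nmE; apply: (le_trans (powR_ler (ltW pV0) (Np_ge0 _ _) B)).
rewrite powRM ?powR_ge0 ?mulr_ge0 ?exprn_ge0// powRK// powRM ?exprn_ge0//.
rewrite mulrA ler_wpM2r ?powR_ge0// [leRHS]mulrC ler_wpM2l//.
have h1 : 1 <= 2 ^+ N :> R by apply: exprn_ege1; lra.
by rewrite -[leRHS]powRr1 ?exprn_ge0//; exact: ler_powR.
Qed.

End square_function.

(** * Sums with geometric decay off the diagonal *)

Section discrete_young.
Variable R : realType.

(** This is [2 ^ - |j - k|]: one of the two truncated differences is zero. *)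
Definition near_weight (j k : nat) : R := 2^-1 ^+ ((j - k) + (k - j)).

Lemma near_weight_ge0 j k : 0 <= near_weight j k.
Proof. by rewrite exprn_ge0// invr_ge0. Qed.

Lemma near_weightC j k : near_weight j k = near_weight k j.
Proof. by rewrite /near_weight addnC. Qed.

Let up_sum n j : \sum_(k < n) (if (j <= k)%N then 2^-1 ^+ (k - j) else 0) <= 2 :> R.
Proof.
elim: j n => [|j ih] n.
  suff -> : \sum_(k < n) (if (0 <= k)%N then 2^-1 ^+ (k - 0) else 0) = 2 - 2 * 2^-1 ^+ n :> R.
    by rewrite gerBl mulr_ge0// exprn_ge0// invr_ge0.
  elim: n => [|n ih]; first by rewrite big_ord0 expr0 mulr1 subrr.
  by rewrite big_ord_recr /= ih subn0 exprS; field.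
case: n => [|n]; first by rewrite big_ord0.
by rewrite big_ord_recl /= add0r; exact: ih.
Qed.

Let down_sum n j : \sum_(k < n) (if (k <= j)%N then 2^-1 ^+ (j - k) else 0) <= 2 - 2^-1 ^+ j :> R.
Proof.
elim: j n => [|j ih] [|n]; rewrite ?big_ord0.
- by rewrite expr0; lra.
- rewrite big_ord_recl /= big1 ?addr0 ?expr0; last by move=> i _; rewrite /bump.
  by lra.
- rewrite subr_ge0; apply: (@le_trans _ _ 1); last lra.
  by apply: exprn_ile1; [rewrite invr_ge0|rewrite invf_le1//; lra].
rewrite big_ord_recl /= subn0.
have := ih n; under [X in _ -> _ + X <= _]eq_bigr => i _.
  rewrite /bump leq0n add1n ltnS subSS; over.
rewrite !exprS; have h0 : 0 <= 2^-1 ^+ j :> R by rewrite exprn_ge0// invr_ge0.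
lra.
Qed.

Lemma near_weight_sum n j : \sum_(k < n) near_weight j k <= 4.
Proof.
apply: (@le_trans _ _ (\sum_(k < n) ((if (j <= k)%N then 2^-1 ^+ (k - j) else 0) +
  (if (k <= j)%N then 2^-1 ^+ (j - k) else 0)))).
  apply: ler_sum => k _; rewrite /near_weight.
  have w0 m : 0 <= 2^-1 ^+ m :> R by rewrite exprn_ge0// invr_ge0.
  have [jk|jk] := leqP j k.
    rewrite (eqP jk) add0n lerDl; by case: ifP.
  by rewrite (ltnW jk) (eqP (ltnW jk)) addn0 add0r.
rewrite big_split /=; have := up_sum n j; have := down_sum n j.
have : 0 <= 2^-1 ^+ j :> R by rewrite exprn_ge0// invr_ge0.
lra.
Qed.

(** Schur's test: Jensen along each row, then the column sums; both kinds of sums are at most 4. *)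
Lemma discrete_young n (q : R) (B : nat -> R) : 1 <= q -> (forall k, 0 <= B k) ->
  \sum_(j < n) (\sum_(k < n) near_weight j k * B k) `^ q <= 4 `^ q * \sum_(k < n) B k `^ q.
Proof.
move=> q1 B0.
apply: (@le_trans _ _ (\sum_(j < n) 4 `^ (q - 1) * \sum_(k < n) near_weight j k * B k `^ q)).
  apply: ler_sum => j _.
  apply: (le_trans (jensen_sum _ q1 (fun k : 'I_n => near_weight_ge0 j k) (fun k => B0 k))).
  apply: ler_wpM2r; first by apply: sumr_ge0 => k _; rewrite mulr_ge0 ?near_weight_ge0 ?powR_ge0.
  apply: powR_ler; [lra|by apply: sumr_ge0 => k _; exact: near_weight_ge0|].
  exact: near_weight_sum.
rewrite -mulr_sumr exchange_big /= (@powRSr _ q 4)//; last by lra.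
rewrite [4 * _]mulrC -mulrA ler_wpM2l ?powR_ge0// mulr_sumr.
apply: ler_sum => k _; rewrite -mulr_suml ler_wpM2r ?powR_ge0//.
under eq_bigr do rewrite near_weightC.
exact: near_weight_sum.
Qed.

End discrete_young.
(** * Littlewood-Paley analysis *)

Section analysis.
Variables (R : realType) (N : nat).
Local Notation V := 'rV[R]_N.
Implicit Types (f g h u v : V -> R).
Local Notation T := (@tent R N).

Lemma dil_tent_ge0 (a : R) y : 0 < a -> 0 <= dil a T y.
Proof. by move=> a0; rewrite mulr_ge0 ?tent_ge0// exprn_ge0// ltW. Qed.

Lemma dil_tentN (a : R) y : dil a T (- y) = dil a T y.
Proof. by rewrite /dil scalerN tentN. Qed.

Lemma dil_tent2 (a : R) y : 0 < a -> dil a T (2 *: y) <= dil a T y.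
Proof.
move=> a0; rewrite /dil ler_wpM2l ?exprn_ge0 ?(ltW a0)//.
by rewrite scalerA mulrC -scalerA tent2.
Qed.

Lemma dil_tent_support (a : R) y : 0 < a -> dil a T y != 0 -> `|y| <= a^-1.
Proof.
move=> a0; rewrite /dil mulf_eq0 negb_or => /andP[_ /tent_support].
by rewrite normrZ gtr0_norm// -ler_pdivlMl// mulr1.
Qed.

Lemma Int_dil_tent (a : R) : 0 < a -> Int (dil a T) = 1.
Proof. by move=> a0; rewrite Int_dil ?Int_tent//; exact/cls_itg/cls_tent. Qed.

(** Built from the top: [U n] is [g], and each step downwards averages once more. Indices above [n]
    are filled with [g] so that all members belong to [cls]. *)
Lemma averaging_chain (k : nat -> V -> R) n g : (forall i, cls (k i)) -> cls g ->
  exists U : nat -> V -> R, [/\ forall i, cls (U i), U n = g &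
    forall i, (i < n)%N -> U i = conv (U i.+1) (k i)].
Proof.
move=> ck; elim: n g => [|n ih] g cg; first by exists (fun=> g).
have [U [cU Un Ui]] := ih _ (cls_conv cg (cls_itg (ck n))).
exists (fun i => if (i <= n)%N then U i else g); split.
- by move=> i; case: ifP.
- by rewrite ltnn.
move=> i; rewrite ltnS leq_eqVlt => /orP[/eqP ->|i_n].
  by rewrite eqxx /= ltnn Un.
by rewrite i_n orbT; exact: Ui.
Qed.

Lemma sum_shift_le n (F : nat -> R) : (forall k, 0 <= F k) ->
  \sum_(k < n) (if (k.+1 < n)%N then F k.+1 else 0) <= \sum_(k < n) F k.
Proof.
case: n => [|n] F0; first by rewrite !big_ord0.
rewrite big_ord_recr /= ltnn addr0 big_ord_recl.
rewrite (_ : \sum_(i < n) _ = \sum_(i < n) F i.+1) ?lerDr//.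
by apply: eq_bigr => i _; rewrite ltnS ltn_ord.
Qed.

(* Both regimes lose [2 ^ - |j - k|]: at frequencies below the averaging scale
   the difference [U k.+1 - U k] gains a derivative from [h], above it the kernel
   [k.+1] is smooth at the scale of [h] and [h] has mean zero. *)
Lemma almost_orthogonal p h (L LK lam : R) n (U : nat -> V -> R) j :
  1 < p -> cls h -> 0 <= L -> lip L h -> mom h -> Int h = 0 -> 0 <= LK -> lip LK T -> 0 < lam ->
  (forall i, cls (U i)) ->
  (forall i, (i < n)%N -> U i = conv (U i.+1) (dil (lam * 2 ^+ i) T)) ->
  (j < n)%N ->
  nm p (conv (U n) (dil (lam * 2 ^+ j) h)) <=
  (2 ^+ N * L + LK * M1 h) * 2 * \sum_(k < n) near_weight R j k *
    (energy p (dil (lam * 2 ^+ k) T) (U k.+1) `^ p^-1 + (if k == 0%N :> nat then nm p (U 1%N) else 0)).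
Proof.
move=> p1 ch L0 hL mh h0 LK0 hLK lam0 cU Ui jn.
have p1' : 1 <= p by lra.
pose a i := lam * 2 ^+ i; have a0 i : 0 < a i by rewrite mulr_gt0// exprn_gt0.
pose A k := energy p (dil (a k) T) (U k.+1) `^ p^-1.
have A0 k : 0 <= A k by exact: powR_ge0.
pose hj := dil (a j) h; have chj : cls hj by exact: cls_dil.
pose D := 2 ^+ N * L + LK * M1 h.
have D1 : 0 <= 2 ^+ N * L by rewrite mulr_ge0// exprn_ge0.
have D2 : 0 <= LK * M1 h by rewrite mulr_ge0// M1_ge0.
have cK k : cls (dil (a k) T) by apply: cls_dil => //; exact: cls_tent.
have a_ratio i k : (i <= k)%N -> a i / a k = near_weight R i k.
  move=> ik; rewrite /a /near_weight (eqP ik) add0n -{1}(subnK ik) exprD exprVn.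
  by field; rewrite !expf_neq0 ?gt_eqF.
have NK k : (k <= j)%N -> N1 (conv (dil (a k) T) hj) <= LK * M1 h * near_weight R j k.
  move=> kj; have [mj Mj] := mom_dil (a0 j) mh.
  apply: (le_trans (N1_conv_vanish (L := LK * a k) _ _ _ _ _)) => //.
  - by move=> z; exact: (lip_dil z (a0 k) (cls_tent R N) hLK).
  - by rewrite Int_dil//; exact: cls_itg.
  rewrite [M1 hj]Mj.
  by rewrite near_weightC -a_ratio// le_eqVlt; apply/orP; left; apply/eqP; ring.
pose W k := conv (fun x => U k.+1 x - U k x) hj.
have cW k : cls (W k) by apply: cls_conv; [exact: clsB|exact: cls_itg].
(* Telescoping along the chain. The bottom term [U 0] is kept apart; it is the origin of the extra
   summand at [k = 0]. *)
have E : conv (U n) hj = (fun x => conv (U 0%N) hj x + \sum_(k < n) W k x).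
  have cd k : cls (fun x => U k.+1 x - U k x) by exact: clsB.
  have e1 : conv (fun x => \sum_(k < n) (U k.+1 x - U k x)) hj = (fun x => \sum_(k < n) W k x).
    by apply: (conv_suml (index_enum 'I_n) (f := fun (k : 'I_n) x => U k.+1 x - U k x)) => //; exact: cls_itg.
  transitivity (fun x => conv (U 0%N) hj x + conv (fun x => \sum_(k < n) (U k.+1 x - U k x)) hj x); last by rewrite e1.
  rewrite -convDl//; [|by apply: cls_sum => i; exact: cd|exact: cls_itg].
  congr conv; apply/funext => x.
  rewrite -(big_mkord xpredT (fun k => U k.+1 x - U k x)) telescope_sumr//.
  by rewrite addrC subrK.
have T0 : nm p (conv (U 0%N) hj) <= D * (near_weight R j 0 * nm p (U 1%N)).
  rewrite (Ui 0%N (leq_ltn_trans (leq0n _) jn)) (convA (cU _) (cK 0%N) chj).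
  apply: (le_trans (nm_conv p1' (cU _) (cls_itg (cls_conv (cK 0%N) (cls_itg chj))))).
  rewrite mulrA ler_wpM2r ?nm_ge0//; apply: le_trans (NK 0%N (leq0n _)) _.
  by rewrite ler_wpM2r ?near_weight_ge0// /D lerDr.
have Tk k : (k < n)%N -> nm p (W k) <= D * ((near_weight R j k * A k) +
    (if (k.+1 < n)%N then near_weight R j k.+1 * A k.+1 else 0)).
  move=> kn; have w0 := near_weight_ge0 R.
  have [jk|kj] := leqP j k.
    apply: (@le_trans _ _ (D * (near_weight R j k * A k))); last first.
      rewrite ler_wpM2l ?addr_ge0// lerDl; case: ifP => // _; exact: mulr_ge0.
    rewrite /W (Ui k kn) -/(a k).
    have ak0 : 0 <= (a k)^-1 by rewrite invr_ge0 ltW.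
    have La0 : 0 <= L * a j by rewrite mulr_ge0// ltW.
    have := conv_id_sub_smooth p1 (cK k) (fun y => dil_tent_ge0 y (a0 k)) (Int_dil_tent (a0 k))
      (dil_tentN (a k)) (fun y => dil_tent2 y (a0 k)) (fun y => dil_tent_support (a0 k)) ak0 La0
      (fun z => lip_dil z (a0 j) ch hL) chj (cU k.+1).
    move=> /le_trans; apply; rewrite -/(A k) [X in _ <= X]mulrA; apply: ler_wpM2r => //.
    rewrite -[L * a j * _]mulrA a_ratio// mulrA; apply: ler_wpM2r => //.
    by rewrite /D lerDl.
  have k1n : (k.+1 < n)%N by exact: leq_ltn_trans kj jn.
  apply: (@le_trans _ _ (D * (near_weight R j k.+1 * A k.+1))); last first.
    by rewrite k1n ler_wpM2l ?addr_ge0// lerDr mulr_ge0.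
  (* Convolutions commute, so the kernel [k.+1] can be pulled out of the difference. What is left is
     averaged at scale [k] and measured by the energy at the finer scale [k.+1]; hence the index
     [k.+1] in [Tk], which is below [n] because [k < j]. *)
  have UE : (fun x => U k.+1 x - U k x) =
      conv (fun x => U k.+2 x - conv (U k.+2) (dil (a k) T) x) (dil (a k.+1) T).
    rewrite convBl//; [|by apply: cls_conv => //; exact: cls_itg|exact: cls_itg].
    rewrite (convA (cU _) (cK k) (cK k.+1)) (convC (cK k) (cK k.+1)) -(convA (cU _) (cK _) (cK k)).
    by rewrite -(Ui _ k1n) -(Ui _ kn).
  have cd : cls (fun x => U k.+2 x - conv (U k.+2) (dil (a k) T) x).
    by apply: clsB => //; apply: cls_conv => //; exact: cls_itg.
  rewrite /W UE (convA cd (cK _) chj).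
  apply: (le_trans (nm_conv p1' cd (cls_itg (cls_conv (cK _) (cls_itg chj))))).
  rewrite mulrA; apply: ler_pM; [exact: N1_ge0|exact: nm_ge0| |].
    by apply: le_trans (NK _ kj) _; rewrite ler_wpM2r// /D lerDr.
  apply: (conv_id_sub p1 (cK k) (fun y => dil_tent_ge0 y (a0 k)) (Int_dil_tent (a0 k)) (cU _)).
  by move=> y; rewrite /dil scalerA mulrA -exprMn /a exprS; congr (_ ^+ _ * T (_ *: _)); ring.
rewrite E.
have cS : cls (fun x => \sum_(k < n) W k x) by apply: cls_sum => k.
apply: (le_trans (nm_triangle p1' (cls_conv (cU 0%N) (cls_itg chj)) cS)).
apply: (le_trans (lerD T0 (nm_sum (index_enum 'I_n) (f := fun k : 'I_n => W k) p1' (fun k => cW k)))).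
have D0 : 0 <= D by exact: addr_ge0.
have S1 : \sum_(k < n) nm p (W k) <= D * (2 * \sum_(k < n) near_weight R j k * A k).
  apply: (@le_trans _ _ (\sum_(k < n) D * ((near_weight R j k * A k) +
    (if (k.+1 < n)%N then near_weight R j k.+1 * A k.+1 else 0)))); first by apply: ler_sum => k _; exact: Tk.
  rewrite -mulr_sumr ler_wpM2l// big_split /= mulr2n mulrDl mul1r lerD2l.
  by apply: (sum_shift_le n (F := fun k => near_weight R j k * A k)) => k; rewrite mulr_ge0// near_weight_ge0.
apply: (le_trans (lerD (lexx _) S1)); rewrite -mulrDr -mulrA ler_wpM2l//.
under [X in _ <= 2 * X]eq_bigr do rewrite mulrDr.
rewrite big_split /= [X in _ <= X]mulrDr addrC lerD2l.
case: n jn {Ui E cS S1 Tk} => // n jn; rewrite big_ord_recl /=.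
rewrite [X in _ <= 2 * (_ + X)]big1 ?addr0; last by move=> i _; rewrite mulr0.
have : 0 <= near_weight R j 0 * nm p (U 1%N) by rewrite mulr_ge0 ?near_weight_ge0 ?nm_ge0.
by move: (near_weight R j 0 * _) => X; lra.
Qed.

(** Each step of the chain takes [c * A k ^ q] from the q-th power of the norm, so the sum of the
    [A k ^ q] is at most [nm p g ^ q / c], whatever [n] and [lam] are. Almost orthogonality and
    Schur's test pass this on to the pieces of [g]. *)
Theorem analysis p h (L : R) : 1 < p -> cls h -> 0 <= L -> lip L h -> mom h -> Int h = 0 ->
  exists2 C : R, 0 < C & forall (lam : R) n g, 0 < lam -> cls g ->
    \sum_(j < n) nm p (conv g (dil (lam * 2 ^+ j) h)) `^ (Num.max p 2) <= C * nm p g `^ (Num.max p 2).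
Proof.
move=> p1 ch L0 hL mh h0.
have [c c0 uc] := uc_exists N p1; have [LK LK0 hLK] := lip_tent R N.
set q := Num.max p 2 in uc *.
have q2 : 2 <= q by rewrite /q le_max lexx orbT.
have pq : p <= q by rewrite /q le_max lexx.
have q1 : 1 <= q by lra.
pose D := (2 ^+ N * L + LK * M1 h) * 2.
have D0 : 0 <= D by rewrite mulr_ge0// addr_ge0// mulr_ge0 ?exprn_ge0 ?M1_ge0.
(* [D] comes from almost orthogonality, 4 from the sums of [near_weight], the rest from splitting
   [B k] into the energy and the term at [k = 0]. *)
pose C := D `^ q * (4 `^ q * (2 `^ (q - 1) * (c^-1 + 1))).
have C0 : 0 <= C by rewrite !mulr_ge0 ?powR_ge0// addr_ge0// invr_ge0 ltW.
exists (C + 1); first by rewrite ltr_wpDl.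
move=> lam n g lam0 cg.
apply: (@le_trans _ _ (C * nm p g `^ q)); last by rewrite ler_wpM2r ?powR_ge0// lerDl.
have a0 i : 0 < lam * 2 ^+ i by rewrite mulr_gt0// exprn_gt0.
have cK k : cls (dil (lam * 2 ^+ k) T) by apply: cls_dil => //; exact: cls_tent.
have [U [cU Un Ui]] := averaging_chain n cK cg.
pose A k := energy p (dil (lam * 2 ^+ k) T) (U k.+1) `^ p^-1.
have A0 k : 0 <= A k by exact: powR_ge0.
pose B k := A k + (if k == 0%N then nm p (U 1%N) else 0).
have B0 k : 0 <= B k by rewrite addr_ge0//; case: ifP => // _; exact: nm_ge0.
have step k : (k < n)%N -> nm p (U k) `^ q + c * A k `^ q <= nm p (U k.+1) `^ q.
  move=> kn; rewrite (Ui k kn); apply: (energy_step p1 pq c0 uc (cK k)) => //.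
  - by move=> y; exact: dil_tent_ge0.
  - exact: Int_dil_tent.
  - exact: dil_tentN.
have tele m : (m <= n)%N -> nm p (U 0%N) `^ q + c * (\sum_(k < m) A k `^ q) <= nm p (U m) `^ q.
  elim: m => [|m ih] mn; first by rewrite big_ord0 mulr0 addr0.
  rewrite big_ord_recr /= mulrDr addrA; apply: le_trans (step m mn).
  by rewrite lerD2r; apply: ih; exact: ltnW.
have SA : \sum_(k < n) A k `^ q <= c^-1 * nm p g `^ q.
  rewrite ler_pdivlMl//; have := tele n (leqnn _); rewrite Un; apply: le_trans.
  by rewrite lerDr powR_ge0.
have mono d : (d <= n)%N -> nm p (U (n - d)%N) `^ q <= nm p g `^ q.
  elim: d => [|d ih] dn; first by rewrite subn0 Un.
  have e : (n - d = (n - d.+1).+1)%N by rewrite subnSK.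
  apply: le_trans (ih (ltnW dn)); rewrite e.
  apply: le_trans (step (n - d.+1)%N _); last by rewrite -subSn// leq_subLR addSn ltnS leq_addl.
  by rewrite lerDl mulr_ge0 ?powR_ge0// ltW.
have SU : \sum_(k < n) (if k == 0%N :> nat then nm p (U 1%N) else 0) `^ q <= nm p g `^ q.
  case: n {step tele SA Ui Un cg} mono => [|n] mono; first by rewrite big_ord0 powR_ge0.
  rewrite big_ord_recl /= big1 ?addr0; last by move=> i _; rewrite powR0//; lra.
  by have := mono n (leqnSn n); rewrite subSnn.
have SB : \sum_(k < n) B k `^ q <= 2 `^ (q - 1) * (c^-1 + 1) * nm p g `^ q.
  apply: (@le_trans _ _ (\sum_(k < n) 2 `^ (q - 1) * (A k `^ q + (if k == 0%N :> nat then nm p (U 1%N) else 0) `^ q))).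
    by apply: ler_sum => k _; apply: powR_mean => //; case: ifP => // _; exact: nm_ge0.
  rewrite -mulr_sumr -mulrA ler_wpM2l ?powR_ge0// big_split /= mulrDl mul1r.
  exact: lerD.
have main (j : 'I_n) : nm p (conv g (dil (lam * 2 ^+ j) h)) `^ q <= D `^ q * (\sum_(k < n) near_weight R j k * B k) `^ q.
  rewrite -powRM//; last by apply: sumr_ge0 => k _; rewrite mulr_ge0 ?near_weight_ge0.
  apply: powR_ler; [lra|exact: nm_ge0|].
  rewrite -{1}Un; exact: (almost_orthogonal p1 ch L0 hL mh h0 LK0 hLK lam0 cU Ui (ltn_ord j)).
apply: (@le_trans _ _ (\sum_(j < n) D `^ q * (\sum_(k < n) near_weight R j k * B k) `^ q)); first by apply: ler_sum => j _.
rewrite -mulr_sumr /C -!mulrA ler_wpM2l ?powR_ge0//.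
apply: (le_trans (discrete_young n q1 B0)).
by rewrite ler_wpM2l ?powR_ge0// mulrA.
Qed.

End analysis.
(** * Littlewood-Paley synthesis *)

Section synthesis.
Variables (R : realType) (N : nat).
Hypothesis hN : (1 <= N)%N.
Local Notation V := 'rV[R]_N.
Implicit Types (f g h u v : V -> R).

Lemma lip_sub f g (L M : R) : cls f -> cls g -> lip L f -> lip M g -> lip (L + M) (fun x => f x - g x).
Proof.
move=> cf cg hf hg z; rewrite mulrDl; apply: le_trans (lerD (hf z) (hg z)).
rewrite !N1_nm (eq_nm 1 (g := fun x => fdiff z f x - fdiff z g x)); last first.
  by move=> x; rewrite /fdiff; ring.
by apply: nm_sub => //; exact: cls_fdiff.
Qed.

Lemma mom_sub f g : cls f -> cls g -> mom f -> mom g -> mom (fun x => f x - g x).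
Proof.
move=> cf cg mf mg.
have mm : measurable_fun setT (fun x : V => `|x| * `|f x - g x|).
  apply: measurable_funM; first exact: measurable_norm_rV.
  by apply: measurableT_comp => //; exact: cls_meas (clsB cf cg).
apply: (le_itg mm _ (itgD mf mg)) => x.
by rewrite normrM !normr_id -mulrDr ler_wpM2l// ler_normB.
Qed.

(* The Littlewood-Paley kernel [eta] and its scaling function [phi], in physical space;
   [conv eta (fat phi) = eta] expresses that the Fourier transform of [fat phi] is 1 on
   the Fourier support of [eta]. *)
Definition fat (phi : V -> R) : V -> R := fun x => dil 2 phi x - dil 4^-1 phi x.

Record lp_pair (eta phi : V -> R) : Prop := LpPair {
  lp_eta : cls eta;
  lp_phi : cls phi;
  lp_etaN : forall x, eta (- x) = eta x;
  lp_phiN : forall x, phi (- x) = phi x;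
  lp_lip : exists2 L : R, 0 <= L & lip L phi;
  lp_mom : mom phi;
  lp_sub : forall x, eta x = phi x - dil 2^-1 phi x;
  lp_fat : conv eta (fat phi) = eta;
  lp_vanish : forall (a : R) x, 4 <= a -> conv (dil a eta) phi x = 0;
  lp_int : Int phi = 1 }.

Section pair.
Variables (eta phi : V -> R).
Hypothesis lp : lp_pair eta phi.

Lemma cls_fat : cls (fat phi).
Proof. by apply: clsB; apply: cls_dil; rewrite ?invr_gt0//; exact: lp_phi lp. Qed.

Lemma fatN x : fat phi (- x) = fat phi x.
Proof. by rewrite /fat /dil !scalerN !(lp_phiN lp). Qed.

Lemma lip_dil_exists f (a : R) : 0 < a -> cls f -> (exists2 L : R, 0 <= L & lip L f) ->
  exists2 L : R, 0 <= L & lip L (dil a f).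
Proof.
move=> a0 cf [L L0 hL]; exists (L * a); first by rewrite mulr_ge0// ltW.
by move=> z; exact: lip_dil.
Qed.

Lemma lip_fat : exists2 L : R, 0 <= L & lip L (fat phi).
Proof.
have cp := lp_phi lp; have h2 : 0 < 2 :> R by []; have h4 : 0 < 4^-1 :> R by rewrite invr_gt0.
have [L L0 hL] := lip_dil_exists h2 cp (lp_lip lp).
have [M M0 hM] := lip_dil_exists h4 cp (lp_lip lp).
exists (L + M); first exact: addr_ge0.
by apply: lip_sub => //; exact: cls_dil.
Qed.

Lemma mom_fat : mom (fat phi).
Proof.
have h4 : 0 < 4^-1 :> R by rewrite invr_gt0.
apply: mom_sub; [exact: cls_dil (lp_phi lp)|exact: cls_dil (lp_phi lp)| |].
  by have [] := mom_dil (ltr0Sn R 1) (lp_mom lp).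
by have [] := mom_dil h4 (lp_mom lp).
Qed.

Lemma Int_fat : Int (fat phi) = 0.
Proof.
have ip := cls_itg (lp_phi lp); have h4 : 0 < 4^-1 :> R by rewrite invr_gt0.
rewrite /fat IntB; [|exact/cls_itg/cls_dil/(lp_phi lp)|exact/cls_itg/cls_dil/(lp_phi lp)].
by rewrite !Int_dil// subrr.
Qed.

Lemma dil_etaE (a : R) x : dil a eta x = dil a phi x - dil (a / 2) phi x.
Proof. by rewrite -dil_dil /dil (lp_sub lp) mulrBr. Qed.

Lemma sum_dil_eta (lam : R) n x :
  \sum_(j < n) dil (lam * 2 ^+ j) eta x = dil (lam * 2 ^+ n / 2) phi x - dil (lam / 2) phi x.
Proof.
elim: n => [|n ih]; first by rewrite big_ord0 expr0 mulr1 subrr.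
rewrite big_ord_recr /= ih dil_etaE exprS.
have -> : lam * (2 * 2 ^+ n) / 2 = lam * 2 ^+ n by field.
ring.
Qed.

Lemma conv_dil_eta_fat (a : R) : 0 < a -> conv (dil a eta) (dil a (fat phi)) = dil a eta.
Proof.
by move=> a0; rewrite conv_dil ?(lp_fat lp)//; [exact: lp_eta lp|exact: cls_itg cls_fat].
Qed.

Lemma conv_phi_id g (a L : R) : 0 < a -> cls g -> lip L g ->
  N1 (fun x => conv g (dil a phi) x - g x) <= L * M1 phi / a.
Proof.
move=> a0 cg hL; have cp := cls_dil a0 (lp_phi lp); have ip := cls_itg cp.
have [mp Mp] := mom_dil a0 (lp_mom lp).
have I1 : Int (dil a phi) = 1 by rewrite Int_dil ?(lp_int lp)//; exact/cls_itg/(lp_phi lp).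
have fF : fam (fun x y => g (x - y) - g x) by apply: famB; [exact: fam_sub|exact: fam_cst].
have E x : conv g (dil a phi) x - g x = avg (dil a phi) (fun x y => g (x - y) - g x) x.
  rewrite /conv /avg -[X in _ - X]mulr1 -I1 -IntZ// -IntB; [|exact: itg_conv1|exact: itgZ].
  by apply: eq_Int => y; ring.
rewrite N1E (eq_Np _ E); apply: (le_trans (Np_avg (lexx 1) ip fF)).
rewrite subrr powRr0 mul1r (_ : L * M1 phi / a = L * M1 (dil a phi)); last by rewrite Mp; ring.
rewrite /M1 -IntZ//; apply: le_Int.
- by apply: fam_Np_itg => //; exact: itg_norm.
- exact: itgZ.
move=> y; rewrite -N1E (_ : L * (`|y| * `|dil a phi y|) = `|dil a phi y| * (L * `|y|)); last by ring.
by apply: ler_wpM2l => //; rewrite -normrN; exact: hL.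
Qed.

(** Low frequencies of an [L^1] function are uniformly small, since [dil b phi] is bounded by
    [b ^+ N * M]; here [N >= 1] gives [b ^+ N <= b]. *)
Lemma conv_phi_small g (b M : R) : 0 < b <= 1 -> cls g -> (forall x, `|phi x| <= M) ->
  forall x, `|conv g (dil b phi) x| <= b * (M * N1 g).
Proof.
move=> /andP[b0 b1] cg hM x; have cp := cls_dil b0 (lp_phi lp).
have M0 : 0 <= M by exact: le_trans (normr_ge0 _) (hM 0).
rewrite (convC cg cp) /conv /avg; apply: le_trans (Int_norm (itg_conv1 x cp (cls_itg cg))) _.
rewrite /N1 -!IntZ; try exact/cls_itg/cls_norm; last by apply/itgZ/cls_itg/cls_norm.
apply: le_Int; [exact/itg_norm/itg_conv1/cls_itg|by do 2 apply: itgZ; exact/cls_itg/cls_norm|].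
move=> y; rewrite normrM mulrC mulrA ler_wpM2r// /dil normrM ger0_norm ?exprn_ge0 ?(ltW b0)//.
apply: ler_pM => //; first by rewrite exprn_ge0// ltW.
by rewrite -[leRHS]expr1 ler_wiXn2l// ltW.
Qed.

Lemma le_geometric_limit (x y c : R) : (forall m, x <= y + c * 2^-1 ^+ m) -> x <= y.
Proof.
move=> h; rewrite leNgt; apply/negP => yx.
have d0 : 0 < x - y by rewrite subr_gt0.
pose m := Num.bound (`|c| / (x - y)).
have hm : `|c| / (x - y) < m%:R.
  by apply: archi_boundP; rewrite divr_ge0// ltW.
have h2 : m%:R < 2 ^+ m :> R by rewrite -natrX ltr_nat ltn_expl.
have h3 : `|c| < (x - y) * 2 ^+ m by rewrite mulrC -ltr_pdivrMr//; exact: lt_trans h2.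
have h4 : c * 2^-1 ^+ m < x - y.
  by rewrite exprVn ltr_pdivrMr ?exprn_gt0//; apply: le_lt_trans h3; exact: ler_norm.
by have := h m; rewrite leNgt => /negP; apply; rewrite addrC -ltrBrDr.
Qed.

(** Jensen with weights [b i ^ q'] and values [a i * b i ^ (1 - q')]; indices with [b i = 0]
    contribute nothing on the left. *)
Lemma hoelder_sum (n : nat) (q q' : R) (a b : nat -> R) : 1 < q -> 1 < q' -> q^-1 + q'^-1 = 1 ->
  (forall i, 0 <= a i) -> (forall i, 0 <= b i) ->
  (\sum_(i < n) a i * b i) `^ q <= (\sum_(i < n) b i `^ q') `^ (q - 1) * \sum_(i < n) a i `^ q.
Proof.
move=> q1 q1' qq a0 b0.
have q0 : q != 0 by lra. have q0' : q' != 0 by lra.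
have qq' : q + q' = q * q'.
  have : q * q' * (q^-1 + q'^-1) = q * q' by rewrite qq mulr1.
  by move=> <-; field; rewrite q0 q0'.
have := @jensen_sum R _ (index_enum 'I_n) (fun i => b i `^ q') (fun i => a i * b i `^ (1 - q')) q (ltW q1)
  (fun i => powR_ge0 _ _) (fun i => mulr_ge0 (a0 i) (powR_ge0 _ _)).
have -> : \sum_(i < n) b i `^ q' * (a i * b i `^ (1 - q')) = \sum_(i < n) a i * b i.
  apply: eq_bigr => i _; have [->|bn0] := eqVneq (b i) 0; first by rewrite powR0// mul0r mulr0.
  rewrite mulrCA -powRD ?bn0 ?implybT//; congr (_ * _).
  by rewrite (_ : q' + (1 - q') = 1) ?powRr1//; ring.
move=> /le_trans; apply; rewrite ler_wpM2l ?powR_ge0//; apply: ler_sum => i _.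
have [->|bn0] := eqVneq (b i) 0; first by rewrite powR0// mul0r powR_ge0.
rewrite powRM ?powR_ge0// mulrCA -powRrM -powRD ?bn0 ?implybT//.
by rewrite (_ : q' + (1 - q') * q = 0) ?powRr0 ?mulr1//; move: qq'; rewrite mulrBl mul1r; lra.
Qed.

(* For [j < 2 m] the exponents [j + 1 - m] run through [1 - m, m]. *)
Definition lp_scale (m j : nat) : R := 2 * 2^-1 ^+ m * 2 ^+ j.

(* Duality: the l^q-sum of the pieces of [g] is paired with the l^q'-sum of the pieces of [h],
   which [analysis] controls in the conjugate exponent. *)
Lemma synthesis_dual p : 1 < p -> exists2 C : R, 0 < C &
  forall g h (B : R), cls g -> (exists L : R, lip L g) -> cls h -> 0 <= B ->
  (forall m, \sum_(j < m + m) nm p (conv g (dil (lp_scale m j) eta)) `^ (Num.min p 2) <= B) ->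
  `|Int (fun x => g x * h x)| `^ (Num.min p 2) <= C * B * nm (p / (p - 1)) h `^ (Num.min p 2).
Proof.
move=> p1; pose p' := p / (p - 1).
have pm : 0 < p - 1 by lra.
have p1' : 1 < p' by rewrite /p' ltr_pdivlMr//; lra.
have pp : p^-1 + p'^-1 = 1 by rewrite /p'; field; rewrite !gt_eqF//; lra.
set q := Num.min p 2; pose q' := Num.max p' 2.
have q1 : 1 < q by rewrite /q lt_min p1 /=; lra.
have q1' : 1 < q' by rewrite /q' lt_max p1'.
(* [p <= 2] exactly when [p' >= 2], so [min(p, 2)] and [max(p', 2)] are conjugate. *)
have qq : q^-1 + q'^-1 = 1.
  rewrite /q /q'; case: (leP p 2) => p2.
    by rewrite max_l// /p' ler_pdivlMr//; lra.
  by rewrite max_r; [field|rewrite /p' ler_pdivrMr//; lra].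
have [L L0 hL] := lip_fat.
have [C C0 hC] := analysis p1' cls_fat L0 hL mom_fat Int_fat.
exists (C `^ (q - 1)); first exact: powR_gt0.
move=> g h B cg [Lg hLg] ch B0 hB.
have ce := lp_eta lp; have cp := lp_phi lp.
pose X := (C `^ (q - 1) * B * nm p' h `^ q) `^ q^-1.
have key m : `|\sum_(j < m + m) Int (fun x => conv g (dil (lp_scale m j) eta) x * h x)| <= X.
  pose lam : R := 2 * 2^-1 ^+ m; pose n := (m + m)%N.
  have lam0 : 0 < lam by rewrite mulr_gt0// exprn_gt0// invr_gt0.
  rewrite -/n; under eq_bigr do rewrite /lp_scale -/lam.
  have a0 i : 0 < lam * 2 ^+ i by rewrite mulr_gt0// exprn_gt0.
  pose a j := nm p (conv g (dil (lam * 2 ^+ j) eta)).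
  pose b j := nm p' (conv h (dil (lam * 2 ^+ j) (fat phi))).
  apply: (@le_trans _ _ (\sum_(j < n) a j * b j)).
    apply: (le_trans (ler_norm_sum _ _ _)); apply: ler_sum => j _.
    have cej := cls_dil (a0 j) ce; have cfj := cls_dil (a0 j) cls_fat.
    have cge := cls_conv cg (cls_itg cej).
    (* The reproducing identity inserts the fat kernel without changing the piece, and evenness
       moves it to [h]. *)
    have -> : Int (fun x => conv g (dil (lam * 2 ^+ j) eta) x * h x) =
        Int (fun x => conv g (dil (lam * 2 ^+ j) eta) x * conv h (dil (lam * 2 ^+ j) (fat phi)) x).
      rewrite -conv_adj//; last by move=> x; rewrite /dil scalerN fatN.
      by rewrite (convA cg cej cfj) conv_dil_eta_fat//; apply: eq_Int => x; rewrite mulrC.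
    by apply: hoelder_Int => //; apply: cls_conv => //; exact: cls_itg.
  have S0 : 0 <= \sum_(j < n) a j * b j by apply: sumr_ge0 => j _; rewrite mulr_ge0// nm_ge0.
  have q0 : q != 0 by lra.
  rewrite -[leLHS](powRK S0 q0) /X; apply: powR_ler; [by rewrite invr_ge0; lra|exact: powR_ge0|].
  apply: (le_trans (hoelder_sum n q1 q1' qq (a := a) (b := b) (fun=> nm_ge0 _ _) (fun=> nm_ge0 _ _))).
  have hq : nm p' h `^ q = (nm p' h `^ q') `^ (q - 1).
    rewrite -powRrM; congr (_ `^ _).
    have q0' : q' != 0 by lra.
    have : q * q' * (q^-1 + q'^-1) = q * q' by rewrite qq mulr1.
    rewrite (_ : q * q' * (q^-1 + q'^-1) = q + q'); last by field; rewrite q0 q0'.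
    by rewrite mulrBr mulr1 [q' * q]mulrC => <-; ring.
  rewrite hq mulrAC -powRM ?powR_ge0 ?(ltW C0)//; apply: ler_pM.
  - exact: powR_ge0.
  - by apply: sumr_ge0 => j _; exact: powR_ge0.
  - apply: powR_ler; [lra|by apply: sumr_ge0 => j _; exact: powR_ge0|].
    exact: hC.
  - exact: hB.
suff H : `|Int (fun x => g x * h x)| <= X.
  have XE : X `^ q = C `^ (q - 1) * B * nm p' h `^ q.
    rewrite /X powRVK//; [|lra].
    by rewrite mulr_ge0 ?powR_ge0// mulr_ge0// powR_ge0.
  by rewrite -XE; apply: powR_ler => //; lra.
have [_ [Mp hMp] _] := cp; have [_ [Mh hMh] _] := ch.
have Mh0 : 0 <= Mh by exact: le_trans (normr_ge0 _) (hMh 0).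
(* The pieces telescope to a difference of two smoothings of [g]. The one with [aa = 2 ^ m] is close
   to [g] in [L^1], the one with [bb = 2 ^ - m] is small in sup norm. As [h] is bounded and
   integrable, both errors are of order [2 ^ - m]. *)
apply: (@le_geometric_limit _ _ (Mh * (Lg * M1 phi) + Mp * N1 g * N1 h)) => m.
pose lam : R := 2 * 2^-1 ^+ m.
have lam0 : 0 < lam by rewrite mulr_gt0// exprn_gt0// invr_gt0.
pose aa : R := 2 ^+ m; pose bb : R := 2^-1 ^+ m.
have aa0 : 0 < aa by exact: exprn_gt0.
have bb0 : 0 < bb by rewrite exprn_gt0// invr_gt0.
have bb1 : bb <= 1 by apply: exprn_ile1; [rewrite invr_ge0|rewrite invf_le1//; lra].
have ca := cls_dil aa0 cp; have cb := cls_dil bb0 cp.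
have cga := cls_conv cg (cls_itg ca); have cgb := cls_conv cg (cls_itg cb).
have ab : aa * bb = 1 by rewrite -exprMn mulfV ?expr1n// pnatr_eq0.
have tele : \sum_(j < m + m) Int (fun x => conv g (dil (lam * 2 ^+ j) eta) x * h x) =
    Int (fun x => conv g (dil aa phi) x * h x) - Int (fun x => conv g (dil bb phi) x * h x).
  have a0 i : 0 < lam * 2 ^+ i by rewrite mulr_gt0// exprn_gt0.
  have cE j : cls (dil (lam * 2 ^+ j) eta) by exact: cls_dil.
  rewrite -Int_sum; last by move=> i; apply/cls_itg/clsMM => //; apply: cls_conv => //; exact: cls_itg.
  rewrite -IntB; [|exact/cls_itg/clsMM|exact/cls_itg/clsMM].
  apply: eq_Int => x; rewrite -mulr_suml -mulrBl; congr (_ * _).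
  have -> : conv g (dil aa phi) x - conv g (dil bb phi) x = conv g (fun x => dil aa phi x - dil bb phi x) x.
    by rewrite convBr//; exact: cls_itg.
  have E : (fun x => dil aa phi x - dil bb phi x) = (fun x => \sum_(j < m + m) dil (lam * 2 ^+ j) eta x).
    apply/funext => y; rewrite sum_dil_eta; congr (dil _ phi y - dil _ phi y).
      have F (r z : R) : 2 * z * (r * r) / 2 = r * z * r by field.
      by rewrite /lam exprD F ab mul1r.
    have F (z : R) : 2 * z / 2 = z by field.
    by rewrite /lam F.
  rewrite (convC cg (clsB ca cb)) E conv_suml//; last exact: cls_itg.
  by apply: eq_bigr => j _; rewrite (convC cg (cE j)).
have e1 : `|Int (fun x => g x * h x) - Int (fun x => conv g (dil aa phi) x * h x)| <= Mh * (Lg * M1 phi) * bb.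
  rewrite -IntB; [|exact/cls_itg/clsMM|exact/cls_itg/clsMM].
  have cd := clsB cga cg.
  apply: (@le_trans _ _ (Mh * N1 (fun x => conv g (dil aa phi) x - g x))); last first.
    rewrite -mulrA ler_wpM2l//; apply: le_trans (conv_phi_id aa0 cg hLg) _.
    by rewrite (_ : bb = aa^-1)// /bb exprVn.
  rewrite /N1 -IntZ; last exact/cls_itg/cls_norm.
  apply: le_trans (Int_norm _) _; first by apply: itgB; exact/cls_itg/clsMM.
  apply: le_Int; [by apply/itg_norm/itgB; exact/cls_itg/clsMM|exact/itgZ/cls_itg/cls_norm|].
  by move=> x; rewrite -mulrBl normrM mulrC distrC ler_wpM2r.
have e2 : `|Int (fun x => conv g (dil bb phi) x * h x)| <= Mp * N1 g * N1 h * bb.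
  apply: le_trans (Int_norm _) _; first exact/cls_itg/clsMM.
  rewrite mulrAC [_ * bb]mulrC /N1 -[X in _ <= X * _]/(bb * (Mp * N1 g)) -IntZ; last exact/cls_itg/cls_norm.
  apply: le_Int; [exact/itg_norm/cls_itg/clsMM|exact/itgZ/cls_itg/cls_norm|].
  by move=> x; rewrite normrM ler_wpM2r// conv_phi_small// bb0.
have := key m; under eq_bigr do rewrite /lp_scale -/lam; rewrite tele.
move: e1 e2; set I0 := Int _; set I1 := Int _; set I2 := Int _ => e1 e2 e3.
have -> : I0 = (I0 - I1) + ((I1 - I2) + I2) by ring.
apply: (le_trans (ler_normD _ _)); apply: (le_trans (lerD e1 (ler_normD _ _))).
apply: (le_trans (lerD (lexx _) (lerD e3 e2))).
by rewrite -/bb mulrDl addrCA.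
Qed.

(** Duality is tested on [|g| ^ (p - 2) g]: its pairing with [g] and the p'-th power of its norm are
    both the integral of [|g| ^ p]. Small values of [|g|] could take this function out of [cls], so
    it is cut off where [|g| <= e]; the part of [Np p g] lost there is at most
    [e ^ (p - 1) * N1 g]. *)
Theorem synthesis p : 1 < p -> exists2 C : R, 0 < C &
  forall g (B : R), cls g -> (exists L : R, lip L g) -> 0 <= B ->
  (forall m, \sum_(j < m + m) nm p (conv g (dil (lp_scale m j) eta)) `^ (Num.min p 2) <= B) ->
  nm p g `^ (Num.min p 2) <= C * B.
Proof.
move=> p1; have [C C0 hC] := synthesis_dual p1; exists C => // g B cg lg B0 hB.
set q := Num.min p 2 in hC hB *.
have q1 : 1 < q by rewrite /q lt_min p1 /=; lra.
have q0 : q != 0 by lra. have p0 : p != 0 by lra.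
have p1w := ltW p1.
pose X := (C * B) `^ q^-1.
have X0 : 0 <= X by exact: powR_ge0.
have CB0 : 0 <= C * B by rewrite mulr_ge0// ltW.
have XE : X `^ q = C * B by rewrite /X powRVK.
suff H : Np p g <= X `^ p.
  rewrite -XE; apply: powR_ler; [lra|exact: nm_ge0|].
  by rewrite nmE -(powRK X0 p0); apply: powR_ler => //; [rewrite invr_ge0; lra|exact: Np_ge0].
have pm : 0 < p - 1 by lra.
have cut (e : R) : 0 < e -> Np p g <= X `^ p + e `^ (p - 1) * N1 g.
  move=> e0.
  pose S := [set x : V | e < `|g x|].
  have mS : measurable S.
    have := measurableT_comp (@normr_measurable R setT) (cls_meas cg) measurableT (measurable_itv `]e, +oo[).
    by rewrite setTI set_itvE.
  have SP x : S x <-> e < `|g x| by [].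
  have [mg [M hM] _] := cg.
  pose u : V -> R := fun x => `|g x| `^ (p - 2) * \1_S x.
  have mu : measurable_fun setT u.
    by apply: measurable_funM; [exact: measurable_powR_norm|exact: measurable_indic].
  have bu : exists D : R, forall x, `|u x| <= D.
    exists (M `^ (p - 2) + e `^ (p - 2)) => x; rewrite /u indicE.
    case: (pselect (S x)) => [Sx|nSx]; last by rewrite memNset// mulr0 normr0 addr_ge0 ?powR_ge0.
    rewrite mem_set// mulr1 ger0_norm ?powR_ge0//; move/SP : Sx => Sx.
    have [p2|p2] := leP 2 p.
      apply: (@le_trans _ _ (M `^ (p - 2))); last by rewrite lerDl powR_ge0.
      by apply: powR_ler => //; lra.
    apply: (@le_trans _ _ (e `^ (p - 2))); last by rewrite lerDr powR_ge0.
    have -> : p - 2 = - (2 - p) by ring.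
    rewrite !powRN lef_pV2 ?posrE ?powR_gt0//; last exact: lt_trans Sx.
    by apply: powR_ler; [lra|exact: ltW|exact: ltW].
  pose h : V -> R := fun x => u x * g x.
  have ch : cls h by exact: clsM.
  pose t : V -> R := fun x => `|g x| `^ p * \1_S x.
  have gh x : g x * h x = t x.
    rewrite /h /u /t indicE; case: (pselect (S x)) => [Sx|nSx]; last first.
      by rewrite memNset// !mulr0 mul0r mulr0.
    rewrite mem_set// !mulr1; move/SP : Sx => Sx.
    have g0 : `|g x| != 0 by rewrite gt_eqF//; exact: lt_trans Sx.
    rewrite mulrCA -expr2 -real_normK ?num_real// -powR_mulrn// -powRD ?g0 ?implybT//.
    by congr (_ `^ _); ring.
  have hp x : `|h x| `^ (p / (p - 1)) = t x.
    rewrite /h /u /t indicE; case: (pselect (S x)) => [Sx|nSx]; last first.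
      rewrite memNset// !mulr0 mul0r normr0 powR0// mulf_neq0// invr_neq0//; lra.
    rewrite mem_set// !mulr1; move/SP : Sx => Sx.
    have g0 : `|g x| != 0 by rewrite gt_eqF//; exact: lt_trans Sx.
    rewrite normrM ger0_norm ?powR_ge0//.
    have -> : `|g x| `^ (p - 2) * `|g x| = `|g x| `^ (p - 1).
      rewrite -{2}(powRr1 (normr_ge0 (g x))) -powRD ?g0 ?implybT//; congr (_ `^ _); ring.
    by rewrite -powRrM; congr (_ `^ _); field; lra.
  have t0 x : 0 <= t x by rewrite mulr_ge0// powR_ge0.
  pose T := Int t; have T0 : 0 <= T by exact: Int_ge0.
  have it : itg t by apply: (eq_itg _ (cls_itg (clsMM cg ch))).
  have := hC g h B cg lg ch B0 hB.
  rewrite (eq_Int gh) ger0_norm// nmE (_ : Np _ h = T); last by apply: eq_Int.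
  rewrite -/T -XE; set T' := T `^ (p / (p - 1))^-1 => H.
  have T'0 : 0 <= T' by exact: powR_ge0.
  (* [T <= X * T ^ (1 / p')], divided by the last factor. *)
  have TX : T <= X `^ p.
    have [->|Tn0] := eqVneq T 0; first exact: powR_ge0.
    have Tp : 0 < T by rewrite lt_neqAle eq_sym Tn0.
    have {}H : T <= X * T'.
      rewrite -(powRK T0 q0) -(powRK (mulr_ge0 X0 T'0) q0).
      by apply: powR_ler; [rewrite invr_ge0; lra|exact: powR_ge0|rewrite powRM//].
    have TT : T = T `^ p^-1 * T'.
      rewrite /T' -powRD ?Tn0 ?implybT// (_ : _ + _ = 1) ?powRr1//.
      by field; rewrite p0 /=; lra.
    have T'p : 0 < T' by exact: powR_gt0.
    move: H; rewrite {1}TT ler_pM2r// => H.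
    by rewrite -(powRVK T0 p0); apply: powR_ler => //; [lra|exact: powR_ge0].
  apply: (@le_trans _ _ (T + e `^ (p - 1) * N1 g)); last by rewrite lerD2r.
  rewrite /N1 -IntZ; last exact/cls_itg/cls_norm.
  rewrite -IntD//; last exact/itgZ/cls_itg/cls_norm.
  apply: le_Int; [exact/cls_itg/cls_pow|by apply: itgD => //; exact/itgZ/cls_itg/cls_norm|].
  move=> x; rewrite /t indicE; case: (pselect (S x)) => [Sx|nSx].
    by rewrite mem_set// mulr1 lerDl mulr_ge0// powR_ge0.
  rewrite memNset// mulr0 add0r; apply: powR_le_linear => //.
  by rewrite leNgt; apply/negP => /SP.
apply: (@le_geometric_limit _ _ (N1 g)) => m.
have w0 : 0 < 2^-1 ^+ m :> R by rewrite exprn_gt0// invr_gt0.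
(* The cut-off level is the one whose power [p - 1] equals [2 ^ - m]. *)
have := cut ((2^-1 ^+ m) `^ (p - 1)^-1) (powR_gt0 _ w0).
by rewrite powRVK ?(ltW w0) ?gt_eqF// mulrC.
Qed.

End pair.
End synthesis.
(** * Dyadic sums and Schwartz functions *)

Section dyadic_shells.
Variable R : realType.

Lemma geometric_partial (r : R) n : 0 <= r < 1 -> \sum_(0 <= k < n) r ^+ k <= (1 - r)^-1.
Proof.
move=> /andP[r0 r1]; have d : 0 < 1 - r by rewrite subr_gt0.
rewrite -[leRHS]mul1r ler_pdivlMr// mulrC.
have -> : (1 - r) * \sum_(0 <= k < n) r ^+ k = 1 - r ^+ n.
  elim: n => [|n ih]; first by rewrite big_nil mulr0 expr0 subrr.
  by rewrite big_nat_recr//= mulrDr ih exprS; ring.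
by rewrite gerBl exprn_ge0.
Qed.

Lemma nneseries_geometric (c r : R) : 0 <= c -> 0 <= r < 1 ->
  (\sum_(k <oo) (c * r ^+ k)%:E <= (c / (1 - r))%:E)%E.
Proof.
move=> c0 r01; have /andP[r0 _] := r01.
apply: lime_le.
  by apply: is_cvg_nneseries => k _ _; rewrite lee_fin mulr_ge0// exprn_ge0.
apply: nearW => n; rewrite sumEFin lee_fin -mulr_sumr ler_wpM2l//.
exact: geometric_partial.
Qed.

Lemma dyadic_above (t : R) : exists k, t <= 2 ^+ k /\ (k = 0%N \/ 2 ^+ k <= 2 * t).
Proof.
have ex : exists k, t <= 2 ^+ k.
  have [t0|t0] := leP t 0; first by exists 0%N; rewrite expr0; lra.
  exists (Num.bound t); apply: ltW; apply: lt_trans (archi_boundP (ltW t0)) _.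
  by rewrite -natrX ltr_nat ltn_expl.
case: (ex_minnP ex) => k hk mink; exists k; split=> //.
case: k hk mink => [|k] hk mink; [by left|right].
rewrite exprS ler_pM2l//; rewrite leNgt; apply/negP => /ltW /mink.
by rewrite ltnn.
Qed.

End dyadic_shells.

Section schwartz_functions.
Variables (R : realType) (N : nat).
Local Notation V := 'rV[R]_N.
Implicit Types (f g : V -> R).

Definition weight (m : nat) : V -> R := fun x => ((1 + `|x|) ^+ m)^-1.

Lemma norm1_gt0 (x : V) : 0 < 1 + `|x|.
Proof. by rewrite ltr_wpDr. Qed.

Lemma weight_gt0 m x : 0 < weight m x.
Proof. by rewrite invr_gt0 exprn_gt0// norm1_gt0. Qed.

Lemma weight_le1 m x : weight m x <= 1.
Proof.
by rewrite /weight invf_le1 ?exprn_gt0 ?norm1_gt0// exprn_ege1// lerDl.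
Qed.

Lemma measurable_weight m : measurable_fun setT (weight m).
Proof.
have -> : weight m = (fun x : V => (1 + `|x|) `^ (- m%:R)).
  by apply/funext => x; rewrite powRN powR_mulrn// ltW// norm1_gt0.
apply: (measurableT_comp (measurable_powR _)); apply: measurable_funD => //.
exact: measurable_norm_rV.
Qed.

Lemma itg_weight : itg (weight N.+1).
Proof.
apply: itg_lty; [exact: measurable_weight|by move=> x; exact/ltW/weight_gt0|].
have w2 : 0 <= (2^-1 : R) < 1 by apply/andP; split; [rewrite invr_ge0|rewrite invf_lt1//; lra].
(* Where [|x|] is about [2 ^ k] the weight is at most [(2 / 2 ^ k) ^ (N + 1)], one power better than
   the growth of the volume. *)
pose w k : R := 2 ^+ N.+1 * (2 ^+ (k * N.+1))^-1.
pose r k : R := 2 ^+ k.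
have w0 k : 0 <= w k by rewrite mulr_ge0 ?invr_ge0 ?exprn_ge0.
apply: (@le_lt_trans _ _ (\sum_(k <oo) (w k * (2 * r k) ^+ N)%:E)%E).
  apply: shell_bound => //.
  - exact: measurable_weight.
  - by move=> x; exact/ltW/weight_gt0.
  - by move=> k; exact: exprn_gt0.
  move=> x _; have [k [k1 k2]] := dyadic_above `|x|; exists k; split=> //.
  have -> : w k = (2 * (2 ^+ k)^-1) ^+ N.+1 by rewrite /w exprM exprMn exprVn.
  have -> : weight N.+1 x = ((1 + `|x|)^-1) ^+ N.+1 by rewrite exprVn.
  have n0 := normr_ge0 x.
  have h : (1 + `|x|)^-1 <= 2 / 2 ^+ k.
    rewrite ler_pdivlMr ?exprn_gt0// mulrC ler_pdivrMr ?norm1_gt0//.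
    by case: k2 => [->|h]; rewrite ?expr0; lra.
  have h0 : 0 <= (1 + `|x|)^-1 by rewrite invr_ge0 ltW// norm1_gt0.
  by apply: lerXn2r => //; rewrite nnegrE; exact: le_trans h.
rewrite (@eq_eseriesr _ _ (fun k => (2 ^+ N.+1 * 2 ^+ N * 2^-1 ^+ k)%:E)); last first.
  move=> k _; congr EFin; rewrite /w /r exprMn -exprM mulnS exprD exprVn.
  by field; rewrite !expf_neq0.
apply: le_lt_trans (nneseries_geometric _ w2) _; last exact: ltry.
by rewrite mulr_ge0 ?exprn_ge0.
Qed.

(** Two seminorms suffice: order 0 where [|x| <= 1], order [m] where [1 + |x| <= 2 |x|]. *)
Lemma schwartz_decay g : real_schwartz g -> forall (l : seq 'I_N) m, exists2 C : R, 0 <= C &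
  forall x, `|partials l g x| <= C * weight m x.
Proof.
move=> [_ hg] l m; have [A hA] := hg 0%N l; have [B hB] := hg m l.
have A0 : 0 <= A by have := hA 0; rewrite expr0 mul1r; apply: le_trans.
have B0 : 0 <= B by have := hB 0; apply: le_trans; apply: mulr_ge0 => //; apply: exprn_ge0; exact: eucl_ge0.
exists (2 ^+ m * (A + B)); first by rewrite mulr_ge0 ?exprn_ge0 ?addr_ge0.
move=> x; rewrite /weight ler_pdivlMr ?exprn_gt0 ?norm1_gt0//.
have n0 := normr_ge0 x.
have [x1|x1] := leP `|x| 1.
  rewrite [leLHS]mulrC; apply: ler_pM; [exact: exprn_ge0 (ltW (norm1_gt0 x))|by []| |].
    by apply: lerXn2r; rewrite ?nnegrE//; lra.
  by have := hA x; rewrite expr0 mul1r => h; apply: le_trans h _; rewrite lerDl.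
have -> : 2 ^+ m * (A + B) = 2 ^+ m * A + 2 ^+ m * B by rewrite mulrDr.
apply: (@le_trans _ _ (2 ^+ m * B)); last by rewrite lerDr mulr_ge0 ?exprn_ge0.
apply: (@le_trans _ _ (`|partials l g x| * (2 * `|x|) ^+ m)).
  by rewrite ler_wpM2l//; apply: lerXn2r; rewrite ?nnegrE//; lra.
rewrite exprMn mulrCA ler_wpM2l ?exprn_ge0// mulrC; apply: le_trans (hB x).
by rewrite ler_wpM2r//; apply: lerXn2r; rewrite ?nnegrE ?eucl_ge0// norm_le_eucl.
Qed.

Lemma weightS m x : weight m.+1 x * `|x| <= weight m x.
Proof.
rewrite /weight exprS invfM mulrAC ler_piMl ?invr_ge0 ?exprn_ge0 ?ltW ?norm1_gt0//.
by rewrite mulrC ltr_pdivrMr ?norm1_gt0// mul1r ltrDr.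
Qed.

Lemma weight_shift m x y : `|y - x| <= 1 -> weight m y <= 2 ^+ m * weight m x.
Proof.
move=> xy; rewrite /weight -!exprVn -exprMn; apply: lerXn2r; rewrite ?nnegrE ?mulr_ge0 ?invr_ge0 ?(ltW (norm1_gt0 _))//.
rewrite -[2]invrK -invfM lef_pV2 ?posrE ?mulr_gt0 ?invr_gt0 ?norm1_gt0//.
have := ler_normB y (y - x); rewrite (_ : y - (y - x) = x); last by rewrite opprB addrC subrK.
have := normr_ge0 y; lra.
Qed.

Lemma schwartz_meas g : real_schwartz g -> measurable_fun setT g.
Proof. by move=> [sg _]; apply: continuous_measurable_rV; exact: (sg [::]).1. Qed.

Lemma schwartz_cls g : real_schwartz g -> cls g.
Proof.
move=> sg; have mg := schwartz_meas sg; have [C C0 hC] := schwartz_decay sg [::] N.+1.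
split=> //; last by apply: (le_itg mg hC (itgZ C itg_weight)).
by exists C => x; apply: le_trans (hC x) _; rewrite ler_piMr// weight_le1.
Qed.

Lemma schwartz_mom g : real_schwartz g -> mom g.
Proof.
move=> sg; have mg := schwartz_meas sg; have [C C0 hC] := schwartz_decay sg [::] N.+2.
have mm : measurable_fun setT (fun x : V => `|x| * `|g x|).
  by apply: measurable_funM; [exact: measurable_norm_rV|exact: measurableT_comp].
apply: (le_itg mm _ (itgZ C itg_weight)) => x.
rewrite normrM !normr_id; apply: (@le_trans _ _ (`|x| * (C * weight N.+2 x))).
  by rewrite ler_wpM2l//; exact: hC.
by rewrite mulrCA ler_wpM2l// mulrC weightS.
Qed.

Lemma partial_mvt g (i : 'I_N) (y : V) (t : R) : real_schwartz g ->
  exists s, `|s| <= `|t| /\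
    g (y + t *: delta_mx 0 i) - g y = partials [:: i] g (y + s *: delta_mx 0 i) * t.
Proof.
move=> [sg _]; have [_ dg] := sg [::].
pose e : V := delta_mx 0 i; pose phi (u : R) : R := g (y + u *: e).
have E (u : R) : (fun h : R => h^-1 *: (phi (h *: 1 + u) - phi u)) =
    (fun h => h^-1 *: (g (h *: e + (y + u *: e)) - g (y + u *: e))).
  by apply/funext => h; rewrite /phi addrCA scalerDl [h *: 1]mulr1.
have D (u : R) : is_derive u 1 phi (partials [:: i] g (y + u *: e)).
  apply: DeriveDef.
    by rewrite /derivable E; exact: dg.
  by rewrite /derive E.
have C (I : interval R) : {within [set` I], continuous phi}.
  by apply: derivable_within_continuous => u _; have := D u; case.
have phi0 : phi 0 = g y by rewrite /phi scale0r addr0.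
have [t0|t0] := leP 0 t.
  have [s] := MVT_segment t0 (fun u _ => D u) (C _).
  rewrite in_itv /= => /andP[s0 st] h; exists s; split.
    by rewrite !ger0_norm.
  by rewrite -phi0 -[g _]/(phi t) h subr0.
have [s] := MVT_segment (ltW t0) (fun u _ => D u) (C _).
rewrite in_itv /= => /andP[s0 st] h; exists s; split.
  by rewrite ler0_norm// ltr0_norm// lerN2.
have -> : g (y + t *: e) - g y = - (phi 0 - phi t) by rewrite phi0 /phi opprB.
by rewrite h sub0r mulrN opprK.
Qed.

(** Vertices of the path from [0] to [z] along the coordinate axes. Consecutive vertices differ in
    one coordinate, so the mean value theorem needs partial derivatives only. *)
Definition row_prefix (z : V) (k : nat) : V := \row_j (if (j < k)%N then z 0 j else 0).

Lemma row_prefixS z (i : 'I_N) : row_prefix z i.+1 = row_prefix z i + z 0 i *: delta_mx 0 i.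
Proof.
apply/rowP => j; rewrite !mxE eqxx /=; have [->|ij] := eqVneq j i.
  by rewrite ltnSn ltnn mulr1 add0r.
by rewrite mulr0 addr0 ltnS leq_eqVlt val_eqE (negbTE ij).
Qed.

Lemma schwartz_diff_le g : real_schwartz g -> exists2 C : R, 0 <= C &
  forall x z, `|z| <= 1 -> `|g (x + z) - g x| <= C * `|z| * weight N.+1 x.
Proof.
move=> sg.
have /choice[c hc] : forall i : 'I_N, exists C : R, 0 <= C /\ forall x, `|partials [:: i] g x| <= C * weight N.+1 x.
  by move=> i; have [C C0 hC] := schwartz_decay sg [:: i] N.+1; exists C.
exists (\sum_i c i * 2 ^+ N.+1).
  by apply: sumr_ge0 => i _; rewrite mulr_ge0 ?exprn_ge0//; exact: (hc i).1.
move=> x z z1.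
have tele : g (x + z) - g x = \sum_(i < N) (g (x + row_prefix z i.+1) - g (x + row_prefix z i)).
  rewrite -(big_mkord xpredT (fun i => g (x + row_prefix z i.+1) - g (x + row_prefix z i))) telescope_sumr//.
  congr (g (x + _) - g _); first by apply/rowP => j; rewrite mxE ltn_ord.
  by rewrite (_ : row_prefix z 0 = 0) ?addr0//; apply/rowP => j; rewrite !mxE.
rewrite tele; apply: (le_trans (ler_norm_sum _ _ _)); rewrite -mulrA mulr_suml.
apply: ler_sum => i _; rewrite row_prefixS addrA.
have [s [st ->]] := partial_mvt i (x + row_prefix z i) (z 0 i) sg.
rewrite normrM (_ : c i * 2 ^+ N.+1 * (`|z| * weight N.+1 x) = c i * (2 ^+ N.+1 * weight N.+1 x) * `|z|); last by ring.
apply: ler_pM => //; last exact: coord_le_norm.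
apply: le_trans ((hc i).2 _) _; rewrite ler_wpM2l ?(hc i).1//; apply: weight_shift.
rewrite -[x + _ + _]addrA [x + (_ + _)]addrC addrK; apply: le_trans z1.
apply/norm_leP => // j; rewrite !mxE eqxx /=.
have [->|ij] := eqVneq j i; first by rewrite ltnn mulr1 add0r; apply: le_trans st _; exact: coord_le_norm.
by rewrite mulr0 addr0; case: ifP => _; rewrite ?normr0//; exact: coord_le_norm.
Qed.

Lemma schwartz_lip g : real_schwartz g -> exists2 L : R, 0 <= L & lip L g.
Proof.
move=> sg; have [C C0 hC] := schwartz_diff_le sg; have cg := schwartz_cls sg.
have W0 : 0 <= Int (weight N.+1) by apply: Int_ge0 => x; exact/ltW/weight_gt0.
have L0 : 0 <= C * Int (weight N.+1) by exact: mulr_ge0.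
have G0 := N1_ge0 g.
exists (C * Int (weight N.+1) + 2 * N1 g); first by rewrite addr_ge0// mulr_ge0.
move=> z; have z0 := normr_ge0 z; have [z1|z1] := leP `|z| 1.
  apply: (@le_trans _ _ (C * Int (weight N.+1) * `|z|)); last by rewrite ler_wpM2r// lerDl mulr_ge0.
  rewrite mulrAC -IntZ; last exact: itg_weight.
  apply: le_Int; [exact/cls_itg/cls_norm/cls_fdiff|exact/itgZ/itg_weight|].
  by move=> x; exact: hC.
apply: (le_trans (N1_fdiff z cg)).
rewrite -[X in X <= _]mulr1; apply: ler_pM => //; [exact: mulr_ge0|by rewrite lerDr|exact: ltW].
Qed.

End schwartz_functions.
(** * Cosine transforms *)

Section cosine_products.
Variable R : realType.
Implicit Types (u v : R).

Lemma sin_mvt v : 0 < v -> exists2 c : R, 0 < c < v & sin v = v * cos c.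
Proof.
move=> v0; have C : {within `[0, v], continuous (@sin R)}.
  by apply: derivable_within_continuous => x _; exact: derivable_sin.
have [c] := @MVT R sin cos 0 v v0 (fun x _ => is_derive_sin x) C.
by rewrite in_itv /= => cv; rewrite sin0 !subr0 mulrC => ->; exists c.
Qed.

Lemma sin_norm_le v : `|sin v| <= `|v|.
Proof.
wlog v0 : v / 0 <= v.
  move=> H; have [/H//|v0] := leP 0 v.
  by have := H (- v); rewrite sinN !normrN; apply; rewrite oppr_ge0 ltW.
have [->|vn0] := eqVneq v 0; first by rewrite sin0.
have vp : 0 < v by rewrite lt_neqAle eq_sym vn0.
have [c _ ->] := sin_mvt vp.
by rewrite normrM ler_piMr// cos_max.
Qed.

Lemma cos_ge_half v : 0 <= v <= 1 -> 2^-1 <= cos v.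
Proof.
move=> /andP[v0 v1].
have E : cos v = 1 - 2 * sin (v / 2) ^+ 2.
  rewrite -{1}(_ : (v / 2) *+ 2 = v); last by rewrite -mulr_natr; field.
  rewrite cos_mulr2n -mulr_natr; have := cos2Dsin2 (v / 2); lra.
have : sin (v / 2) ^+ 2 <= (2^-1) ^+ 2.
  rewrite -real_normK ?num_real//; apply: lerXn2r; rewrite ?nnegrE//.
  by apply: le_trans (sin_norm_le _) _; rewrite ger0_norm; lra.
rewrite E expr2; lra.
Qed.

Lemma sin_ge_half v : 0 <= v <= 1 -> v / 2 <= sin v.
Proof.
move=> /andP[v0 v1]; have [->|vn0] := eqVneq v 0; first by rewrite sin0 mul0r.
have vp : 0 < v by rewrite lt_neqAle eq_sym vn0.
have [c /andP[c0 cv] ->] := sin_mvt vp.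
by rewrite ler_wpM2l// cos_ge_half// (ltW c0) /= (le_trans (ltW cv)).
Qed.

(* Finite version of Euler's product [sin u / u = prod_n cos (u / 2 ^ n)]. *)
Definition cosprod (M : nat) (u : R) : R := \prod_(n < M) cos (u / 2 ^+ n.+1).

Lemma cosprod_sin M u : cosprod M u * (2 ^+ M * sin (u / 2 ^+ M)) = sin u.
Proof.
elim: M => [|M ih]; first by rewrite /cosprod big_ord0 expr0 divr1 !mul1r.
rewrite -ih /cosprod big_ord_recr /= -mulrA; congr (_ * _).
have -> : sin (u / 2 ^+ M) = cos (u / 2 ^+ M.+1) * sin (u / 2 ^+ M.+1) *+ 2.
  rewrite -sin_mulr2n; congr sin; rewrite -mulr_natr exprS; field.
  by rewrite expf_neq0.
by rewrite -mulr_natr exprS; ring.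
Qed.

Lemma cosprodN M u : cosprod M (- u) = cosprod M u.
Proof. by apply: eq_bigr => n _; rewrite mulNr cosN. Qed.

Lemma cosprod_le1 M u : `|cosprod M u| <= 1.
Proof.
rewrite /cosprod normr_prod; apply: prodr_ile1 => n _.
by rewrite normr_ge0 cos_max.
Qed.

(** By the product formula [|cosprod M u| * 2 ^ M * sin (u / 2 ^ M) <= 1] for [u >= 0], and
    [sin v >= v / 2] on [[0, 1]]. The decay of [sin u / u] is thus inherited up to [|u| = 2 ^ M],
    although the product itself is periodic. *)
Lemma cosprod_decay M u : `|u| <= 2 ^+ M -> `|cosprod M u| * `|u| <= 2.
Proof.
wlog u0 : u / 0 <= u.
  move=> H; have [/H//|u0] := leP 0 u.
  by have := H (- u); rewrite cosprodN normrN; apply; rewrite oppr_ge0 ltW.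
rewrite (ger0_norm u0) => uM.
have e0 : 0 < 2 ^+ M :> R by rewrite exprn_gt0.
pose v := u / 2 ^+ M.
have v01 : 0 <= v <= 1 by rewrite divr_ge0 ?(ltW e0)//= ler_pdivrMr// mul1r.
have h := sin_ge_half v01.
have uE : u = 2 ^+ M * v by rewrite /v mulrCA mulfV ?mulr1// gt_eqF.
have : `|cosprod M u * (2 ^+ M * sin v)| <= 1 by rewrite cosprod_sin sin_max.
have /andP[v0 _] := v01.
rewrite normrM [X in _ * X]ger0_norm ?mulr_ge0 ?(ltW e0)//; last by apply: le_trans h; rewrite divr_ge0.
move=> h1; apply: (@le_trans _ _ (`|cosprod M u| * (2 ^+ M * sin v) * 2)); last by rewrite -[leRHS]mul1r ler_wpM2r.
rewrite -mulrA ler_wpM2l// [X in X <= _]uE -mulrA ler_wpM2l ?(ltW e0)//.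
by move: h; move: v {uE v01 v0 h1} => w; lra.
Qed.

(** The product formula again: [sin u >= u / 2], against [2 ^ M * sin (u / 2 ^ M) <= u]. *)
Lemma cosprod_ge_half M u : `|u| <= 1 -> 2^-1 <= cosprod M u.
Proof.
wlog u0 : u / 0 <= u.
  move=> H; have [/H//|u0] := leP 0 u.
  by have := H (- u); rewrite cosprodN normrN; apply; rewrite oppr_ge0 ltW.
rewrite (ger0_norm u0) => u1.
have [->|un0] := eqVneq u 0.
  rewrite /cosprod big1; first lra.
  by move=> n _; rewrite mul0r cos0.
have up : 0 < u by rewrite lt_neqAle eq_sym un0.
have e0 : 0 < 2 ^+ M :> R by rewrite exprn_gt0.
have e1 : 1 <= 2 ^+ M :> R by apply: exprn_ege1; lra.
pose v := u / 2 ^+ M.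
have vp : 0 < v by exact: divr_gt0.
have v01 : 0 <= v <= 1.
  by rewrite ltW//= /v ler_pdivrMr// mul1r; exact: le_trans e1.
have hv := sin_ge_half v01.
have uE : u = 2 ^+ M * v by rewrite /v mulrCA mulfV ?mulr1// gt_eqF.
have u01 : 0 <= u <= 1 by rewrite u0.
have hu := sin_ge_half u01.
have sv0 : 0 < sin v by apply: lt_le_trans hv; exact: divr_gt0.
have S0 : 0 < 2 ^+ M * sin v by exact: mulr_gt0.
rewrite -(ler_pM2r S0) cosprod_sin; apply: le_trans hu.
rewrite [leLHS]mulrC ler_wpM2r// [leRHS]uE ler_wpM2l// ?(ltW e0)//.
by have := sin_norm_le v; rewrite gtr0_norm// gtr0_norm.
Qed.

End cosine_products.

(** * Injectivity of the cosine transform on even functions *)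

Section fourier_injectivity.
Variables (R : realType) (N : nat).
Local Notation V := 'rV[R]_N.
Implicit Types (g h k : V -> R).

Lemma dotvDl (x y xi : V) : dotv (x + y) xi = dotv x xi + dotv y xi.
Proof. by rewrite /dotv -big_split; apply: eq_bigr => i _; rewrite mxE mulrDl. Qed.

Lemma dotvDr (x xi zeta : V) : dotv x (xi + zeta) = dotv x xi + dotv x zeta.
Proof. by rewrite /dotv -big_split; apply: eq_bigr => i _; rewrite mxE mulrDr. Qed.

Lemma dotvZl (a : R) (x xi : V) : dotv (a *: x) xi = a * dotv x xi.
Proof. by rewrite /dotv mulr_sumr; apply: eq_bigr => i _; rewrite mxE mulrA. Qed.

Lemma dotvZr (a : R) (x xi : V) : dotv x (a *: xi) = a * dotv x xi.
Proof. by rewrite /dotv mulr_sumr; apply: eq_bigr => i _; rewrite mxE; ring. Qed.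

Lemma dotvNl (x xi : V) : dotv (- x) xi = - dotv x xi.
Proof. by rewrite -scaleN1r dotvZl mulN1r. Qed.

Lemma dotvNr (x xi : V) : dotv x (- xi) = - dotv x xi.
Proof. by rewrite -scaleN1r dotvZr mulN1r. Qed.

Lemma dotv0r (x : V) : dotv x 0 = 0.
Proof. by rewrite -(scale0r 0) dotvZr mul0r. Qed.

Lemma dotv_delta (x : V) i : dotv x (delta_mx 0 i) = x 0 i.
Proof.
rewrite /dotv (bigD1 i)//= mxE !eqxx mulr1 big1 ?addr0// => j ji.
by rewrite mxE eqxx (negbTE ji) mulr0.
Qed.

Lemma measurable_dotv (xi : V) : measurable_fun setT (fun x : V => dotv x xi).
Proof. by apply: measurable_sum => i; apply: measurable_funM => //; exact: measurable_coord. Qed.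

Lemma measurable_cos_dotv (xi : V) : measurable_fun setT (fun x : V => cos (dotv x xi)).
Proof.
by apply: (measurableT_comp _ (measurable_dotv xi)); apply: continuous_measurable_fun; exact: continuous_cos.
Qed.

Lemma measurable_sin_dotv (xi : V) : measurable_fun setT (fun x : V => sin (dotv x xi)).
Proof.
by apply: (measurableT_comp _ (measurable_dotv xi)); apply: continuous_measurable_fun; exact: continuous_sin.
Qed.

Lemma cls_cos g xi : cls g -> cls (fun x => cos (dotv x xi) * g x).
Proof. by move=> cg; apply: clsM => //; [exact: measurable_cos_dotv|exists 1 => x; exact: cos_max]. Qed.

Lemma cls_sin g xi : cls g -> cls (fun x => sin (dotv x xi) * g x).
Proof. by move=> cg; apply: clsM => //; [exact: measurable_sin_dotv|exists 1 => x; exact: sin_max]. Qed.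

Definition FC g (xi : V) : R := Int (fun x => cos (dotv x xi) * g x).
Definition FS g (xi : V) : R := Int (fun x => sin (dotv x xi) * g x).

Definition even_fun g := forall x : V, g (- x) = g x.

Lemma FS_even g xi : cls g -> even_fun g -> FS g xi = 0.
Proof.
move=> cg eg; have i1 := cls_itg (cls_sin xi cg).
have : FS g xi = - FS g xi.
  rewrite {1}/FS -(Int_reflect 0 i1) -mulN1r -IntZ//; apply: eq_Int => x.
  by rewrite sub0r dotvNl sinN eg mulN1r mulNr.
by move=> h; lra.
Qed.

Lemma FC_sub g h xi : cls g -> cls h -> FC (fun x => g x - h x) xi = FC g xi - FC h xi.
Proof.
move=> cg ch; rewrite /FC -IntB; [|exact/cls_itg/cls_cos|exact/cls_itg/cls_cos].
by apply: eq_Int => x; rewrite mulrBr.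
Qed.

Lemma FC_dil g (a : R) xi : 0 < a -> cls g -> FC (dil a g) xi = FC g (a^-1 *: xi).
Proof.
move=> a0 cg; rewrite /FC -[RHS](Int_dil a0); last exact/cls_itg/cls_cos.
apply: eq_Int => x; rewrite /dil.
by have -> : dotv (a *: x) (a^-1 *: xi) = dotv x xi; [rewrite dotvZl dotvZr mulrA mulfV ?gt_eqF// mul1r|ring].
Qed.

Lemma FC_conv g h xi : cls g -> cls h -> even_fun g -> FC (conv g h) xi = FC g xi * FC h xi.
Proof.
move=> cg ch eg.
have b : exists M : R, forall x : V, `|cos (dotv x xi)| <= M by exists 1 => x; exact: cos_max.
rewrite /FC (avg_dual (cls_itg ch) (fam_sub cg) (measurable_cos_dotv xi) b).
rewrite -/(FC g xi) -IntZ; last exact/cls_itg/cls_cos.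
have E y : Int (fun x => cos (dotv x xi) * g (x - y)) = cos (dotv y xi) * FC g xi.
  have i1 : itg (fun x => cos (dotv x xi) * g (x - y)).
    by apply: cls_itg; apply: clsM; [exact: cls_shift|exact: measurable_cos_dotv|].
  rewrite -(Int_shift y i1).
  have -> : cos (dotv y xi) * FC g xi = cos (dotv y xi) * FC g xi - sin (dotv y xi) * FS g xi.
    by rewrite (FS_even xi cg eg) mulr0 subr0.
  rewrite /FC /FS -!IntZ; [|exact/cls_itg/cls_sin|exact/cls_itg/cls_cos].
  rewrite -IntB; [|exact/itgZ/cls_itg/cls_cos|exact/itgZ/cls_itg/cls_sin].
  by apply: eq_Int => x; rewrite addrK dotvDl cosD; ring.
by apply: eq_Int => y; rewrite E; ring.
Qed.

Lemma Int_tail g : cls g -> forall e : R, 0 < e -> exists n : nat,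
  Int (fun x => `|g x| * (1 - ccube n%:R x)) <= e.
Proof.
move=> cg e e0; have ig := cls_itg (cls_norm cg).
pose F (n : nat) (x : V) := `|g x| * (1 - ccube n%:R x).
have c01 (n : nat) (x : V) : 0 <= 1 - ccube (n%:R : R) x <= 1 by rewrite ccubeE; case: ifP => _; apply/andP; split; lra.
have mF n : measurable_fun setT (F n).
  apply: measurable_funM; first by apply: measurableT_comp => //; exact: cls_meas cg.
  by apply: measurable_funB => //; exact: measurable_ccube.
have F0 n x : 0 <= F n x by rewrite mulr_ge0//; case/andP: (c01 n x).
have Fle n x : F n x <= `|g x| by rewrite ler_piMr//; case/andP: (c01 n x).
have iF n : itg (F n) by apply: (le_itg (mF n) _ ig) => x; rewrite ger0_norm.
have cvF x : F ^~ x @ \oo --> 0.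
  apply: cvg_near_cst; near=> n; rewrite /F ccubeE ifT ?subrr ?mulr0//.
  near: n; exists (Num.bound `|x|) => // n /= hn.
  apply: ltW; apply: lt_le_trans (archi_boundP (normr_ge0 x)) _.
  by rewrite ler_nat.
have : (fun n => \int[@lebesgue_rV R N]_x (F n x)%:E)%E @ \oo --> (\int[@lebesgue_rV R N]_x (0 : \bar R))%E.
  apply: (@dominated_cvg _ _ _ _ _ measurableT _ _ (fun x => (`|g x|)%:E)).
  - by move=> n; exact/measurable_EFinP.
  - by move=> x _; apply: cvg_EFin; [exact: nearW|exact: cvF].
  - by [].
  - exact: ig.
  - by move=> n x _; rewrite /= lee_fin ger0_norm.
rewrite integral0 => /fine_cvgP[_ /cvgr_lt /(_ e e0)].
move=> [n _ /(_ n (leqnn n)) h]; exists n; apply: ltW; move: h.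
by rewrite /= -IntE.
Unshelve. all: by end_near. Qed.

Section annihilated.
Variables (g : V -> R) (y : V).
Hypotheses (cg : cls g) (g_ann : forall xi, FC g xi = 0 /\ FS g xi = 0).

(** Orthogonality to [g] is demanded of [k] times every cosine, not of [k] alone: the product-to-sum
    formula then makes the condition stable under multiplication by a further cosine. *)
Let kills k := [/\ measurable_fun setT k, (exists M : R, forall t, `|k t| <= M) &
  forall xi, Int (fun x => (cos (dotv (x - y) xi) * k (x - y)) * g x) = 0].

Let mult (c : V -> R) := forall k, kills k -> kills (fun t => c t * k t).

Let cls_kg k xi : measurable_fun setT k -> (exists M : R, forall t, `|k t| <= M) ->
  itg (fun x => (cos (dotv (x - y) xi) * k (x - y)) * g x).
Proof.
move=> mk [M hM]; have ma : measurable_fun setT (fun x : V => x - y).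
  by have := measurable_affine 1 (- y); under eq_fun do rewrite scale1r.
apply: cls_itg; apply: clsM => //.
  apply: measurable_funM; last exact: (measurableT_comp mk ma).
  exact: (measurableT_comp (measurable_cos_dotv xi) ma).
exists M => x; rewrite normrM -[leRHS]mul1r; apply: ler_pM => //; exact: cos_max.
Qed.

Let kills1 : kills (fun=> 1).
Proof.
split=> //; first by exists 1 => t; rewrite normr1.
move=> xi; have [h1 h2] := g_ann xi.
transitivity (cos (dotv y xi) * FC g xi + sin (dotv y xi) * FS g xi); last by rewrite h1 h2 !mulr0 addr0.
rewrite /FC /FS -!IntZ; [|exact/cls_itg/cls_sin|exact/cls_itg/cls_cos].
rewrite -IntD; [|exact/itgZ/cls_itg/cls_cos|exact/itgZ/cls_itg/cls_sin].
by apply: eq_Int => x; rewrite dotvDl dotvNl cosB; ring.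
Qed.

Let mult_cos l : mult (fun t => cos (dotv t l)).
Proof.
move=> k [mk [M hM] hk]; split.
- by apply: measurable_funM => //; exact: measurable_cos_dotv.
- by exists M => t; rewrite normrM -[leRHS]mul1r; apply: ler_pM => //; exact: cos_max.
move=> xi.
have bM : exists M : R, forall t, `|k t| <= M by exists M.
transitivity (2^-1 * (Int (fun x => (cos (dotv (x - y) (xi + l)) * k (x - y)) * g x) +
  Int (fun x => (cos (dotv (x - y) (xi - l)) * k (x - y)) * g x))); last by rewrite !hk addr0 mulr0.
rewrite -IntD; [|exact: cls_kg|exact: cls_kg].
rewrite -IntZ; last by apply: itgD; exact: cls_kg.
by apply: eq_Int => x; rewrite !dotvDr dotvNr cosD cosB; field.
Qed.

Let mult_prod (I : Type) (s : seq I) (c : I -> V -> R) :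
  (forall i, mult (c i)) -> mult (fun t => \prod_(i <- s) c i t).
Proof.
move=> hc; elim: s => [|i s ih] k hk.
  by rewrite (_ : (fun t => _) = k)//; apply/funext => t; rewrite big_nil mul1r.
have := hc i _ (ih _ hk).
by rewrite (_ : (fun t => _) = (fun t => \prod_(j <- i :: s) c j t * k t))//;
  apply/funext => t; rewrite big_cons mulrA.
Qed.

Lemma kernel_annihilates M (lam : R) m :
  Int (fun x => (\prod_(i < N) cosprod M (lam * (x - y) 0 i) ^+ m) * g x) = 0.
Proof.
have mc (i : 'I_N) : mult (fun t => cosprod M (lam * t 0 i)).
  apply: mult_prod => n; have := mult_cos ((lam / 2 ^+ n.+1) *: delta_mx 0 i).
  have -> : (fun t : V => cos (dotv t ((lam / 2 ^+ n.+1) *: delta_mx 0 i))) = (fun t => cos (lam * t 0 i / 2 ^+ n.+1)).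
    by apply/funext => t; rewrite dotvZr dotv_delta mulrAC.
  by [].
have mx (i : 'I_N) : mult (fun t => cosprod M (lam * t 0 i) ^+ m).
  have := mult_prod (index_enum 'I_m) (c := fun _ t => cosprod M (lam * t 0 i)) (fun _ => mc i).
  have -> : (fun t : V => \prod_(j < m) cosprod M (lam * t 0 i)) = (fun t => cosprod M (lam * t 0 i) ^+ m).
    by apply/funext => t; rewrite prodr_const card_ord.
  by [].
have [_ _ /(_ 0)] := mult_prod (index_enum 'I_N) mx kills1.
by move=> <-; apply: eq_Int => x; rewrite dotv0r cos0 mul1r mulr1.
Qed.

End annihilated.

(** A trigonometric polynomial modelled on powers of [sin u / u] and centred at [y] is orthogonal to
    [g], yet it is nonnegative and peaks at width [1 / lam]. If [g y > 0], the peak contributes at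
    least a multiple of [lam ^ - N], the middle range at most a multiple of [lam ^ - m] with
    [m > N], and the rest is the tail of an integrable function, so the integral could not
    vanish. *)
Lemma fourier_inj_pos g (y : V) : cls g ->
  (forall e : R, 0 < e -> exists2 d : R, 0 < d & forall x, `|x - y| <= d -> `|g x - g y| <= e) ->
  (forall xi, FC g xi = 0 /\ FS g xi = 0) -> g y <= 0.
Proof.
move=> cg cont ann; rewrite leNgt; apply/negP => gy.
have [d d0 hd] := cont (g y / 2) (divr_gt0 gy (ltr0Sn R 1)).
(* Even, to make the kernel nonnegative, and larger than [N], to beat the volume of the peak. [c0]
   bounds the kernel from below on the peak. *)
pose m := (N.+1).*2; pose c0 : R := (2^-1 ^+ m) ^+ N.
have c00 : 0 < c0 by rewrite !exprn_gt0// invr_gt0.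
pose G x := g (x + y); have cG : cls G by exact: cls_shift.
pose a := g y / 2 * c0 * 2 ^+ N; pose b := (2 / d) ^+ m * N1 G.
have a0 : 0 < a by apply: mulr_gt0; [apply: mulr_gt0 => //; exact: divr_gt0|exact: exprn_gt0].
have b0 : 0 <= b by apply: mulr_ge0; [apply: exprn_ge0; apply: divr_ge0 => //; exact: ltW|exact: N1_ge0].
(* Large enough for the peak to lie within distance [d], and for the middle range to cost at most
   half of the main term [a * lam ^- N]. *)
pose lam := 1 + d^-1 + 2 * b / a.
have ba0 : 0 <= 2 * b / a by apply: divr_ge0; [exact: mulr_ge0|exact: ltW].
have di0 : 0 < d^-1 by rewrite invr_gt0.
have lam1 : 1 <= lam by rewrite /lam; lra.
have lam0 : 0 < lam by lra.
have lamd : lam^-1 <= d.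
  by rewrite -[d]invrK lef_pV2 ?posrE// /lam; lra.
have lamb : b / lam <= a / 2.
  rewrite ler_pdivrMr//; apply: (@le_trans _ _ (a / 2 * (2 * b / a))).
    by rewrite le_eqVlt; apply/orP; left; apply/eqP; field; rewrite gt_eqF.
  by rewrite ler_wpM2l ?divr_ge0 ?(ltW a0)// /lam; lra.
have e0 : 0 < a / 4 * lam ^- N by rewrite mulr_gt0 ?invr_gt0 ?exprn_gt0// divr_gt0.
(* Order of the choices: [lam], then the cut [n] that leaves a tail of at most a quarter of the main
   term, then [M] so large that [cosprod_decay] applies up to [n]. *)
have [n hn] := Int_tail cG e0.
pose M := Num.bound (lam * n%:R).
have hM : lam * n%:R <= 2 ^+ M.
  apply: ltW; apply: lt_trans (archi_boundP _) _; first by rewrite mulr_ge0// ltW.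
  by rewrite -natrX ltr_nat ltn_expl.
pose k (t : V) : R := \prod_(i < N) cosprod M (lam * t 0 i) ^+ m.
have mE (u : R) : u ^+ m = (u ^+ 2) ^+ N.+1 by rewrite -exprM mul2n.
have k0 t : 0 <= k t.
  by apply: prodr_ge0 => i _; rewrite mE exprn_ge0// sqr_ge0.
have f01 (t : V) (i : 'I_N) : 0 <= cosprod M (lam * t 0 i) ^+ m <= 1.
  rewrite mE exprn_ge0 ?sqr_ge0//= exprn_ile1 ?sqr_ge0//.
  by rewrite -real_normK ?num_real// exprn_ile1// cosprod_le1.
have k1 t : k t <= 1 by apply: prodr_ile1 => i _; exact: f01.
have mk : measurable_fun setT k.
  rewrite (_ : k = (fun t => \prod_(i <- index_enum 'I_N) cosprod M (lam * t 0 i) ^+ m))//.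
  elim: (index_enum _) => [|i s ih].
    under eq_fun do rewrite big_nil; exact: measurable_cst.
  under eq_fun do rewrite big_cons.
  apply: measurable_funM => //; apply: measurable_funX.
  apply: (@measurable_prod _ _ _ _ _ (index_enum 'I_M) (fun (j : 'I_M) (t : V) => cos (lam * t 0 i / 2 ^+ j.+1))) => j _.
  apply: (measurableT_comp (f := @cos R)).
    by apply: continuous_measurable_fun; exact: continuous_cos.
  by apply: measurable_funM => //; apply: measurable_funM => //; exact: measurable_coord.
have igk : itg (fun t => k t * G t).
  apply: cls_itg; apply: clsM => //; exists 1 => t; rewrite ger0_norm//; exact: k1.
have zero : Int (fun t => k t * G t) = 0.
  rewrite -(Int_shift (- y) igk) -(kernel_annihilates y cg ann M lam m).
  by apply: eq_Int => x; rewrite /G subrK.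
pose A : R := (2 / (lam * d)) ^+ m.
have li0 : 0 < lam^-1 by rewrite invr_gt0.
have [ic1 ic2] := itg_ccube N li0.
have iG := cls_itg (cls_norm cG).
have it : itg (fun t => `|G t| * (1 - ccube n%:R t)).
  apply: (le_itg _ _ iG) => [|t].
    apply: measurable_funM; first by apply: measurableT_comp => //; exact: cls_meas cG.
    by apply: measurable_funB => //; exact: measurable_ccube.
  by rewrite normrM normr_id ler_piMr// ccubeE; case: ifP => _; rewrite ?subrr ?subr0 ?normr0 ?normr1.
have A0 : 0 <= A by rewrite exprn_ge0// divr_ge0// mulr_ge0// ltW.
have lower t : (g y / 2 * c0) * ccube lam^-1 t - A * `|G t| - `|G t| * (1 - ccube n%:R t) <= k t * G t.
  have G0 := normr_ge0 (G t).
  have far0 : 0 <= `|G t| * (1 - ccube n%:R t).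
    by rewrite mulr_ge0// ccubeE; case: ifP => _; lra.
  have AG0 : 0 <= A * `|G t| by exact: mulr_ge0.
  have near : `|t| <= d -> g y / 2 <= G t.
    move=> td; have := hd (t + y); rewrite addrK => /(_ td).
    by rewrite ler_norml -/(G t) => /andP[h _]; lra.
  have [t1|t1] := leP `|t| lam^-1.
    have Gt := near (le_trans t1 lamd).
    apply: (@le_trans _ _ (g y / 2 * c0)).
      by rewrite ccubeE t1 mulr1; lra.
    rewrite mulrC; apply: ler_pM => //; [exact: ltW|by rewrite divr_ge0// ltW|].
    rewrite /c0 /k -[N in X in X <= _](card_ord N) -prodr_const; apply: ler_prod => i _.
    rewrite exprn_ge0 ?invr_ge0//=; apply: lerXn2r; rewrite ?nnegrE ?invr_ge0//.
      by apply: le_trans (cosprod_ge_half _ _); rewrite ?invr_ge0//; rewrite normrM gtr0_norm// mulrC -ler_pdivlMr// mul1r (le_trans (coord_le_norm _ _)).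
    by apply: cosprod_ge_half; rewrite normrM gtr0_norm// mulrC -ler_pdivlMr// mul1r (le_trans (coord_le_norm _ _)).
  have -> : ccube lam^-1 t = 0 by rewrite ccubeE leNgt t1.
  rewrite mulr0 sub0r.
  have [td|td] := leP `|t| d.
    have Gt := near td; have : 0 <= k t * G t.
      by rewrite mulr_ge0//; apply: le_trans Gt; rewrite divr_ge0// ltW.
    by move: (k t * _) => z; lra.
  have kG : - (k t * `|G t|) <= k t * G t.
    by rewrite -mulrN ler_wpM2l// lerNl ler_normr lexx orbT.
  apply: le_trans kG.
  have [tn|tn] := leP `|t| n%:R; last first.
    have -> : ccube n%:R t = 0 by rewrite ccubeE leNgt tn.
    rewrite subr0 mulr1; have : k t * `|G t| <= `|G t| by rewrite ler_piMl.
    by move: (k t * _) => z; lra.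
  have -> : ccube n%:R t = 1 by rewrite ccubeE tn.
  rewrite subrr mulr0 subr0 lerN2 ler_wpM2r//.
  (* One coordinate exceeds [d]; its factor alone gives the decay, and the others are at most 1. *)
  have [i hi] : exists i, d < `|t 0 i|.
    apply: contrapT => /forallNP h; move: td; rewrite ltNge => /negP; apply.
    by apply/norm_leP; [exact: ltW|move=> i; rewrite leNgt; apply/negP/h].
  rewrite /k (bigD1 i)//=.
  have rest : \prod_(j < N | j != i) cosprod M (lam * t 0 j) ^+ m <= 1.
    by apply: prodr_ile1 => j _; exact: f01.
  have /andP[fi0 _] := f01 t i.
  apply: (@le_trans _ _ (cosprod M (lam * t 0 i) ^+ m)); first by rewrite ler_piMr.
  have E2 (u : R) : u ^+ m = `|u| ^+ m by rewrite mE -real_normK ?num_real// -exprM mul2n.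
  rewrite E2 /A; apply: lerXn2r; rewrite ?nnegrE// ?divr_ge0 ?mulr_ge0 ?(ltW lam0) ?(ltW d0)//.
  rewrite ler_pdivlMr ?mulr_gt0//.
  have hh : `|lam * t 0 i| <= 2 ^+ M.
    rewrite normrM gtr0_norm//; apply: le_trans hM; rewrite ler_wpM2l ?(ltW lam0)//.
    exact: le_trans (coord_le_norm _ _) tn.
  apply: le_trans (cosprod_decay hh); rewrite ler_wpM2l// normrM gtr0_norm//; apply: ler_wpM2l; exact: ltW.
have i1 := itgZ (g y / 2 * c0) ic1; have i2 := itgZ A iG.
have : Int (fun t => (g y / 2 * c0) * ccube lam^-1 t - A * `|G t| - `|G t| * (1 - ccube n%:R t)) <= 0.
  by rewrite -zero; apply: le_Int => //; apply: itgB => //; exact: itgB.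
rewrite IntB//; last exact: itgB.
rewrite IntB// !IntZ// ic2 -/(N1 G).
have -> : g y / 2 * c0 * (2 / lam) ^+ N = a * lam ^- N by rewrite /a exprMn exprVn; ring.
have AE : A * N1 G <= b / lam * lam ^- N.
  have -> : A * N1 G = b * lam ^- m.
    by rewrite /A /b (_ : 2 / (lam * d) = 2 / d / lam) 1?exprMn ?exprVn; [ring|field; rewrite !gt_eqF].
  have hm : lam ^- m <= lam^-1 * lam ^- N.
    rewrite -invfM -exprS lef_pV2 ?posrE ?exprn_gt0//.
    by apply: ler_weXn2l => //; rewrite /m -addnn leq_addr.
  by rewrite -mulrA; apply: ler_wpM2l.
have l0 : 0 < lam ^- N by rewrite invr_gt0 exprn_gt0.
have := ler_wpM2r (ltW l0) lamb; have := mulr_gt0 a0 l0.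
move: hn AE; set tl := Int _; move: (A * N1 G) (b / lam * lam ^- N) => x z.
rewrite [a / 2 * _]mulrAC [a / 4 * _]mulrAC; move: (a * lam ^- N) tl => w tl; clear; lra.
Qed.

Lemma fourier_inj g : cls g -> even_fun g -> (exists C : R, forall x z, `|g (x + z) - g x| <= C * `|z|) ->
  (forall xi, FC g xi = 0) -> forall y, g y = 0.
Proof.
move=> cg eg [C hC] gC y.
have cont (f : V -> R) (D : R) : (forall x z, `|f (x + z) - f x| <= D * `|z|) -> forall e : R, 0 < e ->
    exists2 d : R, 0 < d & forall x : V, `|x - y| <= d -> `|f x - f y| <= e.
  move=> hD e e0; exists (e / (`|D| + 1)); first by rewrite divr_gt0// ltr_wpDl.
  move=> x; rewrite ler_pdivlMr ?ltr_wpDl// => h; apply: le_trans h.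
  have := hD y (x - y); rewrite [y + _]addrC subrK => /le_trans; apply.
  by rewrite mulrC ler_wpM2l// (le_trans (ler_norm _))// lerDl.
have cn : cls (fun x => - g x) by apply: (eq_cls _ (clsZ (-1) cg)) => x; rewrite mulN1r.
apply/eqP; rewrite eq_le; apply/andP; split.
  apply: (fourier_inj_pos cg (cont g C hC)) => xi.
  by rewrite gC FS_even.
rewrite -oppr_le0; apply: (fourier_inj_pos (g := fun x => - g x) cn).
  by apply: (cont _ C) => x z; rewrite -opprD normrN; exact: hC.
move=> xi; split; last by apply: FS_even => // x; rewrite eg.
rewrite /FC; under eq_Int do rewrite mulrN -mulN1r.
by rewrite IntZ; [rewrite -/(FC g xi) gC mulr0|exact/cls_itg/cls_cos].
Qed.

End fourier_injectivity.
(** * Construction of the Littlewood-Paley pair *)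

Section littlewood_paley_pair.
Variables (R : realType) (N : nat).
Local Notation V := 'rV[R]_N.
Implicit Types (g h k : V -> R).

Lemma eucl_scale (a : R) (x : V) : eucl (a *: x) = `|a| * eucl x.
Proof.
rewrite /eucl dotvZl dotvZr mulrA -expr2 sqrtrM ?sqr_ge0//.
by rewrite sqrtr_sqr.
Qed.

Lemma eucl_opp (x : V) : eucl (- x) = eucl x.
Proof. by rewrite -scaleN1r eucl_scale normrN1 mul1r. Qed.

Lemma FC_opp g xi : FC g (- xi) = FC g xi.
Proof. by apply: eq_Int => x; rewrite dotvNr cosN. Qed.

Lemma FS_opp g xi : cls g -> FS g (- xi) = - FS g xi.
Proof.
move=> cg; rewrite -mulN1r -IntZ; last exact/cls_itg/cls_sin.
by apply: eq_Int => x; rewrite dotvNr sinN mulN1r mulNr.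
Qed.

Lemma fourier_Re (f : V -> R[i]) xi :
  cls (fun x => complex.Re (f x)) -> cls (fun x => complex.Im (f x)) ->
  complex.Re (fourier f xi) = FC (fun x => complex.Re (f x)) xi + FS (fun x => complex.Im (f x)) xi.
Proof.
move=> cr ci; rewrite /FC /FS -IntD; [|exact/cls_itg/cls_cos|exact/cls_itg/cls_sin].
rewrite Int.unlock /fourier /cintegral /=; apply: eq_Rintegral => x _.
case: (f x) => a b /=; rewrite cosN sinN; ring.
Qed.

Lemma fourier_Re_even (f : V -> R[i]) xi :
  cls (fun x => complex.Re (f x)) -> cls (fun x => complex.Im (f x)) ->
  FC (fun x => complex.Re (f x)) xi =
  2^-1 * (complex.Re (fourier f xi) + complex.Re (fourier f (- xi))).
Proof.
by move=> cr ci; rewrite !fourier_Re// FC_opp FS_opp//; field.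
Qed.

(** Pointwise, unlike [lip]; it supplies the continuity that injectivity of the transform
    requires. *)
Definition plip g := exists C : R, forall x z, `|g (x + z) - g x| <= C * `|z|.

Lemma plip_sub g h : plip g -> plip h -> plip (fun x => g x - h x).
Proof.
move=> [C hC] [D hD]; exists (C + D) => x z.
have -> : g (x + z) - h (x + z) - (g x - h x) = (g (x + z) - g x) - (h (x + z) - h x) by ring.
by apply: le_trans (ler_normB _ _) _; rewrite mulrDl; exact: lerD.
Qed.

Lemma plip_dil g (a : R) : plip g -> plip (dil a g).
Proof.
move=> [C hC]; exists (`|a| ^+ N * (C * `|a|)) => x z.
rewrite /dil scalerDr -mulrBr normrM normrX -mulrA; apply: ler_wpM2l; first exact: exprn_ge0.
by apply: le_trans (hC _ _) _; rewrite normrZ mulrA.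
Qed.

Lemma plip_schwartz g : real_schwartz g -> plip g.
Proof.
move=> sg; have [C C0 hC] := schwartz_diff_le sg.
have [D D0 hD] := schwartz_decay sg [::] 0.
have gD x : `|g x| <= D by have := hD x; rewrite /weight expr0 invr1 mulr1.
exists (C + 2 * D) => x z; have z0 := normr_ge0 z; have [z1|z1] := leP `|z| 1.
  apply: (le_trans (hC x z z1)); rewrite [(C + _) * _]mulrDl; apply: (@le_trans _ _ (C * `|z|)).
    by apply: ler_piMr; [exact: mulr_ge0|exact: weight_le1].
  by rewrite lerDl; apply: mulr_ge0 => //; exact: mulr_ge0.
apply: (@le_trans _ _ (2 * D)).
  by apply: le_trans (ler_normB _ _) _; have := gD x; have := gD (x + z); lra.
rewrite [(C + _) * _]mulrDl; apply: (@le_trans _ _ (2 * D * `|z|)); last by rewrite lerDr; exact: mulr_ge0.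
by apply: ler_peMr; [exact: mulr_ge0|exact: ltW].
Qed.

Lemma plip_conv g k (L : R) : cls g -> cls k -> lip L g -> plip (conv g k).
Proof.
move=> cg ck hL; have [_ [M hM] _] := ck.
have M0 : 0 <= M by exact: le_trans (normr_ge0 _) (hM 0).
exists (M * L) => x z; rewrite -mulrA.
have cf := cls_fdiff z cg.
have -> : conv g k (x + z) - conv g k x = conv (fdiff z g) k x.
  by rewrite (conv_fdiffl z cg (cls_itg ck)).
rewrite (convC cf ck) /conv /avg.
apply: le_trans (Int_norm (itg_conv1 x ck (cls_itg cf))) _.
apply: (@le_trans _ _ (M * N1 (fdiff z g))); last by rewrite ler_wpM2l//; exact: hL.
rewrite /N1 -IntZ; last exact/cls_itg/cls_norm.
apply: le_Int; [exact/itg_norm/itg_conv1/cls_itg|exact/itgZ/cls_itg/cls_norm|].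
by move=> y; rewrite normrM mulrC ler_wpM2r.
Qed.

Lemma even_conv g k : cls g -> cls k -> even_fun g -> even_fun k -> even_fun (conv g k).
Proof.
move=> cg ck eg ek x; rewrite /conv /avg -[LHS](Int_reflect 0); last exact: itg_conv1 (cls_itg ck).
apply: eq_Int => y; rewrite sub0r ek opprK; congr (_ * _).
by rewrite -(eg (x - y)) opprB addrC.
Qed.

Lemma even_dil g (a : R) : even_fun g -> even_fun (dil a g).
Proof. by move=> eg x; rewrite /dil scalerN eg. Qed.

Lemma even_sub g h : even_fun g -> even_fun h -> even_fun (fun x => g x - h x).
Proof. by move=> eg eh x; rewrite eg eh. Qed.

(** [eta0] is complex and without symmetry, so [phi] is the even part of its real part. The cosine
    transform of [phi] is then the even part of the real part of the Fourier transform of [eta0],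
    which keeps the values 1 and 0 on their regions. The convolution identities are checked on
    cosine transforms and brought back by injectivity. *)
Lemma lp_pair_exists (eta : V -> R) : littlewood_paley_kernel eta ->
  exists2 phi : V -> R, lp_pair eta phi & forall m, exists2 C : R, 0 <= C & forall x, `|phi x| <= C * weight m x.
Proof.
move=> [se ee [eta0 [[sr si] F1 F0 FE]]].
pose r x := complex.Re (eta0 x).
have cr : cls r := schwartz_cls sr; have ci := schwartz_cls si.
have ce := schwartz_cls se.
pose phi x := 2^-1 * (r x + r (- x)).
have clsN g : cls g -> cls (fun x => g (- x)).
  move=> cg; have h : -1 != 0 :> R by rewrite oppr_eq0 oner_neq0.
  by apply: (eq_cls _ (cls_affine 0 h cg)) => x; rewrite scaleN1r addr0.
have crN := clsN _ cr.
have cp : cls phi by apply/clsZ/clsD.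
have ep : even_fun phi by move=> x; rewrite /phi opprK addrC.
have FCphi xi : FC phi xi = 2^-1 * (complex.Re (fourier eta0 xi) + complex.Re (fourier eta0 (- xi))).
  rewrite -fourier_Re_even// -/r.
  have i1 := cls_itg (cls_cos xi cr); have i2 := cls_itg (cls_cos xi crN).
  have e : FC (fun x => r (- x)) xi = FC r xi.
    rewrite /FC -[RHS](Int_reflect 0 i1); apply: eq_Int => x.
    by rewrite sub0r dotvNl cosN.
  transitivity (2^-1 * (FC r xi + FC (fun x => r (- x)) xi)); last by rewrite e; field.
  rewrite /FC -IntD// -IntZ; last exact: itgD.
  by apply: eq_Int => x; rewrite /phi; ring.
have phi1 xi : eucl xi <= 1 -> FC phi xi = 1.
  by move=> h; rewrite FCphi !F1 ?eucl_opp//=; field.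
have phi0 xi : 2 <= eucl xi -> FC phi xi = 0.
  by move=> h; rewrite FCphi !F0 ?eucl_opp//= addr0 mulr0.
have FCeta xi : FC eta xi = FC phi xi - FC phi (2 *: xi).
  have c0 : cls (fun x : V => complex.Im ((eta x)%:C%C)) by exact: (eq_cls _ (cls0 R N)).
  have := @fourier_Re_even (fun x => (eta x)%:C%C) xi ce c0.
  rewrite (_ : FC _ xi = FC eta xi)// => ->; rewrite !FE !FCphi scalerN.
  case: (fourier eta0 xi) => a1 b1; case: (fourier eta0 (- xi)) => a2 b2.
  case: (fourier eta0 (2 *: xi)) => a3 b3; case: (fourier eta0 (- (2 *: xi))) => a4 b4 /=.
  by ring.
have pr := plip_schwartz sr; have pe := plip_schwartz se.
have h2 : 0 < 2^-1 :> R by rewrite invr_gt0.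
have h4 : 0 < 4^-1 :> R by rewrite invr_gt0.
have e2 : 2^-1^-1 = 2 :> R by rewrite invrK.
have e4 : 4^-1^-1 = 4 :> R by rewrite invrK.
have pp : plip phi.
  have [C hC] := pr; exists (2^-1 * (C + C)) => x z.
  have -> : phi (x + z) - phi x = 2^-1 * ((r (x + z) - r x) + (r (- x - z) - r (- x))).
    by rewrite /phi opprD; ring.
  rewrite normrM gtr0_norm// -mulrA; apply: ler_wpM2l; first exact: ltW.
  apply: le_trans (ler_normD _ _) _; rewrite mulrDl; apply: lerD; first exact: hC.
  by have := hC (- x) (- z); rewrite normrN.
have decay m : exists2 C : R, 0 <= C & forall x, `|phi x| <= C * weight m x.
  have [C C0 hC] := schwartz_decay sr [::] m; exists C => // x.
  have a1 := hC x; have a2 := hC (- x).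
  have wN : weight m (- x) = weight m x by rewrite /weight normrN.
  rewrite wN in a2; rewrite /phi normrM gtr0_norm//.
  have a3 : `|r x + r (- x)| <= C * weight m x + C * weight m x.
    by apply: le_trans (ler_normD _ _) _; exact: lerD.
  by rewrite ler_pdivrMl//; apply: le_trans a3 _; rewrite mulr2n mulrDl mul1r.
have [L0 L00 hL0] := schwartz_lip sr; have [Le Le0 hLe] := schwartz_lip se.
have lipp : lip L0 phi.
  move=> z; have crf := cls_fdiff z cr; have crfN := cls_fdiff (- z) cr.
  apply: (@le_trans _ _ (Int (fun x => 2^-1 * `|fdiff z r x| + 2^-1 * `|fdiff (- z) r (- x)|))).
    have i1 : itg (fun x => 2^-1 * `|fdiff z r x|) by apply/itgZ/cls_itg/cls_norm.
    have i2 : itg (fun x => 2^-1 * `|fdiff (- z) r (- x)|).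
      by apply/itgZ/cls_itg; apply: (clsN (fun x => `|fdiff (- z) r x|)); exact: cls_norm.
    apply: le_Int; [exact/cls_itg/cls_norm/cls_fdiff|exact: itgD|].
    move=> x; rewrite -mulrDr -[X in X * (_ + _)]gtr0_norm// /fdiff /phi.
    have -> : 2^-1 * (r (x + z) + r (- (x + z))) - 2^-1 * (r x + r (- x)) =
      2^-1 * ((r (x + z) - r x) + (r (- x - z) - r (- x))) by rewrite opprD; ring.
    by rewrite normrM ler_wpM2l// ler_normD.
  have cN := clsN _ (cls_norm crfN).
  rewrite IntD; [|exact/itgZ/cls_itg/cls_norm|exact/itgZ/cls_itg].
  rewrite !IntZ; [|exact: cls_itg|exact/cls_itg/cls_norm].
  have -> : Int (fun x => `|fdiff (- z) r (- x)|) = N1 (fdiff (- z) r).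
    rewrite /N1 -[RHS](Int_reflect 0); last exact/cls_itg/cls_norm.
    by apply: eq_Int => x; rewrite sub0r.
  have a1 := hL0 z; have a2 := hL0 (- z); rewrite normrN in a2.
  rewrite -mulrDr ler_pdivrMl//; apply: le_trans (lerD a1 a2) _.
  by rewrite mulr2n mulrDl mul1r.
have momp : mom phi.
  have [C C0 hC] := decay N.+2.
  have mm : measurable_fun setT (fun x : V => `|x| * `|phi x|).
    apply: measurable_funM; first exact: measurable_norm_rV.
    by apply: measurableT_comp => //; exact: cls_meas cp.
  apply: (le_itg mm _ (itgZ C (itg_weight R N))) => x.
  rewrite normrM !normr_id; apply: (@le_trans _ _ (`|x| * (C * weight N.+2 x))).
    by rewrite ler_wpM2l//; exact: hC.
  by rewrite mulrCA ler_wpM2l// mulrC weightS.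
have c2 := cls_dil h2 cp; have c4 := cls_dil h4 cp; have cd := cls_dil (ltr0Sn R 1) cp.
have cfat : cls (fat phi) by exact: clsB.
have efat : even_fun (fat phi) by apply: even_sub; exact: even_dil.
have FCfat xi : FC (fat phi) xi = FC phi (2^-1 *: xi) - FC phi (4 *: xi).
  by rewrite /fat FC_sub// !FC_dil// e4.
have FCeta0 xi : eucl xi <= 2^-1 -> FC eta xi = 0.
  move=> h; rewrite FCeta !phi1 ?subrr//; last by lra.
  by rewrite eucl_scale ger0_norm//; lra.
exists phi => //; split=> //.
- by exists L0.
- move=> x; apply/eqP; rewrite -subr_eq0; apply/eqP.
  apply: (@fourier_inj _ _ (fun x => eta x - (phi x - dil 2^-1 phi x))).
  + by apply: clsB => //; exact: clsB.
  + by apply: even_sub => //; apply: even_sub => //; exact: even_dil.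
  + by apply: plip_sub => //; apply: plip_sub => //; exact: plip_dil.
  move=> xi; rewrite FC_sub//; last exact: clsB.
  by rewrite FC_sub// FC_dil// e2 FCeta subrr.
- apply/funext => x; apply/eqP; rewrite -subr_eq0; apply/eqP.
  have cc : cls (conv eta (fat phi)) by apply: cls_conv => //; exact: cls_itg.
  apply: (@fourier_inj _ _ (fun x => conv eta (fat phi) x - eta x)).
  + exact: clsB.
  + by apply: even_sub => //; exact: even_conv.
  + by apply: plip_sub => //; exact: (plip_conv ce cfat hLe).
  move=> xi; rewrite FC_sub// FC_conv// FCfat.
  (* Outside [1/2 < |xi| < 2] the transform of [eta] vanishes; inside, that of the fat kernel is
     [1 - 0], because [|xi / 2| <= 1] and [|4 xi| >= 2]. *)
  have [h|h] := leP (eucl xi) 2^-1; first by rewrite FCeta0// mul0r subrr.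
  have [h'|h'] := leP 2 (eucl xi).
    rewrite (_ : FC eta xi = 0) ?mul0r ?subrr//.
    by rewrite FCeta !phi0 ?subrr// eucl_scale ger0_norm//; lra.
  rewrite phi1; last by rewrite eucl_scale gtr0_norm//; lra.
  rewrite phi0; last by rewrite eucl_scale gtr0_norm//; lra.
  by rewrite subr0 mulr1 subrr.
(* Disjoint frequency supports: the transform of [dil a eta] vanishes for [|xi| <= a / 2], where
   [a / 2 >= 2], and that of [phi] for [|xi| >= 2]. *)
- move=> a x a4; have a0 : 0 < a by lra.
  have cda := cls_dil a0 ce.
  apply: (@fourier_inj _ _ (conv (dil a eta) phi)).
  + by apply: cls_conv => //; exact: cls_itg.
  + by apply: even_conv => //; exact: even_dil.
  + exact: (plip_conv cda cp (fun z => lip_dil z a0 ce hLe)).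
  move=> xi; rewrite FC_conv//; last exact: even_dil.
  rewrite FC_dil//; have [h|h] := leP 2 (eucl xi); first by rewrite phi0// mulr0.
  rewrite FCeta0 ?mul0r// eucl_scale gtr0_norm ?invr_gt0// ler_pdivrMl//.
  by apply: ltW; apply: lt_le_trans h _; lra.
have : FC phi 0 = 1 by apply: phi1; rewrite /eucl dotv0r sqrtr0.
by move=> <-; apply: eq_Int => x; rewrite dotv0r cos0 mul1r.
Qed.

End littlewood_paley_pair.
(** * Scale weights *)

Section scale_weights.
Variable R : realType.
Implicit Types (s q t x a b : R).

Lemma one_sub_half_pow_le x : 0 <= x -> 1 - 2^-1 `^ x <= x.
Proof.
move=> x0; have [x1|x1] := leP 1 x.
  by apply: le_trans x1; rewrite gerBl powR_ge0.
have [->|xn0] := eqVneq x 0; first by rewrite powRr0 subrr.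
have xp : 0 < x by rewrite lt_neqAle eq_sym xn0.
have h : 2 `^ x <= 1 + x.
  have x01 : 0 < x <= 1 by rewrite xp ltW.
  have := powR_bernoulli_concave x01 (ler0n R 2); lra.
have E : 2^-1 `^ x = (2 `^ x)^-1 by rewrite -powR_inv1// -powRrM mulN1r powRN.
have P : 0 < 2 `^ x by rewrite powR_gt0.
have h2 : (1 + x)^-1 <= 2^-1 `^ x by rewrite E lef_pV2 ?posrE//; lra.
have h3 : 1 - x <= (1 + x)^-1.
  have p1 : 0 < 1 + x by lra.
  rewrite -[leRHS]mul1r ler_pdivlMr//; have : 0 <= x * x by exact: mulr_ge0.
  move: (x * x) (erefl ((1 - x) * (1 + x))) => y; rewrite (_ : (1 - x) * (1 + x) = 1 - x * x); last by ring.
  by move=> _ _; rewrite gerBl mulr_ge0.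
lra.
Qed.

(** With the preceding lemma, [1 - 2 ^ - x] is comparable to [x] on [(0, q]]; this is what turns
    limits of geometric series into [1 / s] and [1 / (1 - s)]. *)
Lemma one_sub_half_pow_ge q x : 1 <= q -> 0 < x <= q -> x / (2 * q) <= 1 - 2^-1 `^ x.
Proof.
move=> q1 /andP[x0 xq]; have q0 : 0 < 2 * q by lra.
have h0 : 0 <= 2^-1 :> R by rewrite invr_ge0.
have [x1|x1] := leP x 1.
  have x01 : 0 < x <= 1 by rewrite x0.
  have h := powR_bernoulli_concave x01 h0.
  apply: (@le_trans _ _ (x / 2)); last by lra.
  by rewrite ler_pM2l// lef_pV2 ?posrE//; lra.
apply: (@le_trans _ _ 2^-1); first by rewrite ler_pdivrMr//; lra.
have : 2^-1 `^ x <= 2^-1 `^ 1.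
  by apply: ger_powR; [apply/andP; split; [rewrite invr_gt0|]; lra|exact: ltW].
by rewrite powRr1//; lra.
Qed.

(* [t ^ ((1 - s) q)] for [t <= 1] and [t ^ (- s q)] for [t >= 1] *)
Definition scale_weight s q t := Num.min 1 t `^ q * t `^ (- (s * q)).

Lemma scale_weight_gt0 s q t : 0 < t -> 0 < scale_weight s q t.
Proof. by move=> t0; rewrite mulr_gt0 ?powR_gt0// lt_min ltr01. Qed.

Lemma scale_weightE s q (i k : nat) : scale_weight s q (2 ^+ i / 2 ^+ k) =
  if (k <= i)%N then (2^-1 `^ (s * q)) ^+ (i - k) else (2^-1 `^ ((1 - s) * q)) ^+ (k - i).
Proof.
have P m : (0 : R) < 2 ^+ m by rewrite exprn_gt0.
have h0 : 0 <= 2^-1 :> R by rewrite invr_ge0.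
have hn0 : 2^-1 != 0 :> R by rewrite invr_eq0.
rewrite /scale_weight; case: leqP => ki.
  have -> : 2 ^+ i / 2 ^+ k = 2 ^+ (i - k) :> R.
    by rewrite -{1}(subnK ki) exprD mulfK ?gt_eqF.
  rewrite min_l; last by apply: exprn_ege1; lra.
  rewrite powR1 mul1r -(powR_mulrn (i - k) (powR_ge0 _ _)) -(powR_mulrn (i - k) (ler0n R 2)).
  rewrite -[in RHS](powR_inv1 (ler0n R 2)) -!powRrM.
  by congr (_ `^ _); ring.
have -> : 2 ^+ i / 2 ^+ k = 2^-1 ^+ (k - i) :> R.
  by rewrite -{1}(subnK (ltnW ki)) exprD invfM mulrCA mulfV ?gt_eqF// mulr1 exprVn.
rewrite min_r; last by apply: exprn_ile1 => //; lra.
rewrite -(powR_mulrn (k - i) (powR_ge0 _ _)) -(powR_mulrn (k - i) h0) -!powRrM -powRD ?hn0 ?implybT//.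
by congr (_ `^ _); ring.
Qed.

Lemma half_pow_lt1 x : 0 < x -> 0 <= 2^-1 `^ x < 1.
Proof.
move=> x0; rewrite powR_ge0 /=.
have m1 : 1 <= Num.max 1 x by rewrite le_max lexx.
have mx : 0 < x <= Num.max 1 x by rewrite x0 le_max lexx orbT.
have := one_sub_half_pow_ge m1 mx.
have : 0 < x / (2 * Num.max 1 x) by rewrite divr_gt0 ?mulr_gt0 ?(lt_le_trans ltr01 m1).
lra.
Qed.

(* comparable to [1 / s + 1 / (1 - s)] *)
Definition scale_sum s q := (1 - 2^-1 `^ (s * q))^-1 + (1 - 2^-1 `^ ((1 - s) * q))^-1.

Section sums.
Variables (s q : R).
Hypotheses (s01 : 0 < s < 1) (q1 : 1 <= q).
Let r1 := 2^-1 `^ (s * q).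
Let r2 := 2^-1 `^ ((1 - s) * q).

Let s0 : 0 < s. Proof. by case/andP: s01. Qed.
Let s1 : 0 < 1 - s. Proof. by rewrite subr_gt0; case/andP: s01. Qed.
Let q0 : 0 < q. Proof. exact: lt_le_trans q1. Qed.
Let r1b : 0 <= r1 < 1. Proof. by apply: half_pow_lt1; exact: mulr_gt0. Qed.
Let r2b : 0 <= r2 < 1. Proof. by apply: half_pow_lt1; exact: mulr_gt0. Qed.

Lemma scale_sum_gt0 : 0 < scale_sum s q.
Proof.
have /andP[_ a1] := r1b; have /andP[_ a2] := r2b.
by rewrite addr_gt0// invr_gt0 subr_gt0.
Qed.

Lemma scale_sum_ge : (s^-1 + (1 - s)^-1) / q <= scale_sum s q.
Proof.
have /andP[_ a1] := r1b; have /andP[_ a2] := r2b.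
rewrite mulrDl; apply: lerD; rewrite -invfM lef_pV2 ?posrE ?subr_gt0 ?mulr_gt0//.
  by apply: one_sub_half_pow_le; rewrite ltW// mulr_gt0.
by apply: one_sub_half_pow_le; rewrite ltW// mulr_gt0.
Qed.

Lemma scale_sum_le : scale_sum s q <= 2 * (s^-1 + (1 - s)^-1).
Proof.
have /andP[_ a1] := r1b; have /andP[_ a2] := r2b.
have H x : 0 < x -> x <= 1 -> (1 - 2^-1 `^ (x * q))^-1 <= 2 * x^-1.
  move=> x0 x1.
  have hx : 0 < x * q <= q by rewrite mulr_gt0//= -[leRHS]mul1r ler_wpM2r// ltW.
  have h := one_sub_half_pow_ge q1 hx.
  have -> : 2 * x^-1 = (x * q / (2 * q))^-1 by field; rewrite !gt_eqF//; lra.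
  have P : 0 < x * q / (2 * q) by rewrite divr_gt0 ?mulr_gt0.
  by rewrite lef_pV2 ?posrE// (lt_le_trans P).
rewrite mulrDr; apply: lerD; apply: H => //; first [exact: s0|exact: s1|case/andP: s01 => a b; move: a b; move=> *; lra].
Qed.

Lemma scale_weight_row_sum M n k :
  \sum_(j < n) scale_weight s q (2 ^+ (j + M) / 2 ^+ k) <= scale_sum s q.
Proof.
have /andP[r10 _] := r1b; have /andP[r20 _] := r2b.
(* Distinct indices have distinct exponents, so the sum is part of one geometric series; grouping
   the indices by exponent makes this precise. *)
have gen n' (P : nat -> bool) (F : nat -> nat) (r : R) : 0 <= r < 1 ->
    (forall i j, (i < j)%N -> P i -> P j -> F i != F j) ->
    \sum_(j < n') (if P j then r ^+ F j else 0) <= (1 - r)^-1.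
  move=> r01 inj; have /andP[r0 _] := r01.
  pose B := (\max_(j < n') F j).+1.
  apply: le_trans (geometric_partial B r01); rewrite big_mkord.
  have -> : \sum_(j < n') (if P j then r ^+ F j else 0) =
      \sum_(b < B) \sum_(j < n' | P j && (F j == b)) r ^+ b.
    rewrite -big_mkcond /= (partition_big (fun j : 'I_n' => inord (F j) : 'I_B) xpredT) //=.
    apply: eq_bigr => b _; apply: eq_big => [j|j].
      congr (_ && _); rewrite -(inj_eq val_inj) /= inordK// /B ltnS.
      exact: (leq_bigmax j).
    move=> /andP[_ /eqP <-]; rewrite inordK// /B ltnS; exact: (leq_bigmax j).
  apply: ler_sum => b _.
  case: (pickP (fun j : 'I_n' => P j && (F j == b))) => [j0 /andP[Pj0 /eqP Fj0]|none]; last first.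
    by rewrite big_pred0 ?exprn_ge0.
  rewrite (big_pred1 j0)// => j; apply/idP/eqP => [/andP[Pj /eqP Fj]|->]; last by rewrite Pj0 Fj0 eqxx.
  apply: val_inj; apply/eqP; case: ltngtP => // jj.
    by have := inj _ _ jj Pj Pj0; rewrite Fj Fj0 eqxx.
  by have := inj _ _ jj Pj0 Pj; rewrite Fj Fj0 eqxx.
have -> : \sum_(j < n) scale_weight s q (2 ^+ (j + M) / 2 ^+ k) =
  \sum_(j < n) (if (k <= j + M)%N then r1 ^+ (j + M - k) else 0) +
  \sum_(j < n) (if (j + M < k)%N then r2 ^+ (k - (j + M)) else 0).
  rewrite -big_split; apply: eq_bigr => j _; rewrite scale_weightE /=.
  by case: leqP => h; rewrite ?addr0 ?add0r.
apply: lerD.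
  apply: (gen n (fun j => (k <= j + M)%N) (fun j => (j + M - k)%N)) => // i j ij h1 h2.
  by apply/eqP => /(congr1 (addn^~ k)); rewrite !subnK// => /addIn e; rewrite e ltnn in ij.
apply: (gen n (fun j => (j + M < k)%N) (fun j => (k - (j + M))%N)) => // i j ij h1 h2.
apply/eqP => e; have : (k - (k - (i + M)) = k - (k - (j + M)))%N by rewrite e.
by rewrite !subKn 1?ltnW// => /addIn e'; rewrite e' ltnn in ij.
Qed.

(** A partial geometric sum reaches half of its limit once the power has fallen below 1/2. How long
    this takes depends on [s], and so does [M]; but [M] only says how many scales to keep on either
    side of [i], and does not enter the constant. *)
Lemma scale_weight_col_sum : exists M : nat, (2 <= M)%N /\ forall n i, (M <= i)%N -> (i + M < n)%N ->
  2^-1 `^ (q + 1) * scale_sum s q <= \sum_(k < n) scale_weight s q (2 ^+ i / 2 ^+ k).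
Proof.
have /andP[r10 r11] := r1b; have /andP[r20 r21] := r2b.
have half01 : 0 < (2^-1 : R) <= 1 by rewrite invr_gt0 ltr0Sn /=; lra.
have hq : 1 <= q + 1 by rewrite lerDr (ltW q0).
have hsq : (1 - s) * q <= q.
  by rewrite -[leRHS]mul1r ler_wpM2r ?(ltW q0)// gerBl (ltW s0).
have half1 : 1 - 2^-1 = 2^-1 :> R by field.
have small (r : R) : 0 <= r < 1 -> exists M : nat, r ^+ M <= 2^-1.
  move=> /andP[r0 r1']; have : r ^+ n @[n --> \oo] --> (0 : R) by apply: cvg_expr; rewrite ger0_norm.
  move/cvgr_le => /(_ 2^-1); rewrite invr_gt0 => /(_ (ltr0Sn _ 1)) [M _ /(_ M (leqnn M)) h].
  by exists M.
have [M1 hM1] := small _ r1b; have [M2 hM2] := small _ r2b.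
exists (M1 + M2 + 2)%N; split=> [|n i Mi iMn]; first by rewrite leq_addl.
set M := (M1 + M2 + 2)%N in Mi iMn *.
have pw (r : R) m m' : 0 <= r < 1 -> (m <= m')%N -> r ^+ m' <= r ^+ m.
  by move=> /andP[r0 r1'] mm; apply: ler_wiXn2l => //; exact: ltW.
have geo (r : R) m : 0 <= r < 1 -> r ^+ m <= 2^-1 -> 2^-1 * (1 - r)^-1 <= \sum_(0 <= l < m) r ^+ l.
  move=> /andP[r0 r1'] hm.
  have -> : \sum_(0 <= l < m) r ^+ l = (1 - r ^+ m) / (1 - r).
    have d : 1 - r != 0 by rewrite gt_eqF// subr_gt0.
    elim: m {hm} => [|m ih]; first by rewrite big_nil expr0 subrr mul0r.
    by rewrite big_nat_recr//= ih exprS; field.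
  by rewrite ler_wpM2r ?invr_ge0 ?subr_ge0 ?(ltW r1')//; lra.
have w0 k : 0 <= scale_weight s q (2 ^+ i / 2 ^+ k) by rewrite ltW// scale_weight_gt0// divr_gt0 ?exprn_gt0.
have in_ : (i < n)%N by apply: leq_ltn_trans iMn; rewrite leq_addr.
rewrite -(big_mkord xpredT (fun k => scale_weight s q (2 ^+ i / 2 ^+ k))).
rewrite (@big_cat_nat _ _ _ i.+1)//= /scale_sum mulrDr; apply: lerD.
  have -> : \sum_(0 <= k < i.+1) scale_weight s q (2 ^+ i / 2 ^+ k) = \sum_(0 <= l < i.+1) r1 ^+ l.
    rewrite big_nat_rev /= add0n; apply: eq_big_nat => l /andP[_ li].
    by rewrite scale_weightE subSS leq_subr subKn// -ltnS.
  apply: le_trans (geo _ i.+1 r1b _); last first.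
    apply: le_trans hM1; apply: pw => //; apply: leq_trans (leqW Mi).
    by rewrite /M -addnA leq_addr.
  rewrite ler_wpM2r ?invr_ge0 ?subr_ge0 ?(ltW r11)//.
  have h0 : 0 <= 2^-1 :> R by rewrite invr_ge0.
  rewrite -[leRHS](powRr1 h0); exact: ger_powR.
rewrite -[i.+1]add0n big_addn.
(* The terms with [k > i] start at exponent 1, which costs a factor [r2 >= 2 ^ - q]. *)
apply: (@le_trans _ _ (r2 * \sum_(0 <= l < M) r2 ^+ l)).
  have hM : r2 ^+ M <= 2^-1.
    by apply: le_trans hM2; apply: pw => //; rewrite /M addnAC leq_addl.
  apply: le_trans (ler_wpM2l r20 (geo _ _ r2b hM)); rewrite mulrA ler_wpM2r ?invr_ge0 ?subr_ge0 ?(ltW r21)//.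
  have h0 : 0 <= 2^-1 :> R by rewrite invr_ge0.
  have hn0 : 2^-1 != 0 :> R by rewrite invr_eq0.
  rewrite powRD ?hn0 ?implybT// powRr1// ler_wpM2r// /r2; exact: ger_powR.
have Mn : (M <= n - i.+1)%N by rewrite leq_subRL ?addSn// addnC in iMn *.
rewrite mulr_sumr (@big_cat_nat _ _ _ M 0 (n - i.+1))//=.
rewrite -[leLHS]addr0; apply: lerD; last by apply: sumr_ge0 => l _; exact: w0.
rewrite le_eqVlt; apply/orP; left; apply/eqP; apply: eq_big_nat => l _.
by rewrite scale_weightE leqNgt ?addnS ltnS leq_addl /= -?addSn addnK exprS.
Qed.

End sums.

Lemma sum_min_inv t K : 0 < t -> \sum_(k < K) Num.min (t * 2 ^+ k) (t * 2 ^+ k)^-1 <= 4.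
Proof.
move=> t0.
have up K' : \sum_(k < K') (if t * 2 ^+ k <= 1 then t * 2 ^+ k else 0) <= 2.
  elim: K' => [|K' ih]; first by rewrite big_ord0.
  rewrite big_ord_recr /=; case: ifPn => h; last by rewrite addr0.
  have : \sum_(k < K') (if t * 2 ^+ k <= 1 then t * 2 ^+ k else 0) <= t * 2 ^+ K'.
    apply: (@le_trans _ _ (\sum_(k < K') t * 2 ^+ k)).
      by apply: ler_sum => k _; case: ifP => // _; rewrite mulr_ge0 ?exprn_ge0// ltW.
    rewrite -mulr_sumr ler_wpM2l ?(ltW t0)//.
    elim: K' {ih h} => [|m ihm]; first by rewrite big_ord0 expr0.
    rewrite big_ord_recr /= exprS; have -> : 2 * 2 ^+ m = 2 ^+ m + 2 ^+ m :> R by ring.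
    by rewrite lerD2r.
  by move: (\sum_(k < K') _) => z; lra.
have down K' t' : 0 < t' -> \sum_(k < K') (if 1 < t' * 2 ^+ k then (t' * 2 ^+ k)^-1 else 0) <= 2.
  elim: K' t' => [|K' ih] t' t'0; first by rewrite big_ord0.
  have [h|h] := ltP 1 t'.
    apply: (@le_trans _ _ (\sum_(k < K'.+1) 2^-1 ^+ k)).
      apply: ler_sum => k _; case: ifP => _; last by rewrite exprn_ge0// invr_ge0.
      by rewrite invfM -exprVn ler_piMl ?exprn_ge0 ?invr_ge0// invf_le1// ltW.
    have w2 : 0 <= (2^-1 : R) < 1 by apply/andP; split; [rewrite invr_ge0|rewrite invf_lt1//; lra].
    rewrite -(big_mkord xpredT (fun k => 2^-1 ^+ k)); apply: le_trans (geometric_partial _ w2) _.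
    by rewrite (_ : 1 - 2^-1 = 2^-1) ?invrK//; field.
  rewrite big_ord_recl expr0 mulr1 ltNge h /= add0r.
  apply: le_trans (ih (t' * 2) _); last by rewrite mulr_gt0.
  by apply: ler_sum => k _; rewrite /bump add1n exprS mulrA.
apply: (@le_trans _ _ (\sum_(k < K) ((if t * 2 ^+ k <= 1 then t * 2 ^+ k else 0) +
   (if 1 < t * 2 ^+ k then (t * 2 ^+ k)^-1 else 0)))).
  apply: ler_sum => k _; case: leP => h; first by rewrite addr0 ge_min lexx.
  by rewrite add0r ge_min lexx orbT.
by rewrite big_split /=; have := up K; have := down K t t0; lra.
Qed.

End scale_weights.
(** * Lower bound by increments *)

Section lower_bound.
Variables (R : realType) (N : nat).
Local Notation V := 'rV[R]_N.
Local Notation mu := (@lebesgue_rV R N).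
Implicit Types (f g : V -> R) (a b p q s t nu : R).

Lemma Np_fdiff_pow2 p m h g : 1 <= p -> cls g ->
  Np p (fdiff (2 ^+ m *: h) g) <= (2 ^+ m) `^ p * Np p (fdiff h g).
Proof.
move=> p1 cg; have p0 : p != 0 by rewrite gt_eqF// (lt_le_trans ltr01).
have pp : 0 <= p by exact: le_trans p1.
rewrite -!(nm_pow _ p0) -powRM ?nm_ge0 ?exprn_ge0//; apply: powR_ler => //; first exact: nm_ge0.
elim: m => [|m ih]; first by rewrite expr0 mul1r scale1r.
have -> : fdiff (2 ^+ m.+1 *: h) g = fun x => fdiff (2 ^+ m *: h) g (x + 2 ^+ m *: h) + fdiff (2 ^+ m *: h) g x.
  by apply/funext => x; rewrite /fdiff exprS -scalerA scaler_nat mulr2n addrA addrA subrK.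
have c := cls_fdiff (2 ^+ m *: h) cg.
apply: le_trans (nm_triangle p1 (cls_shift (2 ^+ m *: h) c) c) _.
rewrite nm_shift// exprS -mulrA mulr_natl mulr2n; exact: lerD.
Qed.

Lemma fdiff0_Np p f : p != 0 -> Np p (fdiff 0 f) = 0.
Proof.
move=> p0; rewrite /Np -[RHS](@Int0 R N); apply: eq_Int => x.
by rewrite /fdiff addr0 subrr normr0 powR0.
Qed.

Lemma fam_fdiff1 g : cls g -> fam (fun x y => fdiff y g x).
Proof. by move=> cg; apply: (eq_fam _ (fam_fdiff 1 cg)) => x y; rewrite scale1r. Qed.

(* the [p]-th power of the Gagliardo seminorm, written with increments *)
Definition difference_energy p s f : \bar R :=
  (\int[mu]_h (Np p (fdiff h f) / eucl h `^ (N%:R + s * p))%:E)%E.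

Lemma measurable_difference_energy p s f : 1 <= p -> cls f ->
  measurable_fun setT (fun h : V => Np p (fdiff h f) / eucl h `^ (N%:R + s * p)).
Proof.
move=> p1 cf; apply: measurable_funM; first exact: (fam_Np_bound p1 (fam_fdiff1 cf)).1.
under eq_fun do rewrite -powRN.
apply: (measurableT_comp (measurable_powR _)); exact: measurable_eucl.
Qed.

Section pair.
Variables (eta phi : V -> R).
Hypothesis lp : lp_pair eta phi.

Let ce := lp_eta lp.
Let cp := lp_phi lp.

(** The kernel concentrates on steps [h] of size about [1 / b], so [b] is a frequency, not a
    length. *)
Definition diff_avg p b g := Int (fun h => `|dil b phi h| * Np p (fdiff h g)).

Lemma itg_diff_avg p b g : 1 <= p -> 0 < b -> cls g -> itg (fun h => `|dil b phi h| * Np p (fdiff h g)).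
Proof.
move=> p1 b0 cg; have ik := itg_norm (cls_itg (cls_dil b0 cp)).
exact: (fam_Np_itg p1 ik (fam_fdiff1 cg)).
Qed.

Lemma conv_vanish a b f x : 0 < b -> 4 * b <= a -> cls f ->
  conv (conv f (dil a eta)) (dil b phi) x = 0.
Proof.
move=> b0 ba cf; have a0 : 0 < a by apply: lt_le_trans ba; rewrite mulr_gt0.
have cE := cls_dil a0 ce; have cP := cls_dil b0 cp.
rewrite convA//.
have -> : conv (dil a eta) (dil b phi) = fun=> 0.
  have -> : dil a eta = dil b (dil (a / b) eta).
    by rewrite dil_dil mulrC divfK// gt_eqF.
  rewrite conv_dil//; [|exact/cls_dil/ce/divr_gt0|exact: cls_itg].
  apply/funext => y; rewrite /dil -/(dil _ _) (lp_vanish lp) ?mulr0//.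
  by rewrite ler_pdivlMr.
by rewrite /conv /avg -[RHS](@Int0 R N); apply: eq_Int => y; rewrite mul0r.
Qed.

(* [conv g (dil b phi) = 0] and [Int phi = 1] make [g] an average of its differences. *)
Lemma Np_le_diff_avg p a b f : 1 <= p -> 0 < b -> 4 * b <= a -> cls f ->
  Np p (conv f (dil a eta)) <= N1 phi `^ (p - 1) * diff_avg p b (conv f (dil a eta)).
Proof.
move=> p1 b0 ba cf; have a0 : 0 < a by apply: lt_le_trans ba; rewrite mulr_gt0.
have cE := cls_dil a0 ce; have cP := cls_dil b0 cp; have iP := cls_itg cP.
set g := conv f (dil a eta).
have cg : cls g by apply: cls_conv => //; exact: cls_itg.
have fg : fam (fun x y => g x - g (x - y)) by apply: famB; [exact: fam_cst|exact: fam_sub].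
have e : g = avg (dil b phi) (fun x y => g x - g (x - y)).
  apply/funext => x; rewrite /avg.
  transitivity (Int (fun y => g x * dil b phi y - dil b phi y * g (x - y))).
    rewrite IntB; [|exact: itgZ|exact: itg_conv1].
    rewrite IntZ// Int_dil//; last exact: cls_itg.
    have /(_ x) := conv_vanish _ b0 ba cf; rewrite -/g /conv /avg => ->.
    by rewrite (lp_int lp) mulr1 subr0.
  by apply: eq_Int => y; rewrite mulrBr mulrC.
rewrite {1}e; apply: le_trans (Np_avg p1 iP fg) _.
have -> : Int (fun y => `|dil b phi y|) = N1 phi by exact: (N1_dil b0 (cls_itg cp)).
rewrite ler_wpM2l ?powR_ge0// le_eqVlt; apply/orP; left; apply/eqP.
apply: eq_Int => y; congr (_ * _); rewrite -fdiffN_Np//.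
by apply: eq_Int => x; rewrite /fdiff distrC.
Qed.

Lemma diff_avg_pow2 p b m g : 1 <= p -> 0 < b -> cls g ->
  diff_avg p (b / 2 ^+ m) g <= (2 ^+ m) `^ p * diff_avg p b g.
Proof.
move=> p1 b0 cg; have m0 : 0 < 2 ^+ m :> R by rewrite exprn_gt0.
have bm : 0 < b / 2 ^+ m by exact: divr_gt0.
have mn0 : 2 ^+ m != 0 :> R by rewrite gt_eqF.
have i1 := itg_diff_avg p1 bm cg; have i2 := itg_affine 0 mn0 i1.
rewrite /diff_avg (Int_affine 0 mn0 i1) -(IntZ _ i2) -(IntZ _ (itg_diff_avg p1 b0 cg)).
apply: le_Int; [exact: itgZ|exact/itgZ/itg_diff_avg|].
move=> h; rewrite addr0 mulrA.
have -> : `|2 ^+ m| ^+ N * `|dil (b / 2 ^+ m) phi (2 ^+ m *: h)| = `|dil b phi h|.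
  rewrite /dil scalerA divfK// !normrM !normrX normf_div mulrA; congr (_ * _).
  by rewrite -exprMn normrX mulrC divfK// expf_neq0// normr_eq0.
rewrite [leRHS]mulrCA ler_wpM2l//; exact: Np_fdiff_pow2.
Qed.

(** The piece [g] lives at frequency [a = nu * 2 ^ i]. If [b = nu * 2 ^ k] satisfies [4 b <= a], its
    increments recover [g]; for larger [b] they are compared with those at [b / 2 ^ m], and the loss
    [(2 ^ m) ^ p] is paid by the minimum on the left. *)
Lemma Np_min_le_diff_avg p nu i k f : 1 <= p -> 0 < nu -> cls f ->
  Num.min 1 (2 ^+ i / 2 ^+ k) `^ p * Np p (conv f (dil (nu * 2 ^+ i) eta)) <=
  4 `^ p * N1 phi `^ (p - 1) * diff_avg p (nu * 2 ^+ k) (conv f (dil (nu * 2 ^+ i) eta)).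
Proof.
move=> p1 nu0 cf; have P m : (0 : R) < 2 ^+ m by rewrite exprn_gt0.
have pp : 0 <= p by exact: le_trans p1.
set g := conv f _.
have cg : cls g by apply: cls_conv => //; apply/cls_itg/cls_dil => //; exact: mulr_gt0.
have D0 b : 0 <= diff_avg p b g by apply: Int_ge0 => h; rewrite mulr_ge0 ?Np_ge0.
have Z0 : 0 <= N1 phi `^ (p - 1) by exact: powR_ge0.
(* Truncated: [m = 0] when [4 b <= a] already holds. The 2 stands for the factor 4. *)
pose m := (k + 2 - i)%N.
have key : Np p g <= N1 phi `^ (p - 1) * ((2 ^+ m) `^ p * diff_avg p (nu * 2 ^+ k) g).
  apply: (@le_trans _ _ (N1 phi `^ (p - 1) * diff_avg p (nu * 2 ^+ k / 2 ^+ m) g)); last first.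
    by rewrite ler_wpM2l// diff_avg_pow2// mulr_gt0.
  apply: Np_le_diff_avg => //; first by rewrite divr_gt0 ?mulr_gt0.
  have -> : 4 * (nu * 2 ^+ k / 2 ^+ m) = nu * (2 ^+ (k + 2) / 2 ^+ m).
    by rewrite exprD; move: (2 ^+ k) ((2 ^+ m)^-1) => u v; ring.
  rewrite ler_pM2l// ler_pdivrMr// -exprD.
  by rewrite ler_weXn2l ?ler1n// /m -leq_subLR.
have t0 : 0 <= Num.min 1 (2 ^+ i / 2 ^+ k : R) by rewrite le_min ler01 divr_ge0 ?(ltW (P _)).
apply: le_trans (ler_wpM2l (powR_ge0 _ _) key) _.
have AC (x z y w : R) : x * (z * (y * w)) = (x * y) * (z * w) by ring.
rewrite -[leRHS]mulrA AC ler_wpM2r ?mulr_ge0//.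
rewrite -powRM ?(ltW (P _))//; apply: powR_ler => //.
have [ik|ki] := leqP (k + 2) i.
  have -> : m = 0%N by apply/eqP; rewrite subn_eq0.
  by rewrite expr0 mulr1 ge_min; apply/orP; left; lra.
apply: (@le_trans _ _ (2 ^+ i / 2 ^+ k * 2 ^+ m)).
  by rewrite ler_wpM2r ?(ltW (P _))// ge_min lexx orbT.
rewrite mulrAC -exprD subnKC; last exact: ltnW.
by rewrite exprD mulrAC mulfV ?mul1r ?gt_eqF// expr2; lra.
Qed.

Lemma powR_weight_le (T e : R) m : 0 < T -> 1 <= e -> e + 1 <= m%:R ->
  T `^ e * ((1 + T) ^+ m)^-1 <= Num.min T T^-1.
Proof.
move=> T0 e1 em; have P : 0 < (1 + T) ^+ m by rewrite exprn_gt0// addr_gt0.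
have w1 : ((1 + T) ^+ m)^-1 <= 1.
  by rewrite invf_le1// exprn_ege1// lerDl ltW.
have w0 : 0 <= ((1 + T) ^+ m)^-1 by rewrite invr_ge0 ltW.
have small : T <= 1 -> T `^ e * ((1 + T) ^+ m)^-1 <= T.
  move=> T1; apply: (@le_trans _ _ (T `^ e)); first by rewrite ler_piMr ?powR_ge0.
  by rewrite -[leRHS](powRr1 (ltW T0)); apply: ger_powR => //; rewrite T0.
have big : 1 <= T -> T `^ e * ((1 + T) ^+ m)^-1 <= T^-1.
  move=> T1; have Tm : 0 < T ^+ m by rewrite exprn_gt0.
  apply: (@le_trans _ _ (T `^ e * (T ^+ m)^-1)).
    by rewrite ler_wpM2l ?powR_ge0// lef_pV2 ?posrE// lerXn2r ?nnegrE ?addr_ge0 ?(ltW T0)// lerDr.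
  rewrite -(powR_mulrn m (ltW T0)) -powRN -powRD ?(gt_eqF T0) ?implybT// -[leRHS](powR_inv1 (ltW T0)).
  by apply: ler_powR => //; lra.
rewrite le_min; apply/andP; case: (leP T 1) => [T1|/ltW T1].
- split; first exact: small.
  by apply: le_trans (small T1) _; exact: (le_trans T1 (eq_ind_r is_true T1 (invf_ge1 T0))).
- split; last exact: big.
  by apply: le_trans (big T1) _; exact: (le_trans (eq_ind_r is_true T1 (invf_le1 T0)) T1).
Qed.

(** The identity behind the form of [scale_weight]: after Jensen with exponent [p / q] the weight
    reappears with power 1 and can be summed over the steps. *)
Lemma scale_weight_exponents s p q b t : 0 < b -> 0 < t -> q != 0 ->
  b `^ (s * p) * (scale_weight s q t `^ (1 - p / q) * Num.min 1 t `^ p) =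
  (b * t) `^ (s * p) * scale_weight s q t.
Proof.
move=> b0 t0 q0; have mt : 0 < Num.min 1 t by rewrite lt_min ltr01.
have pD (x y z : R) : 0 < z -> z `^ (x + y) = z `^ x * z `^ y.
  by move=> z0; rewrite powRD// (gt_eqF z0) implybT.
rewrite /scale_weight powRM ?powR_ge0// -!powRrM powRM ?(ltW b0) ?(ltW t0)// -!mulrA; congr (_ * _).
have -> : q * (1 - p / q) = q - p by field.
have -> : - (s * q) * (1 - p / q) = s * p - s * q by field.
rewrite mulrCA -pD// subrK (pD (s * p))// -mulrA; congr (_ * _); exact: mulrC.
Qed.

Hypothesis hN : (1 <= N)%N.
Hypothesis decay : forall m, exists2 C : R, 0 <= C & forall x, `|phi x| <= C * weight m x.

(** With [T = b |h|], each term is up to a constant [|h| ^ - (N + s p)] times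
    [T ^ (N + s p) / (1 + T) ^ m], and the last quotient is at most [min(T, 1 / T)]. As [N >= 1],
    the exponent of [T] is at least 1 even when [s] tends to 0, so the sum over scales costs no
    factor [1 / s]. *)
Lemma dyadic_kernel_sum p : 0 < p -> exists2 C : R, 0 <= C &
  forall s nu K h, 0 < s < 1 -> 0 < nu -> h != 0 ->
  \sum_(k < K) (nu * 2 ^+ k) `^ (s * p) * `|dil (nu * 2 ^+ k) phi h| <= C * (eucl h `^ (N%:R + s * p))^-1.
Proof.
move=> p0; have [n pn] : exists n : nat, p <= n%:R.
  by exists (Num.trunc p).+1; rewrite ltW// truncnS_gt.
pose m := (N + n + 1)%N; have [C C0 hC] := decay m.
exists (C * N.+1%:R ^+ m * 4); first by rewrite !mulr_ge0// exprn_ge0.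
move=> s nu K h /andP[s0 s1] nu0 hn0.
have E0 : 0 < eucl h by apply: lt_le_trans (norm_le_eucl h); rewrite normr_gt0.
pose e := N%:R + s * p; have sp : 0 < s * p by exact: mulr_gt0.
have e1 : 1 <= e by rewrite -[leLHS]addr0; apply: lerD; [rewrite ler1n|exact: ltW].
have em : e + 1 <= m%:R.
  rewrite /m !natrD; apply: lerD => //; apply: lerD => //; apply: le_trans pn.
  by rewrite ler_piMl ?ltW.
have term k : (nu * 2 ^+ k) `^ (s * p) * `|dil (nu * 2 ^+ k) phi h| <=
    C * N.+1%:R ^+ m * (eucl h `^ e)^-1 *
    Num.min (nu * eucl h * 2 ^+ k) (nu * eucl h * 2 ^+ k)^-1.
  set b := nu * 2 ^+ k; have b0 : 0 < b by rewrite mulr_gt0 ?exprn_gt0.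
  have -> : nu * eucl h * 2 ^+ k = b * eucl h by rewrite /b mulrAC.
  have T0 : 0 < b * eucl h by exact: mulr_gt0.
  have hw : weight m (b *: h) <= N.+1%:R ^+ m * ((1 + b * eucl h) ^+ m)^-1.
    have X0 : 0 < (1 + `|b *: h|) ^+ m by rewrite exprn_gt0// ltr_wpDr.
    have Y0 : 0 < (1 + b * eucl h) ^+ m by rewrite exprn_gt0// ltr_wpDr// ltW.
    rewrite /weight ler_pdivlMr// mulrC ler_pdivrMr// -exprMn lerXn2r ?nnegrE ?mulr_ge0 ?addr_ge0 ?(ltW T0)//.
    rewrite normrZ gtr0_norm// mulrDr mulr1.
    apply: lerD; first by rewrite ler1n.
    by rewrite mulrCA ler_wpM2l ?(ltW b0)//; exact: eucl_le_norm.
  rewrite /dil normrM gtr0_norm ?exprn_gt0// mulrA.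
  have -> : b `^ (s * p) * b ^+ N = (eucl h `^ e)^-1 * (b * eucl h) `^ e.
    rewrite powRM ?(ltW b0) ?(ltW E0)// mulrCA mulVf ?mulr1; last by rewrite gt_eqF ?powR_gt0.
    by rewrite /e powRD ?(gt_eqF b0) ?implybT// powR_mulrn ?(ltW b0)// mulrC.
  have I0 : 0 <= (eucl h `^ e)^-1 by rewrite invr_ge0 powR_ge0.
  have A0 : 0 <= C * N.+1%:R ^+ m by rewrite mulr_ge0 ?exprn_ge0.
  apply: (@le_trans _ _ ((eucl h `^ e)^-1 * (b * eucl h) `^ e * (C * (N.+1%:R ^+ m * ((1 + b * eucl h) ^+ m)^-1)))).
    rewrite ler_wpM2l ?mulr_ge0 ?powR_ge0//; apply: le_trans (hC _) _.
    by rewrite ler_wpM2l.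
  have AC (x y z u w : R) : x * y * (z * (u * w)) = z * u * x * (y * w) by ring.
  rewrite AC ler_wpM2l ?mulr_ge0//; exact: powR_weight_le.
apply: le_trans (ler_sum _ (fun (k : 'I_K) _ => term k)) _.
rewrite -mulr_sumr [leRHS]mulrAC ler_wpM2l ?sum_min_inv ?mulr_gt0// ?mulr_ge0 ?exprn_ge0 ?invr_ge0 ?powR_ge0//.
Qed.

(** For each [h], [analysis] bounds the q-th powers of the pieces of [fdiff h f], and concave Jensen
    with weights [c j k] turns them into p-th powers. The sums of weights over [j] cost
    [S ^ (1 - r)], those over [k] return [S]; the quotient [S ^ r], with [r = p / q], is the
    gain. *)
Theorem difference_lower_bound p (L : R) : 1 < p -> 0 <= L -> lip L eta -> mom eta -> Int eta = 0 ->
  exists2 C : R, 0 < C & forall s f (lam : R) n, 0 < s < 1 -> cls f -> 0 < lam ->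
    ((scale_sum s (Num.max p 2) `^ (p / Num.max p 2) * \sum_(j < n) (lam * 2 ^+ j) `^ (s * p) *
       Np p (conv f (dil (lam * 2 ^+ j) eta)))%:E <= C%:E * difference_energy p s f)%E.
Proof.
move=> p1 L0 hL mh h0; set q := Num.max p 2.
have [CA CA0 hA] := analysis p1 ce L0 hL mh h0.
have p0 : 0 < p by exact: lt_trans p1.
have p1' := ltW p1.
have [CK CK0 hK] := dyadic_kernel_sum p0.
have q1 : 1 <= q by rewrite le_max p1'.
have q0 : 0 < q by exact: lt_le_trans q1.
have qn0 : q != 0 by rewrite gt_eqF.
have r01 : 0 < p / q <= 1 by rewrite divr_gt0//= ler_pdivrMr// mul1r le_max lexx.
set r := p / q in r01 *.
pose D := 4 `^ p * N1 phi `^ (p - 1).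
have D0 : 0 <= D by rewrite mulr_ge0 ?powR_ge0.
pose C' := 2 `^ (q + 1) * (D * CA `^ r).
have C'0 : 0 <= C' by rewrite !mulr_ge0 ?powR_ge0.
exists (C' * CK + 1); first by apply: ltr_wpDl => //; exact: mulr_ge0.
move=> s f lam n s01 cf lam0.
have [M [M2 hM]] := scale_weight_col_sum s01 q1.
have S0 := scale_sum_gt0 s01 q1; set S := scale_sum s q in hM S0 *.
have P m : (0 : R) < 2 ^+ m by rewrite exprn_gt0.
(* The averaging scales start [M] octaves below the lowest frequency, and [K] later leaves [M] above
   the highest, as [scale_weight_col_sum] requires. *)
pose nu := lam / 2 ^+ M; have nu0 : 0 < nu by rewrite divr_gt0.
have aE j : lam * 2 ^+ j = nu * 2 ^+ (j + M).
  by rewrite /nu addnC exprD mulrA divfK ?gt_eqF.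
pose g j := conv f (dil (lam * 2 ^+ j) eta).
have cg j : cls (g j) by apply/cls_conv/cls_itg/cls_dil/ce => //; exact: mulr_gt0.
pose t j k : R := 2 ^+ (j + M) / 2 ^+ k.
have t0 j k : 0 < t j k by exact: divr_gt0.
pose c j k := scale_weight s q (t j k).
have c0 j k : 0 < c j k by exact: scale_weight_gt0.
have step1 k h : \sum_(j < n) c j k `^ (1 - r) * Np p (fdiff h (g j)) <= S `^ (1 - r) * (CA `^ r * Np p (fdiff h f)).
  have pn0 : p != 0 by rewrite gt_eqF.
  (* Division by the weight makes [c j k * X j] the plain q-th power, to which [analysis]
     applies. *)
  pose X j := nm p (fdiff h (g j)) `^ q / c j k.
  have X0 j : 0 <= X j by rewrite divr_ge0 ?powR_ge0 ?ltW.
  have qr : q * r = p by rewrite /r mulrCA mulfV ?mulr1.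
  have nmr (u : V -> R) : (nm p u `^ q) `^ r = Np p u by rewrite -powRrM qr nm_pow.
  have cX j : c j k `^ (1 - r) * Np p (fdiff h (g j)) = c j k * X j `^ r.
    rewrite /X powRM ?powR_ge0 ?invr_ge0 ?(ltW (c0 _ _))// nmr mulrCA mulrC; congr (_ * _).
    rewrite -(powR_inv1 (ltW (c0 j k))) -powRrM mulN1r -[in RHS](powRr1 (ltW (c0 j k))) -powRrM mul1r -powRD//.
    by rewrite (gt_eqF (c0 j k)) implybT.
  rewrite (eq_bigr (fun j : 'I_n => c j k * X j `^ r)) => [|j _]; last exact: cX.
  apply: le_trans (jensen_sum_concave _ r01 (fun j : 'I_n => ltW (c0 j k)) (fun j : 'I_n => X0 j)) _.
  apply: ler_pM; rewrite ?powR_ge0//.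
    apply: powR_ler; [by rewrite subr_ge0; case/andP: r01|by apply: sumr_ge0 => j _; exact: ltW|].
    exact: scale_weight_row_sum.
  have CA0' := ltW CA0.
  rewrite -nmr -powRM ?powR_ge0//; apply: powR_ler; [by case/andP: r01 => /ltW|by apply: sumr_ge0 => j _; exact: mulr_ge0 (ltW (c0 j k)) (X0 j)|].
  apply: le_trans (hA lam n (fdiff h f) lam0 (cls_fdiff h cf)); apply: ler_sum => j _.
  rewrite /X mulrCA mulfV ?mulr1 ?gt_eqF// conv_fdiffl//.
  by apply/cls_itg/cls_dil/ce; exact: mulr_gt0.
pose b k := nu * 2 ^+ k; have b0 k : 0 < b k by exact: mulr_gt0.
have step2 k : \sum_(j < n) c j k `^ (1 - r) * diff_avg p (b k) (g j) <=
    S `^ (1 - r) * (CA `^ r * diff_avg p (b k) f).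
  rewrite mulrA -IntZ; last exact: itg_diff_avg.
  have ii j := itgZ (c j k `^ (1 - r)) (itg_diff_avg p1' (b0 k) (cg j)).
  rewrite (eq_bigr (fun j : 'I_n => Int (fun h => c j k `^ (1 - r) * (`|dil (b k) phi h| * Np p (fdiff h (g j)))))) => [|j _]; last first.
    by rewrite IntZ//; exact: itg_diff_avg.
  rewrite -Int_sum//; apply: le_Int.
  - by apply: itg_sum => j; exact: ii.
  - by apply: itgZ; exact: itg_diff_avg.
  move=> h.
  rewrite (eq_bigr (fun j : 'I_n => `|dil (b k) phi h| * (c j k `^ (1 - r) * Np p (fdiff h (g j))))) => [|j _]; last exact: mulrCA.
  rewrite -mulr_sumr; apply: le_trans (ler_wpM2l (normr_ge0 _) (step1 k h)) _.
  move: (S `^ (1 - r)) (CA `^ r) (Np p (fdiff h f)) `|dil (b k) phi h| => x1 x2 x3 x4.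
  by rewrite le_eqVlt; apply/orP; left; apply/eqP; ring.
pose X := \sum_(j < n) (lam * 2 ^+ j) `^ (s * p) * Np p (g j).
(* By [scale_weight_exponents] the weight now stands with power 1 in front of the pieces of [f], and
   the sum over [k] can act on it. *)
have step3 k : \sum_(j < n) (lam * 2 ^+ j) `^ (s * p) * Np p (g j) * c j k <=
    D * (S `^ (1 - r) * (CA `^ r * (b k `^ (s * p) * diff_avg p (b k) f))).
  apply: (@le_trans _ _ (b k `^ (s * p) * (D * (\sum_(j < n) c j k `^ (1 - r) * diff_avg p (b k) (g j))))).
    rewrite mulr_sumr mulr_sumr; apply: ler_sum => j _.
    have -> : (lam * 2 ^+ j) `^ (s * p) * Np p (g j) * c j k =
        b k `^ (s * p) * c j k `^ (1 - r) * (Num.min 1 (t j k) `^ p * Np p (g j)).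
      rewrite mulrAC mulrA; congr (_ * _).
      have -> : lam * 2 ^+ j = b k * t j k by rewrite aE /b /t -mulrA; congr (_ * _); rewrite mulrC divfK// gt_eqF.
      by rewrite -scale_weight_exponents// mulrA.
    rewrite -mulrA ler_wpM2l ?powR_ge0// [leRHS]mulrCA ler_wpM2l ?powR_ge0// /g aE.
    exact: Np_min_le_diff_avg.
  apply: le_trans (ler_wpM2l (powR_ge0 _ _) (ler_wpM2l D0 (step2 k))) _.
  move: (b k `^ (s * p)) (S `^ (1 - r)) (CA `^ r) (diff_avg p (b k) f) => x1 x2 x3 x4.
  by rewrite le_eqVlt; apply/orP; left; apply/eqP; ring.
pose K := (n + M + M)%N.
pose Y := \sum_(k < K) b k `^ (s * p) * diff_avg p (b k) f.
have step4 : S `^ r * X <= C' * Y.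
  have h1 : 2^-1 `^ (q + 1) * S * X <= D * (S `^ (1 - r) * (CA `^ r * Y)).
    rewrite /Y !mulr_sumr; apply: le_trans (ler_sum _ (fun (k : 'I_K) _ => step3 k)).
    rewrite exchange_big /=; apply: ler_sum => j _; rewrite -mulr_sumr mulrC.
    rewrite ler_wpM2l ?mulr_ge0 ?powR_ge0 ?Np_ge0//.
    by apply: hM; rewrite ?leq_addl// /K ltn_add2r ltn_add2r.
  have SE : S = S `^ (1 - r) * S `^ r.
    by rewrite -powRD ?subrK ?powRr1 ?(ltW S0)// gt_eqF ?implybT.
  have H0 : 0 < 2^-1 `^ (q + 1) :> R by rewrite powR_gt0// invr_gt0.
  have HE : 2 `^ (q + 1) = (2^-1 `^ (q + 1))^-1 :> R.
    by rewrite -powRN -(powR_inv1 (ler0n R 2)) -powRrM mulrNN mul1r.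
  have A0 : 0 < S `^ (1 - r) by exact: powR_gt0.
  rewrite /C' HE -mulrA ler_pdivlMl// -(ler_pM2l A0).
  move: h1; rewrite {1}SE => h1; apply: le_trans (le_trans h1 _).
    by rewrite le_eqVlt; apply/orP; left; apply/eqP; move: (S `^ r) (S `^ (1 - r)) (2^-1 `^ (q + 1)) => x1 x2 x3; ring.
  by rewrite le_eqVlt; apply/orP; left; apply/eqP; move: (CA `^ r) (S `^ (1 - r)) => x1 x2; ring.
have step5 : (Y%:E <= CK%:E * difference_energy p s f)%E.
  have YE : Y = Int (fun h => \sum_(k < K) b k `^ (s * p) * (`|dil (b k) phi h| * Np p (fdiff h f))).
    by rewrite Int_sum => [|k]; [apply: eq_bigr => k _; rewrite IntZ//|apply: itgZ]; exact: itg_diff_avg.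
  rewrite YE IntE; last by apply: itg_sum => k; apply: itgZ; exact: itg_diff_avg.
  have mE := measurable_difference_energy s p1' cf.
  rewrite /difference_energy -ge0_integralZl ?lee_fin//; first last.
  - by move=> h _; rewrite lee_fin divr_ge0 ?Np_ge0 ?powR_ge0.
  - exact/measurable_EFinP.
  apply: ge0_le_integral => //.
  - by move=> h _; rewrite lee_fin; apply: sumr_ge0 => k _; rewrite !mulr_ge0 ?powR_ge0 ?Np_ge0.
  - apply/measurable_EFinP/measurable_sum => k; apply: measurable_funM => //.
    exact: (itg_meas (itg_diff_avg p1' (b0 k) cf)).
  - by apply: measurable_funeM; exact/measurable_EFinP.
  move=> h _; rewrite -EFinM lee_fin.
  have [->|hn0] := eqVneq h 0.
    rewrite fdiff0_Np ?gt_eqF// mul0r mulr0 big1// => k _; by rewrite !mulr0.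
  rewrite mulrCA (eq_bigr (fun k : 'I_K => Np p (fdiff h f) * (b k `^ (s * p) * `|dil (b k) phi h|))) => [|k _]; last first.
    by rewrite [RHS]mulrC -mulrA.
  by rewrite -mulr_sumr ler_wpM2l ?Np_ge0// hK.
have G0 : (0 <= difference_energy p s f)%E.
  by apply: integral_ge0 => h _; rewrite lee_fin divr_ge0 ?Np_ge0 ?powR_ge0.
apply: (@le_trans _ _ (C' * Y)%:E); first by rewrite lee_fin.
rewrite EFinM; apply: (@le_trans _ _ (C'%:E * (CK%:E * difference_energy p s f))%E).
  by apply: lee_wpmul2l; rewrite ?lee_fin.
by rewrite muleA -EFinM lee_wpmul2r// lee_fin lerDl.
Qed.

End pair.
End lower_bound.
(** * Increments at a fixed step *)

Section upper_bound.
Variables (R : realType) (N : nat).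
Local Notation V := 'rV[R]_N.
Local Notation mu := (@lebesgue_rV R N).
Implicit Types (f g : V -> R) (h : V) (a b p q s t nu : R).

Lemma scale_weight_double s q t t' : 0 < s -> 0 <= q -> 0 < t -> t <= t' <= 2 * t ->
  scale_weight s q t' <= 2 `^ q * scale_weight s q t.
Proof.
move=> s0 q0 t0 /andP[tt' t't]; have t'0 : 0 < t' by exact: lt_le_trans tt'.
have m0 : 0 <= Num.min 1 t by rewrite le_min ler01 ltW.
have m0' : 0 <= Num.min 1 t' by rewrite le_min ler01 ltW.
rewrite /scale_weight mulrA -powRM//; apply: ler_pM; rewrite ?powR_ge0//.
  apply: powR_ler => //; rewrite ge_min; case: (leP t 1) => t1.
    by apply/orP; right.
  by apply/orP; left; lra.
rewrite !powRN lef_pV2 ?posrE ?powR_gt0//; apply: powR_ler => //; last exact: ltW.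
by rewrite mulr_ge0// ltW.
Qed.

Lemma dyadic_between t : 0 < t -> exists i k : nat, 2 ^+ i / 2 ^+ k <= t <= 2 * (2 ^+ i / 2 ^+ k).
Proof.
move=> t0; have P m : (0 : R) < 2 ^+ m by rewrite exprn_gt0.
have [t1|t1] := leP 1 t.
  have [k [k1 k2]] := dyadic_above t; exists k, 1%N; rewrite expr1; apply/andP; split.
    case: k2 => [->|k2]; first by rewrite expr0; lra.
    by rewrite ler_pdivrMr// mulrC.
  by rewrite mulrC divfK.
have [k [k1 k2]] := dyadic_above t^-1; exists 0%N, k; rewrite expr0 mul1r; apply/andP; split.
  by rewrite -[leRHS]invrK lef_pV2 ?posrE ?invr_gt0.
case: k2 => [k0|k2].
  by move: k1; rewrite k0 expr0 invf_le1// leNgt t1.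
by rewrite ler_pdivlMr// mulrC -ler_pdivlMr.
Qed.

Lemma scale_weight_sum s q t n : 0 < s < 1 -> 1 <= q -> 0 < t ->
  \sum_(j < n) scale_weight s q (2 ^+ j * t) <= 2 `^ q * scale_sum s q.
Proof.
move=> s01 q1 t0; have [i [k /andP[h1 h2]]] := dyadic_between t0.
have q0 : 0 <= q by exact: le_trans q1.
have P m : (0 : R) < 2 ^+ m by rewrite exprn_gt0.
have s0 : 0 < s by case/andP: s01.
apply: (@le_trans _ _ (\sum_(j < n) 2 `^ q * scale_weight s q (2 ^+ (j + i) / 2 ^+ k))).
  apply: ler_sum => j _; rewrite exprD -mulrA; apply: scale_weight_double => //.
  by rewrite ler_pM2l// h1 mulrCA ler_pM2l.
by rewrite -mulr_sumr ler_wpM2l ?powR_ge0// scale_weight_row_sum.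
Qed.

(** Its dilate by [a] is [scale_weight s q (a |h|) / |h| ^ N]: integrated over the steps [h], all
    frequencies [a] give the same value. *)
Definition scale_kernel s q h := (`|h| ^+ N)^-1 * scale_weight s q `|h|.

Lemma measurable_scale_kernel s q : measurable_fun setT (scale_kernel s q).
Proof.
have mn := @measurable_norm_rV R N.
apply: measurable_funM.
  have -> : (fun h : V => (`|h| ^+ N)^-1) = (fun h => (`|h| `^ (- N%:R))).
    by apply/funext => h; rewrite powRN powR_mulrn.
  exact: (measurableT_comp (measurable_powR _) mn).
apply: measurable_funM; last exact: (measurableT_comp (measurable_powR _) mn).
apply: (measurableT_comp (measurable_powR _)); exact: measurable_minr.
Qed.

Lemma scale_kernel_ge0 s q h : 0 <= scale_kernel s q h.
Proof. by rewrite mulr_ge0 ?invr_ge0 ?exprn_ge0// /scale_weight mulr_ge0 ?powR_ge0. Qed.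

Lemma scale_kernel0 s q : 0 < q -> scale_kernel s q 0 = 0.
Proof.
move=> q0; rewrite /scale_kernel normr0 /scale_weight min_r// powR0 ?gt_eqF//.
by rewrite mul0r mulr0.
Qed.

(** Dyadic shells: those inside [|h| <= 1] sum with ratio [2 ^ (- (1 - s) q)], those outside with
    ratio [2 ^ (- s q)], which are the two halves of [scale_sum]. *)
Lemma scale_kernel_integral s q : 0 < s < 1 -> 1 <= q ->
  (\int[mu]_h (scale_kernel s q h)%:E <= (4 ^+ N * 2 `^ q * scale_sum s q)%:E)%E.
Proof.
move=> s01 q1; have /andP[s0 s1] := s01; have q0 : 0 < q by exact: lt_le_trans q1.
have P m : (0 : R) < 2 ^+ m by rewrite exprn_gt0.
have sq0 : 0 < s * q by exact: mulr_gt0.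
have s1' : 0 < 1 - s by rewrite subr_gt0.
have sq1 : 0 < (1 - s) * q by exact: mulr_gt0.
pose D := [set h : V | `|h| <= 1]; have mD : measurable D by exact: measurable_cube.
pose F1 h := scale_kernel s q h * \1_D h; pose F2 h := scale_kernel s q h * \1_(~` D) h.
have m1 : measurable_fun setT F1.
  by apply: measurable_funM; [exact: measurable_scale_kernel|exact: measurable_indic].
have m2 : measurable_fun setT F2.
  by apply: measurable_funM; [exact: measurable_scale_kernel|apply/measurable_indic/measurableC].
have F10 h : 0 <= F1 h by rewrite mulr_ge0// scale_kernel_ge0.
have F20 h : 0 <= F2 h by rewrite mulr_ge0// scale_kernel_ge0.
have E h : scale_kernel s q h = F1 h + F2 h.
  rewrite /F1 /F2 -mulrDr !indicE in_setC; case: (h \in D) => /=; ring.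
have h2 : (0 : R) <= 2^-1 by rewrite invr_ge0.
have b1 : (\int[mu]_h (F1 h)%:E <= (4 ^+ N * 2 `^ q / (1 - 2^-1 `^ ((1 - s) * q)))%:E)%E.
  pose w k : R := 2 ^+ k ^+ N * (2 / 2 ^+ k) `^ ((1 - s) * q).
  pose r k : R := 2 / 2 ^+ k.
  apply: le_trans (shell_bound (w := w) (r := r) m1 F10 _ _ _) _.
  - by move=> k; rewrite mulr_ge0 ?powR_ge0 ?exprn_ge0.
  - by move=> k; rewrite divr_gt0.
  - move=> h Fn0; have hD : D h.
      by apply: contrapT => nD; move: Fn0; rewrite /F1 indicE memNset// mulr0 eqxx.
    have hn0 : 0 < `|h|.
      by rewrite normr_gt0; apply: contraNneq Fn0 => ->; rewrite /F1 scale_kernel0// mul0r.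
    have hle : `|h| <= 1 by exact: hD.
    have [k [k1 k2]] := dyadic_above `|h|^-1; exists k.
    have hr : `|h| <= r k.
      rewrite /r ler_pdivlMr// mulrC -ler_pdivlMr//; case: k2 => [->|//].
      rewrite expr0; apply: (@le_trans _ _ (2 * 1)); first by lra.
      by rewrite ler_pM2l// invf_ge1.
    split=> //; rewrite /F1 indicE mem_set// mulr1 /scale_kernel /w.
    apply: ler_pM; rewrite ?invr_ge0 ?exprn_ge0//.
    + by rewrite /scale_weight mulr_ge0 ?powR_ge0.
    + by rewrite -exprVn lerXn2r ?nnegrE ?invr_ge0 ?(ltW (P _)).
    rewrite /scale_weight min_r// -powRD ?(gt_eqF hn0) ?implybT//.
    have -> : q + - (s * q) = (1 - s) * q by ring.
    by apply: powR_ler => //; exact: ltW.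
  rewrite (@eq_eseriesr _ _ (fun k => (4 ^+ N * 2 `^ ((1 - s) * q) * (2^-1 `^ ((1 - s) * q)) ^+ k)%:E)); last first.
    move=> k _; congr EFin; rewrite /w /r powRM ?invr_ge0 ?(ltW (P _))//.
    have -> : (2 ^+ k)^-1 `^ ((1 - s) * q) = (2^-1 `^ ((1 - s) * q)) ^+ k.
      rewrite -exprVn -(powR_mulrn k h2) -(powR_mulrn k (powR_ge0 _ _)) -!powRrM.
      by rewrite mulrC.
    rewrite mulrAC -exprMn.
    have -> : 2 ^+ k * (2 * (2 / 2 ^+ k)) = 4 :> R.
      by move: (gt_eqF (P k)); move: (2 ^+ k) => z /negbT z0; field.
    by rewrite mulrA.
  apply: le_trans (nneseries_geometric _ (half_pow_lt1 sq1)) _.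
    by rewrite mulr_ge0 ?powR_ge0 ?exprn_ge0.
  have /andP[_ lt1] := half_pow_lt1 sq1.
  rewrite lee_fin ler_wpM2r ?invr_ge0 ?subr_ge0 ?(ltW lt1)// ler_wpM2l ?exprn_ge0//.
  by apply: ler_powR; [lra|rewrite -[leRHS]mul1r ler_wpM2r ?(ltW q0)//; lra].
have b2 : (\int[mu]_h (F2 h)%:E <= (4 ^+ N * 2 `^ q / (1 - 2^-1 `^ (s * q)))%:E)%E.
  pose w k : R := (2 / 2 ^+ k) ^+ N * (2 / 2 ^+ k) `^ (s * q).
  pose r k : R := 2 ^+ k.
  apply: le_trans (shell_bound (w := w) (r := r) m2 F20 _ _ _) _.
  - by move=> k; rewrite mulr_ge0 ?powR_ge0 ?exprn_ge0// divr_ge0// ltW.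
  - by move=> k; exact: P.
  - move=> h Fn0; have hD : (~` D) h.
      by apply: contrapT => nD; move: Fn0; rewrite /F2 indicE memNset// mulr0 eqxx.
    have hle : 1 < `|h| by rewrite ltNge; apply/negP; exact: hD.
    have hn0 : 0 < `|h| by exact: lt_trans hle.
    have [k [k1 k2]] := dyadic_above `|h|; exists k.
    have hr : `|h|^-1 <= 2 / 2 ^+ k.
      rewrite ler_pdivlMr// mulrC ler_pdivrMr//; case: k2 => [->|//].
      by rewrite expr0; lra.
    split=> //; rewrite /F2 indicE mem_set// mulr1 /scale_kernel /w.
    apply: ler_pM; rewrite ?invr_ge0 ?exprn_ge0//.
    + by rewrite /scale_weight mulr_ge0 ?powR_ge0.
    + by rewrite -[leLHS]exprVn lerXn2r ?nnegrE ?invr_ge0 ?divr_ge0 ?(ltW (P _)).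
    rewrite /scale_weight min_l ?(ltW hle)// powR1 mul1r.
    have -> : `|h| `^ (- (s * q)) = `|h|^-1 `^ (s * q).
      by rewrite -(powR_inv1 (ltW hn0)) -powRrM mulN1r.
    by apply: powR_ler; rewrite ?invr_ge0// ltW.
  rewrite (@eq_eseriesr _ _ (fun k => (4 ^+ N * 2 `^ (s * q) * (2^-1 `^ (s * q)) ^+ k)%:E)); last first.
    move=> k _; congr EFin; rewrite /w /r powRM ?invr_ge0 ?(ltW (P _))//.
    have -> : (2 ^+ k)^-1 `^ (s * q) = (2^-1 `^ (s * q)) ^+ k.
      rewrite -exprVn -(powR_mulrn k h2) -(powR_mulrn k (powR_ge0 _ _)) -!powRrM.
      by rewrite mulrC.
    rewrite mulrAC -exprMn.
    have -> : 2 / 2 ^+ k * (2 * 2 ^+ k) = 4 :> R.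
      by move: (gt_eqF (P k)); move: (2 ^+ k) => z /negbT z0; field.
    by rewrite mulrA.
  apply: le_trans (nneseries_geometric _ (half_pow_lt1 sq0)) _.
    by rewrite mulr_ge0 ?powR_ge0 ?exprn_ge0.
  have /andP[_ lt1] := half_pow_lt1 sq0.
  rewrite lee_fin ler_wpM2r ?invr_ge0 ?subr_ge0 ?(ltW lt1)// ler_wpM2l ?exprn_ge0//.
  by apply: ler_powR; [lra|rewrite -[leRHS]mul1r ler_wpM2r ?(ltW q0)//; exact: ltW].
under eq_integral do rewrite E EFinD.
rewrite ge0_integralD//; first last.
- exact/measurable_EFinP.
- by move=> h _; rewrite lee_fin.
- exact/measurable_EFinP.
- by move=> h _; rewrite lee_fin.
rewrite /scale_sum mulrDr addrC EFinD; exact: leeD.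
Qed.

Section pair.
Hypothesis hN : (1 <= N)%N.
Variables (eta phi : V -> R).
Hypothesis lp : lp_pair eta phi.
Let ce := lp_eta lp.
Let cp := lp_phi lp.

(** Since the fat kernel reproduces [eta], the difference can be put on that kernel; the minimum
    records its trivial bound and its [L^1] Lipschitz bound. *)
Lemma nm_conv_fdiff p h : 1 <= p -> exists2 C : R, 1 <= C & forall f a h, cls f -> 0 < a ->
  nm p (conv (fdiff h f) (dil a eta)) <= C * (Num.min 1 (a * `|h|) * nm p (conv f (dil a eta))).
Proof.
move=> p1; have [L L0 hL] := lip_fat lp; have cF := cls_fat lp.
exists (Num.max 1 (Num.max (2 * N1 (fat phi)) L)); first by rewrite le_max lexx.
set C := Num.max 1 _; move=> f a h' cf a0.
have cE := cls_dil a0 ce; have cEt := cls_dil a0 cF.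
have cg : cls (conv f (dil a eta)) by apply: cls_conv => //; exact: cls_itg.
have -> : conv (fdiff h' f) (dil a eta) = conv (conv f (dil a eta)) (fdiff h' (dil a (fat phi))).
  rewrite conv_fdiffl//; last exact: cls_itg.
  rewrite conv_fdiffr// convA// conv_dil_eta_fat//.
apply: le_trans (nm_conv p1 cg (cls_itg (cls_fdiff h' cEt))) _.
rewrite mulrA ler_wpM2r ?nm_ge0//; case: (leP 1 (a * `|h'|)) => h1.
  rewrite mulr1; apply: le_trans (N1_fdiff h' cEt) _; rewrite N1_dil//; last exact: cls_itg.
  by rewrite /C !le_max lexx orbT.
apply: le_trans (lip_dil h' a0 cF hL) _; rewrite -mulrA ler_wpM2r ?mulr_ge0 ?(ltW a0)//.
by rewrite /C !le_max lexx !orbT.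
Qed.

Lemma lip_fdiff (L : R) h f : cls f -> lip L f -> lip (2 * L) (fdiff h f).
Proof.
move=> cf hL z.
have -> : fdiff z (fdiff h f) = fdiff h (fdiff z f).
  by apply/funext => x; rewrite /fdiff [x + z + h]addrAC; ring.
by apply: le_trans (N1_fdiff h (cls_fdiff z cf)) _; rewrite -mulrA ler_pM2l.
Qed.

Lemma lp_scale_gt0 m j : 0 < lp_scale R m j.
Proof. by rewrite !mulr_gt0 ?exprn_gt0// invr_gt0. Qed.

(** [synthesis] for the increment, then convex Jensen. The splitting of [min(1, t) ^ q] as
    [scale_weight] times [t ^ (s q)] leaves the weight with power 1, ready to be integrated over
    [h], while the total mass of the weights gives [S ^ (r - 1)]. [T] is any finite bound that is
    uniform in the window [m]. *)
Lemma increment_upper_bound p : 1 < p -> exists2 K : R, 0 < K &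
  forall s f h (T : R), 0 < s < 1 -> cls f -> (exists L : R, lip L f) -> h != 0 -> 0 <= T ->
  (forall m, \sum_(j < m + m) scale_weight s (Num.min p 2) (lp_scale R m j * `|h|) *
     (lp_scale R m j `^ (s * p) * Np p (conv f (dil (lp_scale R m j) eta))) <= T) ->
  Np p (fdiff h f) <= K * scale_sum s (Num.min p 2) `^ (p / Num.min p 2 - 1) * (`|h| `^ (s * p) * T).
Proof.
move=> p1; have [C C0 hC] := synthesis hN lp p1; have p1' := ltW p1.
have [C1 C11 hC1] := nm_conv_fdiff 0 p1'.
set q := Num.min p 2 in hC *.
have q1 : 1 < q by rewrite lt_min p1 /=; lra.
have q0 : 0 < q by exact: lt_trans q1.
have qn0 : q != 0 by rewrite gt_eqF.
have p0 : 0 < p by exact: lt_trans p1.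
have pn0 : p != 0 by rewrite gt_eqF.
have r1 : 1 <= p / q by rewrite ler_pdivlMr// mul1r ge_min lexx.
set r := p / q in r1 *.
have r0 : 0 < r by exact: lt_le_trans r1.
have rn0 : r != 0 by rewrite gt_eqF.
have C10 : 0 < C1 by exact: lt_le_trans C11.
exists (C `^ r * C1 `^ p * (2 `^ q) `^ (r - 1)); first by rewrite !mulr_gt0 ?powR_gt0.
move=> s f h T s01 cf [L hL] hn0 T0 hT.
have h0 : 0 < `|h| by rewrite normr_gt0.
set S := scale_sum s q; have S0 : 0 < S by exact: scale_sum_gt0 s01 (ltW q1).
pose a := lp_scale R.
have a0 m j : 0 < a m j by exact: lp_scale_gt0.
pose U := (2 `^ q * S) `^ (r - 1) * (`|h| `^ (s * p) * T).
have U0 : 0 <= U by rewrite !mulr_ge0 ?powR_ge0.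
pose B := C1 `^ q * U `^ r^-1.
have qr : q * r = p by rewrite /r mulrCA mulfV ?mulr1.
have nmr (u : V -> R) : (nm p u `^ q) `^ r = Np p u by rewrite -powRrM qr nm_pow.
have sumB m : \sum_(j < m + m) nm p (conv (fdiff h f) (dil (lp_scale R m j) eta)) `^ q <= B.
  pose d j := nm p (conv f (dil (a m j) eta)) `^ q.
  pose t j := a m j * `|h|; have t0 j : 0 < t j by exact: mulr_gt0.
  pose Y := \sum_(j < m + m) Num.min 1 (t j) `^ q * d j.
  have mt0 j : 0 <= Num.min 1 (t j) by rewrite le_min ler01 ltW.
  have d0 j : 0 <= d j by exact: powR_ge0.
  have Y0 : 0 <= Y by apply: sumr_ge0 => j _; rewrite mulr_ge0 ?powR_ge0.
  apply: (@le_trans _ _ (C1 `^ q * Y)).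
    rewrite mulr_sumr; apply: ler_sum => j _; rewrite /d mulrA -!powRM ?mulr_ge0 ?nm_ge0 ?(ltW C10)//.
    by apply: powR_ler; [exact: ltW|exact: nm_ge0|rewrite -mulrA; exact: hC1].
  rewrite ler_wpM2l ?powR_ge0// -(powRK Y0 rn0); apply: powR_ler; rewrite ?invr_ge0 ?(ltW r0) ?powR_ge0//.
  pose c j := scale_weight s q (t j).
  pose X j := t j `^ (s * q) * d j.
  have c0 j : 0 <= c j by apply/ltW/scale_weight_gt0.
  have X0 j : 0 <= X j by rewrite mulr_ge0 ?powR_ge0.
  have cX j : c j * X j = Num.min 1 (t j) `^ q * d j.
    rewrite /c /X /scale_weight mulrA -[_ * _ * t j `^ _]mulrA -powRD ?(gt_eqF (t0 j)) ?implybT//.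
    by rewrite addNr powRr0 mulr1.
  have Xr j : X j `^ r = `|h| `^ (s * p) * (a m j `^ (s * p) * Np p (conv f (dil (a m j) eta))).
    rewrite /X powRM ?powR_ge0// /d nmr -powRrM -mulrA qr /t powRM ?(ltW (a0 _ _))//.
    by rewrite mulrCA mulrA.
  have YE : Y = \sum_(j < m + m) c j * X j by apply: eq_bigr => j _; rewrite cX.
  rewrite YE; apply: le_trans (jensen_sum _ r1 (fun j : 'I_(m + m) => c0 j) (fun j : 'I_(m + m) => X0 j)) _.
  apply: ler_pM; rewrite ?powR_ge0//.
  - by apply: sumr_ge0 => j _; rewrite mulr_ge0 ?powR_ge0.
  - apply: powR_ler; [by rewrite subr_ge0|by apply: sumr_ge0 => j _|].
    apply: le_trans (scale_weight_sum (m + m) s01 (ltW q1) (t := 2 * 2^-1 ^+ m * `|h|) _); last first.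
      by rewrite !mulr_gt0 ?exprn_gt0// invr_gt0.
    by apply: ler_sum => j _; rewrite /c /t /a /lp_scale mulrAC mulrC.
  rewrite (eq_bigr (fun j : 'I_(m + m) => `|h| `^ (s * p) * (c j * (a m j `^ (s * p) * Np p (conv f (dil (a m j) eta)))))) => [|j _]; last first.
    by rewrite Xr mulrCA.
  by rewrite -mulr_sumr ler_wpM2l ?powR_ge0//; exact: hT.
have B0 : 0 <= B by rewrite mulr_ge0 ?powR_ge0.
have := hC (fdiff h f) B (cls_fdiff h cf) (ex_intro (fun L => lip L (fdiff h f)) _ (lip_fdiff h cf hL)) B0 sumB.
move=> H; rewrite -nmr.
apply: (@le_trans _ _ ((C * B) `^ r)).
  by apply: powR_ler => //; [exact: ltW|exact: powR_ge0].
rewrite powRM ?(ltW C0)// /B powRM ?powR_ge0// -powRrM qr (powRVK U0 rn0) /U powRM ?powR_ge0 ?(ltW S0)//.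
rewrite le_eqVlt; apply/orP; left; apply/eqP.
move: (C `^ r) (C1 `^ p) ((2 `^ q) `^ (r - 1)) (S `^ (r - 1)) (`|h| `^ (s * p)) => x1 x2 x3 x4 x5; ring.
Qed.

End pair.
End upper_bound.
(** * Upper bound by increments *)

Section monotone_limits.
Variables (R : realType) (N : nat).
Local Notation V := 'rV[R]_N.
Local Notation mu := (@lebesgue_rV R N).

Lemma integral_sup_le (g : nat -> V -> R) : (forall m, measurable_fun setT (g m)) ->
  (forall m x, 0 <= g m x) -> (forall m x, g m x <= g m.+1 x) ->
  measurable_fun setT (fun x => ereal_sup (range (fun m => (g m x)%:E))) /\
  forall B : \bar R, (forall m, \int[mu]_x (g m x)%:E <= B)%E ->
    (\int[mu]_x ereal_sup (range (fun m => (g m x)%:E)) <= B)%E.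
Proof.
move=> mg g0 gS; pose u m x := (g m x)%:E.
have nd x : {homo u^~ x : n m / (n <= m)%N >-> (n <= m)%E}.
  by apply/nondecreasing_seqP => m; rewrite lee_fin.
have mu_ m : measurable_fun setT (u m) by exact/measurable_EFinP.
have cv x : u^~ x @ \oo --> ereal_sup (range (u^~ x)) by apply: ereal_nondecreasing_cvgn; exact: nd.
have ms : measurable_fun setT (fun x => ereal_sup (range (u^~ x))).
  exact: (emeasurable_fun_cvg u (fun x => ereal_sup (range (u^~ x))) mu_ (fun x _ => cv x)).
split=> // B hB.
have u0 n (x : V) : setT x -> (0 <= u n x)%E by move=> _; rewrite lee_fin.
have -> : (\int[mu]_x ereal_sup (range (u^~ x)) = \int[mu]_x limn (u^~ x))%E.
  by apply: eq_integral => x _; rewrite (cvg_lim _ (cv x)).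
rewrite (monotone_convergence mu measurableT mu_ u0 (fun x _ => nd x)).
apply: lime_le; last exact: nearW.
by apply: (cvgP _ (cvg_monotone_convergence measurableT mu_ u0 (fun x _ => nd x))).
Qed.

Lemma lp_scaleS m j : lp_scale R m.+1 j.+1 = lp_scale R m j.
Proof. by rewrite /lp_scale !exprS; move: (2^-1 ^+ m) (2 ^+ j) => x y; field. Qed.

(** From [m] to [m.+1] the window gains one scale at either end. *)
Lemma sum_lp_scaleS (G : R -> R) m : (forall a, 0 < a -> 0 <= G a) ->
  \sum_(j < m + m) G (lp_scale R m j) <= \sum_(j < m.+1 + m.+1) G (lp_scale R m.+1 j).
Proof.
move=> G0; rewrite addSn addnS big_ord_recr big_ord_recl /=.
rewrite (eq_bigr (fun j : 'I_(m + m) => G (lp_scale R m.+1 j.+1))) => [|j _]; last by rewrite lp_scaleS.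
by rewrite addrAC lerDr addr_ge0// G0// lp_scale_gt0.
Qed.

End monotone_limits.

Section difference_upper_bound.
Variables (R : realType) (N : nat).
Local Notation V := 'rV[R]_N.
Local Notation mu := (@lebesgue_rV R N).
Hypothesis hN : (1 <= N)%N.
Variables (eta phi : V -> R).
Hypothesis lp : lp_pair eta phi.

(** The bound at fixed [h] is integrated: every frequency contributes the same [Int F <= CF * S],
    which turns [S ^ (r - 1)] into [S ^ r]. *)
Theorem difference_upper_bound (p : R) : 1 < p -> exists2 C : R, 0 < C &
  forall (s : R) f (T : R), 0 < s < 1 -> cls f -> (exists L : R, lip L f) ->
  (forall m, \sum_(j < m + m) lp_scale R m j `^ (s * p) * Np p (conv f (dil (lp_scale R m j) eta)) <= T) ->
  (difference_energy p s f <= (C * scale_sum s (Num.min p 2) `^ (p / Num.min p 2) * T)%:E)%E.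
Proof.
move=> p1; have [K K0 hK] := increment_upper_bound hN lp p1; have p1' := ltW p1.
set q := Num.min p 2 in hK *; set r := p / q in hK *.
have q1 : 1 <= q by rewrite le_min p1' /=; lra.
have q0 : 0 < q by exact: lt_le_trans q1.
have p0 : 0 < p by exact: lt_trans p1.
pose CF := 4 ^+ N * 2 `^ q : R.
have CF0 : 0 < CF by rewrite mulr_gt0 ?powR_gt0// exprn_gt0.
exists (K * CF); first exact: mulr_gt0.
move=> s f T s01 cf lf hT; have S0 := scale_sum_gt0 s01 q1.
set S := scale_sum s q in hK S0 *; have /andP[s0 s1] := s01.
have T0 : 0 <= T by have := hT 0%N; rewrite big_ord0.
pose KS := K * S `^ (r - 1); have KS0 : 0 < KS by rewrite mulr_gt0 ?powR_gt0.
pose A a := a `^ (s * p) * Np p (conv f (dil a eta)).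
have A0 a : 0 <= A a by rewrite mulr_ge0 ?powR_ge0 ?Np_ge0.
pose F := @scale_kernel R N s q.
have dF a h : 0 < a -> dil a F h = (`|h| ^+ N)^-1 * scale_weight s q (a * `|h|).
  move=> a0; rewrite /dil /F /scale_kernel normrZ gtr0_norm// exprMn invfM !mulrA mulfV ?mul1r//.
  by rewrite gt_eqF// exprn_gt0.
have iF : itg F.
  apply: itg_lty; [exact: measurable_scale_kernel|exact: scale_kernel_ge0|].
  by apply: le_lt_trans (scale_kernel_integral _ s01 q1) _; exact: ltry.
have IF : Int F <= CF * S.
  by rewrite -lee_fin IntE//; exact: scale_kernel_integral.
pose g m h := KS * \sum_(j < m + m) A (lp_scale R m j) * dil (lp_scale R m j) F h.
have a0 := lp_scale_gt0 R.
have id_ a : 0 < a -> itg (dil a F).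
  move=> h; apply: itgZ; apply: (eq_itg _ (itg_affine 0 (lt0r_neq0 h) iF)) => x.
  by rewrite addr0.
have ig m : itg (g m) by apply: itgZ; apply: itg_sum => j; apply: itgZ; exact: id_.
have d0 a h : 0 < a -> 0 <= dil a F h.
  by move=> ha; rewrite mulr_ge0 ?exprn_ge0 ?scale_kernel_ge0// ltW.
have g0 m h : 0 <= g m h.
  by rewrite mulr_ge0 ?(ltW KS0)//; apply: sumr_ge0 => j _; rewrite mulr_ge0// d0.
have gS m h : g m h <= g m.+1 h.
  rewrite ler_pM2l//; apply: (@sum_lp_scaleS _ (fun a => A a * dil a F h)) => a ha.
  by rewrite mulr_ge0// d0.
have [msup hsup] := integral_sup_le (fun m => itg_meas (ig m)) g0 gS.
have mE := measurable_difference_energy s p1' cf.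
apply: (@le_trans _ _ (\int[mu]_h ereal_sup (range (fun m => (g m h)%:E)))%E); last first.
  apply: hsup => m; rewrite -IntE// lee_fin /g IntZ; last by apply: itg_sum => j; apply: itgZ; exact: id_.
  rewrite Int_sum; last by move=> j; apply: itgZ; exact: id_.
  apply: (@le_trans _ _ (KS * (T * (CF * S)))).
    rewrite ler_pM2l//; apply: (@le_trans _ _ ((\sum_(j < m + m) A (lp_scale R m j)) * (CF * S))).
      rewrite mulr_suml; apply: ler_sum => j _; rewrite IntZ; last exact: id_.
      by rewrite Int_dil// ler_wpM2l.
    by rewrite ler_wpM2r ?mulr_ge0 ?(ltW CF0) ?(ltW S0)//; exact: hT.
  have SE : S `^ r = S `^ (r - 1) * S by rewrite -{3}(powRr1 (ltW S0)) -powRD ?subrK// (gt_eqF S0) implybT.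
  rewrite SE /KS le_eqVlt; apply/orP; left; apply/eqP; move: (S `^ (r - 1)) => x; ring.
apply: ge0_le_integral => //.
- by move=> h _; rewrite lee_fin divr_ge0 ?Np_ge0 ?powR_ge0.
- exact/measurable_EFinP.
move=> h _.
have ub m : ((g m h)%:E <= ereal_sup (range (fun m => (g m h)%:E)))%E by apply: ereal_sup_ubound; exists m.
have [h0|hn0] := eqVneq h 0.
  rewrite h0 fdiff0_Np ?gt_eqF// mul0r -h0; apply: le_trans (ub 0%N); by rewrite lee_fin.
have nh0 : 0 < `|h| by rewrite normr_gt0.
(* The bound at fixed [h] needs a finite value; an infinite supremum leaves nothing to prove. *)
case El : (ereal_sup _) ub => [l||] ub.
- have hl m : g m h <= l by rewrite -lee_fin.
  have l0 : 0 <= l by exact: le_trans (g0 0%N h) (hl 0%N).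
  have Pn : 0 < `|h| ^+ N by exact: exprn_gt0.
  (* The factor [|h| ^ N / KS] undoes the normalisation of [g m h]. *)
  have := hK s f h (`|h| ^+ N * (l / KS)) s01 cf lf hn0.
  rewrite mulr_ge0 ?divr_ge0 ?(ltW KS0) ?(ltW Pn)// => /(_ isT) H.
  have {}H : Np p (fdiff h f) <= KS * (`|h| `^ (s * p) * (`|h| ^+ N * (l / KS))).
    apply: H => m.
    have := hl m; rewrite /g -ler_pdivlMl// [KS^-1 * l]mulrC => H2.
    rewrite -ler_pdivrMl//; apply: le_trans H2; rewrite mulr_sumr; apply: ler_sum => j _.
    have AC (x y z : R) : x * (y * z) = z * (x * y) by ring.
    by rewrite dF// le_eqVlt; apply/orP; left; apply/eqP; exact: AC.
  rewrite lee_fin; have E0 : 0 < eucl h by exact: lt_le_trans (norm_le_eucl h).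
  rewrite ler_pdivrMr ?powR_gt0//; apply: (le_trans H).
  have -> : KS * (`|h| `^ (s * p) * (`|h| ^+ N * (l / KS))) = l * `|h| `^ (N%:R + s * p).
    rewrite powRD ?(gt_eqF nh0) ?implybT// powR_mulrn ?(ltW nh0)//.
    by move: (lt0r_neq0 KS0) (`|h| `^ (s * p)) (`|h| ^+ N) => k0 x y; field.
  rewrite ler_wpM2l//; apply: powR_ler; rewrite ?norm_le_eucl//.
  by rewrite addr_ge0// mulr_ge0// ltW.
- exact: leey.
by have := ub 0%N; rewrite leeNy_eq.
Qed.

End difference_upper_bound.
(** * Complex absolute values and dyadic exponents *)

Section complex_norm.
Variable R : realType.
Local Notation cabs a b := (Normc.normc (Complex a b)).
Implicit Types a b p : R.

Lemma normc_sub (z w : R[i]) :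
  Normc.normc (z - w) = cabs (complex.Re z - complex.Re w) (complex.Im z - complex.Im w).
Proof. by case: z; case: w. Qed.

Lemma le_normc a b : `|a| <= cabs a b /\ `|b| <= cabs a b.
Proof.
rewrite /= -!sqrtr_sqr; split; apply: ler_wsqrtr; [rewrite lerDl|rewrite lerDr]; exact: sqr_ge0.
Qed.

Lemma normc_le a b : cabs a b <= `|a| + `|b|.
Proof.
rewrite /= -[leRHS]ger0_norm ?addr_ge0// -sqrtr_sqr; apply: ler_wsqrtr.
have S (x : R) : `|x| ^+ 2 = x ^+ 2 by rewrite -normrX ger0_norm// sqr_ge0.
rewrite sqrrD !S addrAC lerDl mulrn_wge0// mulr_ge0//.
Qed.

Lemma normc_ge0 a b : 0 <= cabs a b.
Proof. exact: sqrtr_ge0. Qed.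

Lemma normc_pow_ge p a b : 0 <= p -> `|a| `^ p + `|b| `^ p <= 2 * cabs a b `^ p.
Proof.
move=> p0; have [ha hb] := le_normc a b.
have := powR_ler p0 (normr_ge0 _) ha; have := powR_ler p0 (normr_ge0 _) hb.
move: (`|a| `^ p) (`|b| `^ p) (cabs a b `^ p) => x y z; lra.
Qed.

Lemma normc_pow_le p a b : 1 <= p -> cabs a b `^ p <= 2 `^ p * (`|a| `^ p + `|b| `^ p).
Proof.
move=> p1; have p0 : 0 <= p by exact: le_trans p1.
apply: le_trans (powR_ler p0 (normc_ge0 a b) (normc_le a b)) _.
apply: le_trans (powR_mean p1 (normr_ge0 a) (normr_ge0 b)) _.
rewrite ler_wpM2r ?addr_ge0 ?powR_ge0//; apply: ler_powR; [lra|by rewrite gerBl].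
Qed.

Lemma measurable_normc_pow d (T : measurableType d) p (u v : T -> R) :
  measurable_fun setT u -> measurable_fun setT v -> measurable_fun setT (fun x => cabs (u x) (v x) `^ p).
Proof.
move=> mu mv; apply: (measurableT_comp (measurable_powR _)).
have -> : (fun x => cabs (u x) (v x)) = (fun x => (u x ^+ 2 + v x ^+ 2) `^ 2^-1).
  by apply/funext => x; rewrite powR12_sqrt// addr_ge0 ?sqr_ge0.
apply: (measurableT_comp (measurable_powR _)).
by apply: measurable_funD; apply: measurable_funX.
Qed.

End complex_norm.

Section complex_norm_integral.
Variables (R : realType) (N : nat).
Local Notation V := 'rV[R]_N.
Local Notation cabs a b := (Normc.normc (Complex a b)).
Implicit Types u v : V -> R.

Lemma cls_normc_pow (p : R) u v : 1 <= p -> cls u -> cls v -> cls (fun x => cabs (u x) (v x) `^ p).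
Proof.
move=> p1 cu cv; have [_ [M hM] i] := clsZ (2 `^ p) (clsD (cls_pow p1 cu) (cls_pow p1 cv)).
have m : measurable_fun setT (fun x => cabs (u x) (v x) `^ p).
  by apply: measurable_normc_pow; apply: cls_meas.
have b x : `|cabs (u x) (v x) `^ p| <= 2 `^ p * (`|u x| `^ p + `|v x| `^ p).
  by rewrite ger0_norm ?powR_ge0//; exact: normc_pow_le.
split=> //; last exact: (le_itg m b i).
by exists M => x; apply: le_trans (b x) _; apply: le_trans (hM x); exact: ler_norm.
Qed.

Lemma Int_normc_pow_ge (p : R) u v : 1 <= p -> cls u -> cls v ->
  Np p u + Np p v <= 2 * Int (fun x => cabs (u x) (v x) `^ p).
Proof.
move=> p1 cu cv; have i := cls_itg (cls_normc_pow p1 cu cv).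
have iu := cls_itg (cls_pow p1 cu); have iv := cls_itg (cls_pow p1 cv).
rewrite /Np -IntD// -IntZ//; apply: le_Int; [exact: itgD|exact: itgZ|].
by move=> x; apply: normc_pow_ge; exact: le_trans p1.
Qed.

Lemma Int_normc_pow_le (p : R) u v : 1 <= p -> cls u -> cls v ->
  Int (fun x => cabs (u x) (v x) `^ p) <= 2 `^ p * (Np p u + Np p v).
Proof.
move=> p1 cu cv; have i := cls_itg (cls_normc_pow p1 cu cv).
have iu := cls_itg (cls_pow p1 cu); have iv := cls_itg (cls_pow p1 cv).
rewrite /Np -IntD// -IntZ; last exact: itgD.
by apply: le_Int => //; [apply/itgZ/itgD|move=> x; exact: normc_pow_le].
Qed.

End complex_norm_integral.

Section dyadic_exponents.
Variable R : realType.

Lemma lp_scale_exprz m j : lp_scale R m j = 2 ^ (j%:Z + 1 - m%:Z).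
Proof.
have h : (2 : R) \is a GRing.unit by rewrite unitfE.
rewrite /lp_scale !expfzDr// exprVn mulrAC [2 * _]mulrC.
by rewrite -exprnN.
Qed.

(** The terms are nonnegative, and every finite set of integers lies in some window from [1 - m] to
    [m]. *)
Lemma esum_lp_scale (G : R -> R) : (forall a, 0 < a -> 0 <= G a) ->
  \esum_(j in [set: int]) (G (2 ^ j))%:E = ereal_sup (range (fun m => (\sum_(j < m + m) G (lp_scale R m j))%:E)).
Proof.
move=> G0; have F0 (j : int) : (0 <= (G (2 ^ j))%:E)%E by rewrite lee_fin G0// exprz_gt0.
pose e m (j : nat) : int := j%:Z + 1 - m%:Z.
have window m : \sum_(j \in e m @` `I_(m + m)) (G (2 ^ j))%:E = (\sum_(j < m + m) G (lp_scale R m j))%:E.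
  rewrite (@reindex_fsbig _ _ _ _ _ (e m) `I_(m + m)); last first.
    split.
    - by move=> j hj /=; exists j.
    - by move=> i j _ _; rewrite /e => /(addIr _) /(addIr _) [].
    - by [].
  rewrite -(fsbig_ord _ _ (fun j : nat => (G (2 ^ e m j))%:E)) sumEFin; congr EFin.
  by apply: eq_bigr => j _; rewrite lp_scale_exprz.
have fin m : finite_set (e m @` `I_(m + m)) by apply: finite_image; exact: finite_II.
apply/eqP; rewrite eq_le; apply/andP; split.
  apply: ge_ereal_sup => _ [A [fA _] <-]; have /finite_seqP [X AX] := fA.
  (* Strictly above every [|i|], because the window reaches down to [1 - m] only. *)
  pose m := (\max_(i <- X) absz i).+1.
  apply: (@le_trans _ _ (\sum_(j < m + m) G (lp_scale R m j))%:E); last first.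
    by apply: ereal_sup_ubound; exists m.
  rewrite -window; apply: lee_fsum_nneg_subset => //.
  move=> j; rewrite inE AX /= => jX; rewrite inE.
  have jm : (absz j < m)%N by rewrite ltnS; exact: leq_bigmax_seq.
  case: j jm {jX} => n nm; rewrite ?NegzE /= in nm.
    exists (n + m).-1; first by move: (m) nm => M /= h; lia.
    by rewrite /e; move: (m) nm => M h; lia.
  by exists (m - n.+2)%N; rewrite /= /e ?NegzE; move: (m) nm => M h; lia.
apply: ge_ereal_sup => _ [m _ <-]; rewrite -window; apply: esum_ge.
by exists (e m @` `I_(m + m)) => //; split.
Qed.

End dyadic_exponents.
(** * Reduction to real and imaginary parts *)

Section complex_reduction.
Variables (R : realType) (N : nat).
Local Notation V := 'rV[R]_N.
Local Notation mu := (@lebesgue_rV R N).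
Local Notation cabs a b := (Normc.normc (Complex a b)).
Variables (eta : V -> R) (p s : R) (f : V -> R[i]).
Hypotheses (ce : cls eta) (p1 : 1 < p) (sf : schwartz f).

Let fr x := complex.Re (f x).
Let fi x := complex.Im (f x).
Let p1w : 1 <= p. Proof. exact: ltW. Qed.
Let p0 : 0 < p. Proof. exact: lt_trans p1. Qed.
Let cr : cls fr. Proof. exact: schwartz_cls sf.1. Qed.
Let ci : cls fi. Proof. exact: schwartz_cls sf.2. Qed.

Definition lp_sum g m := \sum_(j < m + m) lp_scale R m j `^ (s * p) * Np p (conv g (dil (lp_scale R m j) eta)).

Lemma lp_projectionE j x :
  lp_projection eta j f x = Complex (conv fr (dil (2 ^ j) eta) x) (conv fi (dil (2 ^ j) eta) x).
Proof.
have E : (2 : R) ^ (j * N%:Z) = (2 ^ j) ^+ N by rewrite -exprz_exp.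
rewrite /lp_projection /convolution /cintegral /conv /avg Int.unlock /fr /fi.
by congr Complex; apply: eq_Rintegral => y _; rewrite /dil -E; case: (f (x - y)) => a b /=; ring.
Qed.

Let piece a x := cabs (conv fr (dil a eta) x) (conv fi (dil a eta) x) `^ p.
Let pieces m x := \sum_(j < m + m) lp_scale R m j `^ (s * p) * piece (lp_scale R m j) x.

Let cls_conv_dil g a : cls g -> 0 < a -> cls (conv g (dil a eta)).
Proof. by move=> cg a0; apply: cls_conv => //; apply/cls_itg/cls_dil. Qed.

Let cls_piece a : 0 < a -> cls (piece a).
Proof. by move=> a0; apply: cls_normc_pow => //; apply: cls_conv_dil. Qed.

Let itg_term m j : itg (fun x => lp_scale R m j `^ (s * p) * piece (lp_scale R m j) x).
Proof. by apply/itgZ/cls_itg/cls_piece/lp_scale_gt0. Qed.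

Let itg_pieces m : itg (pieces m).
Proof. by apply: itg_sum => j; exact: itg_term. Qed.

Let Int_pieces m : Int (pieces m) = \sum_(j < m + m) lp_scale R m j `^ (s * p) * Int (piece (lp_scale R m j)).
Proof.
rewrite /pieces Int_sum => [|j]; last exact: itg_term.
by apply: eq_bigr => j _; rewrite IntZ//; apply/cls_itg/cls_piece/lp_scale_gt0.
Qed.

Lemma lp_sum_le m : lp_sum fr m + lp_sum fi m <= 2 * Int (pieces m).
Proof.
rewrite Int_pieces mulr_sumr /lp_sum -big_split /=; apply: ler_sum => j _.
rewrite -mulrDr mulrCA ler_wpM2l ?powR_ge0//; have a0 := lp_scale_gt0 R m j.
by apply: Int_normc_pow_ge => //; apply: cls_conv_dil.
Qed.

Lemma lp_sum_ge m : Int (pieces m) <= 2 `^ p * (lp_sum fr m + lp_sum fi m).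
Proof.
rewrite Int_pieces /lp_sum -big_split /= mulr_sumr; apply: ler_sum => j _.
rewrite -mulrDr mulrCA ler_wpM2l ?powR_ge0//; have a0 := lp_scale_gt0 R m j.
by apply: Int_normc_pow_le => //; apply: cls_conv_dil.
Qed.

Lemma lp_sum_ge0 g m : 0 <= lp_sum g m.
Proof. by apply: sumr_ge0 => j _; rewrite mulr_ge0 ?powR_ge0 ?Np_ge0. Qed.

(** For [p = q] the inner power is 1, and monotone convergence over the windows describes the p-th
    power of the seminorm by finite sums. [T] may be infinite. *)
Lemma triebel_lizorkin_sup : exists2 T : \bar R, triebel_lizorkin eta s p p f = (T `^ p^-1)%E &
  [/\ (0 <= T)%E, (forall m, (Int (pieces m))%:E <= T)%E &
      forall B : \bar R, (forall m, (Int (pieces m))%:E <= B)%E -> (T <= B)%E].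
Proof.
have G0 x a : 0 < a -> 0 <= a `^ (s * p) * piece a x by move=> _; rewrite mulr_ge0 ?powR_ge0.
pose W x := ereal_sup (range (fun m => (pieces m x)%:E)).
have WE x : (\esum_(j in [set: int]) ((2 : R) `^ (j%:~R * s * p) * Normc.normc (lp_projection eta j f x) `^ p)%:E = W x)%E.
  transitivity (\esum_(j in [set: int]) (((2 : R) ^ j) `^ (s * p) * piece (2 ^ j) x)%:E)%E; last exact: (esum_lp_scale (G0 x)).
  apply: eq_esum => j _; congr EFin.
  by rewrite lp_projectionE -mulrA [2 `^ _]powRrM powR_intmul.
have g0 m x : 0 <= pieces m x by apply: sumr_ge0 => j _; exact/G0/lp_scale_gt0.
have gS m x : pieces m x <= pieces m.+1 x by exact: (sum_lp_scaleS m (G0 x)).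
have [mW hW] := integral_sup_le (fun m => itg_meas (itg_pieces m)) g0 gS.
have W0 x : (0 <= W x)%E.
  by apply: (@le_trans _ _ (pieces 0 x)%:E); [rewrite lee_fin|apply: ereal_sup_ubound; exists 0%N].
exists (\int[mu]_x W x)%E.
  rewrite /triebel_lizorkin; congr (_ `^ _)%E; apply: eq_integral => x _.
  by rewrite WE divff ?gt_eqF// poweRe1.
split; [by apply: integral_ge0 => x _|move=> m|].
  rewrite IntE//; apply: ge0_le_integral => //.
  - by move=> x _; rewrite lee_fin.
  - by apply/measurable_EFinP; exact: (itg_meas (itg_pieces m)).
  - by move=> x _; apply: ereal_sup_ubound; exists m.
by move=> B hB; apply: hW => m; rewrite -IntE.
Qed.

(** The substitution [x = y + h] and Tonelli. The p-th power of the modulus is comparable to the sum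
    of those of the real and imaginary parts, with factors [2] and [2 ^ p]. *)
Lemma gagliardo_energy : exists2 G : \bar R, gagliardo s p f = (G `^ p^-1)%E &
  [/\ (0 <= G)%E, (difference_energy p s fr + difference_energy p s fi <= 2%:E * G)%E &
      (G <= (2 `^ p)%:E * (difference_energy p s fr + difference_energy p s fi))%E].
Proof.
pose e := N%:R + s * p.
pose D h y := cabs (fdiff h fr y) (fdiff h fi y) `^ p.
pose Q h y := (eucl h `^ e)^-1 * D h y.
have cD h : cls (D h) by apply: cls_normc_pow => //; exact: cls_fdiff.
have Q0 h y : 0 <= Q h y by rewrite mulr_ge0 ?invr_ge0 ?powR_ge0.
have mE : measurable_fun setT (fun h : V => (eucl h `^ e)^-1).
  under eq_fun do rewrite -powRN.
  by apply: (measurableT_comp (measurable_powR _)); exact: measurable_eucl.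
have mQ : mfun2 Q.
  have md g : cls g -> mfun2 (fun h y : V => fdiff h g y).
    move=> cg; apply: measurable_funB; last exact: (mfun2_y (cls_meas cg)).
    have := mfun2_comp 1 1 0 (cls_meas cg); congr (measurable_fun _ _); apply/funext => z.
    by rewrite !scale1r addr0 addrC.
  apply: measurable_funM; first exact: (mfun2_x mE).
  by apply: measurable_normc_pow; exact: md.
pose G := (\int[mu]_y \int[mu]_h (Q h y)%:E)%E.
have inner y : (\int[mu]_x (Normc.normc (f x - f y) `^ p / eucl (x - y) `^ e)%:E = \int[mu]_h (Q h y)%:E)%E.
  rewrite (@integral_affine R N 1 (- y) (fun h => (Q h y)%:E)) ?oner_eq0//; last first.
  - by move=> h; rewrite lee_fin.
  - by apply/measurable_EFinP; exact: (mfun2_r y mQ).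
  rewrite normr1 expr1n mul1e; apply: eq_integral => x _; congr EFin.
  rewrite scale1r /Q /D /fdiff [y + _]addrC subrK mulrC; congr (_ * _ `^ _).
  exact: normc_sub.
exists G; first by rewrite /gagliardo; congr (_ `^ _)%E; apply: eq_integral => y _; exact: inner.
have GE : G = (\int[mu]_h ((eucl h `^ e)^-1 * Int (D h))%:E)%E.
  rewrite /G -(@fubini_tonelli _ _ _ _ _ mu mu (fun z => (Q z.1 z.2)%:E)); first last.
  - by move=> z; rewrite lee_fin.
  - exact/measurable_EFinP.
  apply: eq_integral => h _ /=; rewrite -IntE; last exact/itgZ/cls_itg.
  by rewrite IntZ//; exact: cls_itg.
have mIQ : measurable_fun setT (fun h => (eucl h `^ e)^-1 * Int (D h)).
  have h1 : measurable_fun setT (fun h => Int (Q h)) by apply: (mfun_Int mQ) => h; exact/itgZ/cls_itg.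
  have -> // : (fun h => (eucl h `^ e)^-1 * Int (D h)) = fun h => Int (Q h).
  by apply/funext => h; rewrite IntZ//; exact: cls_itg.
have m1 := measurable_difference_energy s p1w cr.
have m2 := measurable_difference_energy s p1w ci.
have DE0 g h : (0 <= (Np p (fdiff h g) / eucl h `^ (N%:R + s * p))%:E)%E by rewrite lee_fin divr_ge0 ?Np_ge0 ?powR_ge0.
have sumE : (difference_energy p s fr + difference_energy p s fi =
    \int[mu]_h ((eucl h `^ e)^-1 * (Np p (fdiff h fr) + Np p (fdiff h fi)))%:E)%E.
  rewrite /difference_energy -ge0_integralD//; [|exact/measurable_EFinP|exact/measurable_EFinP].
  by apply: eq_integral => h _; rewrite -EFinD -mulrDl mulrC.
have msum : measurable_fun setT (fun h => (eucl h `^ e)^-1 * (Np p (fdiff h fr) + Np p (fdiff h fi))).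
  have := measurable_funD m1 m2; congr (measurable_fun _ _); apply/funext => h.
  by rewrite /= -mulrDl mulrC.
have I0 h : 0 <= Int (D h) by apply: Int_ge0 => y; exact: powR_ge0.
have E0 (h : V) : 0 <= (eucl h `^ e)^-1 by rewrite invr_ge0 powR_ge0.
split.
- by rewrite GE; apply: integral_ge0 => h _; rewrite lee_fin mulr_ge0.
- rewrite sumE GE -ge0_integralZl ?lee_fin//; [|exact/measurable_EFinP|by move=> h _; rewrite lee_fin mulr_ge0].
  apply: ge0_le_integral => //.
  + by move=> h _; rewrite lee_fin mulr_ge0// addr_ge0 ?Np_ge0.
  + exact/measurable_EFinP.
  + by apply: measurable_funeM; exact/measurable_EFinP.
  move=> h _; rewrite -EFinM lee_fin mulrCA ler_wpM2l//.
  by apply: Int_normc_pow_ge => //; exact: cls_fdiff.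
rewrite sumE GE -ge0_integralZl ?lee_fin ?powR_ge0//; [|exact/measurable_EFinP|by move=> h _; rewrite lee_fin mulr_ge0// addr_ge0 ?Np_ge0].
apply: ge0_le_integral => //.
- by move=> h _; rewrite lee_fin mulr_ge0.
- exact/measurable_EFinP.
- by apply: measurable_funeM; exact/measurable_EFinP.
move=> h _; rewrite -EFinM lee_fin mulrCA ler_wpM2l//.
by apply: Int_normc_pow_le => //; exact: cls_fdiff.
Qed.

Lemma difference_energy_ge0 (g : V -> R) : (0 <= difference_energy p s g)%E.
Proof. by apply: integral_ge0 => h _; rewrite lee_fin divr_ge0 ?Np_ge0 ?powR_ge0. Qed.

Lemma poweR_inv_le (a b : R) (X Y : \bar R) : 0 <= a -> 0 <= b -> (0 <= X)%E -> (0 <= Y)%E ->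
  (a%:E * X <= b%:E * Y)%E ->
  ((a `^ p^-1)%:E * X `^ p^-1 <= (b `^ p^-1)%:E * Y `^ p^-1)%E.
Proof.
move=> a0 b0 X0 Y0 h; rewrite -!poweR_EFin -!poweRM ?lee_fin//.
by apply: gt0_ler_poweR; rewrite ?invr_ge0 ?(ltW p0)// in_itv /= leey andbT mule_ge0 ?lee_fin.
Qed.

Lemma lower_transfer (S C : R) : 0 < S -> 0 < C ->
  (forall m, (S * lp_sum fr m)%:E <= C%:E * difference_energy p s fr)%E ->
  (forall m, (S * lp_sum fi m)%:E <= C%:E * difference_energy p s fi)%E ->
  ((S `^ p^-1)%:E * triebel_lizorkin eta s p p f <= ((2 `^ p * C * 2) `^ p^-1)%:E * gagliardo s p f)%E.
Proof.
move=> S0 C0 h1 h2; have [T -> [T0 _ hT]] := triebel_lizorkin_sup.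
have [G -> [G0 hG _]] := gagliardo_energy.
have P0 : 0 < 2 `^ p :> R by exact: powR_gt0.
apply: poweR_inv_le => //; [exact: ltW|by rewrite !mulr_ge0 ?(ltW P0) ?(ltW C0)|].
rewrite -lee_pdivlMl//; apply: hT => m; rewrite lee_pdivlMl// -EFinM.
apply: (@le_trans _ _ ((2 `^ p * (S * lp_sum fr m + S * lp_sum fi m))%:E)).
  rewrite lee_fin -mulrDr mulrCA ler_wpM2l ?(ltW S0)//; exact: lp_sum_ge.
rewrite EFinM EFinD; apply: (@le_trans _ _ ((2 `^ p)%:E * (C%:E * (difference_energy p s fr + difference_energy p s fi)))%E).
  apply: lee_wpmul2l; first by rewrite lee_fin ltW.
  by rewrite ge0_muleDr ?difference_energy_ge0//; exact: leeD.
rewrite !EFinM -!muleA; apply: lee_wpmul2l; first by rewrite lee_fin ltW.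
by apply: lee_wpmul2l => //; rewrite lee_fin ltW.
Qed.

Lemma upper_transfer (C : R) : 0 < C ->
  (forall T : R, (forall m, lp_sum fr m <= T) -> (difference_energy p s fr <= (C * T)%:E)%E) ->
  (forall T : R, (forall m, lp_sum fi m <= T) -> (difference_energy p s fi <= (C * T)%:E)%E) ->
  (gagliardo s p f <= ((2 `^ p * C * 4) `^ p^-1)%:E * triebel_lizorkin eta s p p f)%E.
Proof.
move=> C0 h1 h2; have [T -> [T0 hT _]] := triebel_lizorkin_sup.
have [G -> [G0 _ hG]] := gagliardo_energy.
have P0 : 0 < 2 `^ p :> R by exact: powR_gt0.
have K0 : 0 < 2 `^ p * C * 4 by rewrite !mulr_gt0.
have H : (1%:E * G <= (2 `^ p * C * 4)%:E * T)%E.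
  (* If the seminorm is infinite, so is the right side; otherwise twice its p-th power is the finite
     bound on all windows that the hypotheses ask for. *)
  rewrite mul1e; case: T T0 hT => [t t0 hT|_ _|//]; last by rewrite gt0_muley ?lte_fin// leey.
  have l1 m : lp_sum fr m <= 2 * t.
    apply: (@le_trans _ _ (2 * Int (pieces m))); last by rewrite ler_pM2l// -lee_fin.
    by apply: le_trans (lp_sum_le m); rewrite lerDl lp_sum_ge0.
  have l2 m : lp_sum fi m <= 2 * t.
    apply: (@le_trans _ _ (2 * Int (pieces m))); last by rewrite ler_pM2l// -lee_fin.
    by apply: le_trans (lp_sum_le m); rewrite lerDr lp_sum_ge0.
  apply: le_trans hG _; apply: (@le_trans _ _ ((2 `^ p)%:E * ((C * (2 * t))%:E + (C * (2 * t))%:E))%E).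
    by apply: lee_wpmul2l; [rewrite lee_fin ltW|apply: leeD; [exact: h1|exact: h2]].
  rewrite -EFinD -!EFinM lee_fin le_eqVlt; apply/orP; left; apply/eqP.
  by move: (2 `^ p) => x; ring.
have := poweR_inv_le ler01 (ltW K0) G0 T0 H.
by rewrite powR1 mul1e.
Qed.

End complex_reduction.

(** * From scale sums to powers of [s] and [1 - s] *)

Section constants.
Variable R : realType.
Implicit Types s q : R.

Lemma scale_sum_root_ge s q : 0 < s < 1 -> 1 <= q ->
  1 / s `^ (1 / q) + 1 / (1 - s) `^ (1 / q) <= 2 * q * scale_sum s q `^ q^-1.
Proof.
move=> s01 q1; have /andP[s0 s1] := s01; have q0 : 0 < q by exact: lt_le_trans q1.
have t0 : 0 < 1 - s by rewrite subr_gt0.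
have h := scale_sum_ge s01 q1; have S0 := scale_sum_gt0 s01 q1.
have key x : 0 < x -> x^-1 <= s^-1 + (1 - s)^-1 -> 1 / x `^ (1 / q) <= q * scale_sum s q `^ q^-1.
  move=> x0 hx; rewrite !div1r.
  have -> : (x `^ q^-1)^-1 = x^-1 `^ q^-1 by rewrite -powRN -(powR_inv1 (ltW x0)) -powRrM mulN1r.
  apply: (@le_trans _ _ ((q * scale_sum s q) `^ q^-1)).
    apply: powR_ler; rewrite ?invr_ge0 ?(ltW q0) ?(ltW x0)//.
    by apply: (le_trans hx); rewrite -ler_pdivrMl// mulrC.
  rewrite powRM ?(ltW q0) ?(ltW S0)// ler_wpM2r ?powR_ge0//.
  by rewrite -[leRHS](powRr1 (ltW q0)); apply: ler_powR => //; rewrite invf_le1.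
have a1 := key s s0; have a2 := key (1 - s) t0.
rewrite -mulrA mulr_natl mulr2n; apply: lerD; [apply: a1|apply: a2].
  by rewrite lerDl invr_ge0 ltW.
by rewrite lerDr invr_ge0 ltW.
Qed.

(** Monotonicity and subadditivity of the power [1 / q <= 1]. *)
Lemma scale_sum_root_le s q : 0 < s < 1 -> 1 <= q ->
  scale_sum s q `^ q^-1 <= 2 * (1 / s `^ (1 / q) + 1 / (1 - s) `^ (1 / q)).
Proof.
move=> s01 q1; have /andP[s0 s1] := s01; have q0 : 0 < q by exact: lt_le_trans q1.
have t0 : 0 < 1 - s by rewrite subr_gt0.
have h := scale_sum_le s01 q1; have S0 := scale_sum_gt0 s01 q1.
have V0 : 0 < q^-1 <= 1 by rewrite invr_gt0 q0 /= invf_le1.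
have inv x : 0 < x -> 1 / x `^ (1 / q) = x^-1 `^ q^-1.
  by move=> x0; rewrite !div1r -powRN -(powR_inv1 (ltW x0)) -powRrM mulN1r.
rewrite !inv//; have a0 : 0 <= s^-1 by rewrite invr_ge0 ltW.
have b0 : 0 <= (1 - s)^-1 by rewrite invr_ge0 ltW.
apply: le_trans (powR_ler _ (ltW S0) h) _; first by rewrite invr_ge0 ltW.
rewrite powRM ?addr_ge0//; apply: ler_pM; rewrite ?powR_ge0//; last exact: powR_subadd.
by rewrite -[leRHS](@powRr1 R 2)//; apply: ler_powR; [lra|case/andP: V0].
Qed.

End constants.
(** * Comparison of the seminorms *)

Section seminorm_comparison.
Variables (R : realType) (N : nat).
Local Notation V := 'rV[R]_N.
Hypothesis hN : (1 <= N)%N.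
Variable eta : V -> R.
Hypothesis heta : littlewood_paley_kernel eta.
Variable p : R.
Hypothesis p1 : 1 < p.

Let p0 : 0 < p. Proof. exact: lt_trans p1. Qed.

(** The p-th powers of the seminorms are compared with a factor [S ^ (p / q)], whose root is
    [S ^ (1 / q)]: [q = max(p, 2)] in the lower bound, [q = min(p, 2)] in the upper one. *)
Lemma root_exponent (S q : R) : 0 < q -> (S `^ (p / q)) `^ p^-1 = S `^ q^-1.
Proof. by move=> q0; rewrite -powRrM mulrAC divff ?gt_eqF// mul1r. Qed.

Lemma gagliardo_lower_bound : exists2 C : R, 0 < C & forall s (f : V -> R[i]), 0 < s < 1 -> schwartz f ->
  ((C^-1 * (1 / s `^ (1 / Num.max p 2) + 1 / (1 - s) `^ (1 / Num.max p 2)))%:E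
     * triebel_lizorkin eta s p p f <= gagliardo s p f)%E.
Proof.
have [phi lp decay] := lp_pair_exists heta; have [se _ _] := heta.
have ce := schwartz_cls se; have me := schwartz_mom se; have [L L0 hL] := schwartz_lip se.
have cp := lp_phi lp.
have h2 : (0 : R) < 2^-1 by rewrite invr_gt0.
have i0 : Int eta = 0.
  rewrite (eq_Int (lp_sub lp)) IntB; [|exact: cls_itg|exact/cls_itg/cls_dil].
  by rewrite Int_dil ?subrr//; exact: cls_itg.
have [C1 C10 hC1] := difference_lower_bound lp hN decay p1 L0 hL me i0.
set q := Num.max p 2 in hC1 *.
have q1 : 1 <= q by rewrite le_max (ltW p1).
have q0 : 0 < q by exact: lt_le_trans q1.
pose K := (2 `^ p * C1 * 2) `^ p^-1.
have K0 : 0 < K by rewrite powR_gt0// !mulr_gt0 ?powR_gt0.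
exists (2 * q * K); first by rewrite !mulr_gt0.
move=> s f s01 sf; have S0 := scale_sum_gt0 s01 q1; set S := scale_sum s q in hC1 S0 *.
have SP : 0 < S `^ (p / q) by exact: powR_gt0.
have low g : cls g -> forall m, ((S `^ (p / q) * lp_sum eta p s g m)%:E <= C1%:E * difference_energy p s g)%E.
  move=> cg m; apply: (hC1 s g (2 * 2^-1 ^+ m) (m + m)%N s01 cg).
  by rewrite mulr_gt0// exprn_gt0.
have cr := schwartz_cls sf.1; have ci := schwartz_cls sf.2.
have := lower_transfer ce p1 sf SP C10 (low _ cr) (low _ ci).
rewrite root_exponent// -/K => H.
have T0 : (0 <= triebel_lizorkin eta s p p f)%E by exact: poweR_ge0.
apply: (@le_trans _ _ ((K^-1 * S `^ q^-1)%:E * triebel_lizorkin eta s p p f)%E).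
  apply: lee_wpmul2r => //; rewrite lee_fin invfM mulrAC mulrC ler_wpM2l ?invr_ge0 ?(ltW K0)//.
  by rewrite ler_pdivrMl ?mulr_gt0//; exact: scale_sum_root_ge.
by rewrite EFinM -muleA lee_pdivrMl.
Qed.

Lemma gagliardo_upper_bound : exists2 C : R, 0 < C & forall s (f : V -> R[i]), 0 < s < 1 -> schwartz f ->
  (gagliardo s p f <= (C * (1 / s `^ (1 / Num.min p 2) + 1 / (1 - s) `^ (1 / Num.min p 2)))%:E
     * triebel_lizorkin eta s p p f)%E.
Proof.
have [phi lp _] := lp_pair_exists heta; have [se _ _] := heta.
have ce := schwartz_cls se.
have [C1 C10 hC1] := difference_upper_bound hN lp p1.
set q := Num.min p 2 in hC1 *.
have q1 : 1 <= q by rewrite le_min (ltW p1) /=; lra.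
have q0 : 0 < q by exact: lt_le_trans q1.
have P0 : 0 < 2 `^ p :> R by exact: powR_gt0.
pose K := (2 `^ p * C1 * 4) `^ p^-1.
have K0 : 0 < K by rewrite powR_gt0// !mulr_gt0.
exists (2 * K); first by rewrite mulr_gt0.
move=> s f s01 sf; have S0 := scale_sum_gt0 s01 q1; set S := scale_sum s q in hC1 S0 *.
have SP : 0 < S `^ (p / q) by exact: powR_gt0.
have up g : real_schwartz g -> forall T : R, (forall m, lp_sum eta p s g m <= T) ->
    (difference_energy p s g <= (C1 * S `^ (p / q) * T)%:E)%E.
  move=> sg T hT; have [L _ hL] := schwartz_lip sg.
  by apply: (hC1 s g T s01 (schwartz_cls sg)) => //; exists L.
have := upper_transfer ce p1 sf (mulr_gt0 C10 SP) (up _ sf.1) (up _ sf.2).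
have -> : 2 `^ p * (C1 * S `^ (p / q)) * 4 = 2 `^ p * C1 * 4 * S `^ (p / q).
  by move: (2 `^ p) (S `^ (p / q)) => x y; ring.
rewrite powRM ?(ltW SP)//; last by rewrite !mulr_ge0 ?ltW.
rewrite root_exponent// -/K => H; apply: (le_trans H).
apply: lee_wpmul2r; first exact: poweR_ge0.
by rewrite lee_fin [2 * K]mulrC -mulrA ler_wpM2l ?(ltW K0)//; exact: scale_sum_root_le.
Qed.

End seminorm_comparison.

Theorem theorem1p2 (R : realType) (N : nat) (hN : (1 <= N)%N)
    (eta : 'rV[R]_N -> R) (heta : littlewood_paley_kernel eta)
    (p : R) (hp : 1 < p) :
  exists2 C : R, 0 < C &
    forall (s : R) (f : 'rV[R]_N -> R[i]), 0 < s < 1 -> schwartz f ->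
      (p <= 2 ->
        ((C^-1 * (1 / s `^ (1 / 2) + 1 / (1 - s) `^ (1 / 2)))%:E
            * triebel_lizorkin eta s p p f <= gagliardo s p f)%E /\
        (gagliardo s p f <=
          (C * (1 / s `^ (1 / p) + 1 / (1 - s) `^ (1 / p)))%:E
            * triebel_lizorkin eta s p p f)%E) /\
      (2 <= p ->
        ((C^-1 * (1 / s `^ (1 / p) + 1 / (1 - s) `^ (1 / p)))%:E
            * triebel_lizorkin eta s p p f <= gagliardo s p f)%E /\
        (gagliardo s p f <=
          (C * (1 / s `^ (1 / 2) + 1 / (1 - s) `^ (1 / 2)))%:E
            * triebel_lizorkin eta s p p f)%E).
Proof.
have [C1 C10 lower] := gagliardo_lower_bound hN heta hp.
have [C2 C20 upper] := gagliardo_upper_bound hN heta hp.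
(* Both inequalities become weaker when the constant grows, so the sum serves for both. *)
exists (C1 + C2); first exact: addr_gt0.
move=> s f s01 sf; have /andP[s0 s1] := s01.
have T0 : (0 <= triebel_lizorkin eta s p p f)%E by exact: poweR_ge0.
have c0 x y : 0 <= 1 / s `^ x + 1 / (1 - s) `^ y by rewrite addr_ge0// divr_ge0// powR_ge0.
have low r : Num.max p 2 = r -> ((((C1 + C2)^-1 * (1 / s `^ (1 / r) + 1 / (1 - s) `^ (1 / r)))%:E
    * triebel_lizorkin eta s p p f) <= gagliardo s p f)%E.
  move=> <-; apply: le_trans (lower s f s01 sf); apply: lee_wpmul2r => //.
  by rewrite lee_fin ler_wpM2r// lef_pV2 ?posrE ?addr_gt0// lerDl ltW.
have up r : Num.min p 2 = r -> (gagliardo s p f <= ((C1 + C2) * (1 / s `^ (1 / r) + 1 / (1 - s) `^ (1 / r)))%:E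
    * triebel_lizorkin eta s p p f)%E.
  move=> <-; apply: le_trans (upper s f s01 sf) _; apply: lee_wpmul2r => //.
  by rewrite lee_fin ler_wpM2r// lerDr ltW.
split=> p2; split; [apply: low; exact: max_r|apply: up; exact: min_l|apply: low; exact: max_l|apply: up; exact: min_r].
Qed.
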